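(* For each natural number $k$, the pair of contravariant functors $\ast_{\mathcal G}[k]$ (sending a graded bundle $F$ of degree at most $k$ to $F^{\ast[k]}_{\mathcal G}$ and a morphism $f$ to $f^{\ast[k]}_{\mathcal G}$) and $\star_{\mathcal G}[k]$ (sending a free graded Weil algebra bundle $\mathbf A$ of order $k$ to $\mathbf A^{\star[k]}_{\mathcal G}$ and a morphism $\phi$ to $\phi^{\star[k]}_{\mathcal G}$) establishes a (contravariant) equivalence between the category $GB_k$ of graded bundles of degree $k$ and the category $FGWAB_k^\ast$ of free graded Weil algebra bundles of order $k$.
   Context: Algebras are real, commutative, associative, with unit; algebra homomorphisms preserve units; $\mathbb N=\{0,1,2,\dots\}$. **Graded bundles.** Let $\mathcal G=(\mathbb R,\cdot)$ be the multiplicative monoid of reals. A graded bundle is a smooth manifold $F$ with a smooth action $h:\mathbb R\times F\to F$ of $\mathcal G$ ($h_t\circ h_s=h_{ts}$, $h_1=\mathrm{id}$). Its base is $M=h_0(F)$, its projection is $h_0:F\to M$. It is locally trivial with one typical fibre: there is $\mathbf d=(d_1,\dots,d_r)$, $d_i\in\mathbb N$, such that locally over $M$ it is isomorphic to $U\times\mathbb R^{\mathbf d}$, $\mathbb R^{\mathbf d}=\mathbb R^{d_1}\times\dots\times\mathbb R^{d_r}$, with $h_t(x,y_1,\dots,y_r)=(x,ty_1,\dots,t^ry_r)$. It is of degree $k$ (meaning at most $k$) if one can take $r=k$. Morphisms are smooth maps intertwining the actions; such a map $f:F\to E$ covers a smooth map $\underline f$ of the bases. $GB_k$ is the category of graded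 bundles of degree (at most) $k$. **Algebras.** $\mathcal A(\mathbb R^{\mathbf d})=\mathbb R[y_i^a]$ ($1\le a\le d_i$) is the polynomial algebra with $y_i^a$ of weight $i$, and $\mathcal A^{>k}(\mathbb R^{\mathbf d})$ is the ideal spanned by elements of weight $>k$. A free graded Weil algebra of order $k$ is a graded algebra isomorphic to $\mathcal A^{[k]}(\mathbb R^{\mathbf d})=\mathcal A(\mathbb R^{\mathbf d})/\mathcal A^{>k}(\mathbb R^{\mathbf d})$ for some $\mathbf d=(d_1,\dots,d_k)$ (equivalently, a finite-dimensional graded local algebra concentrated in weights $0,\dots,k$ with homogeneous generators $y^1,\dots,y^N$ such that a nonzero weighted-homogeneous polynomial in them vanishes iff its weight is $>k$). Let $\mathbb A^{[k]}=\mathbb R[\varepsilon]/\langle\varepsilon^{k+1}\rangle$, graded by $\deg\varepsilon^i=i$, with $\mathcal G$-action $h_t(\varepsilon^i)=t^i\varepsilon^i$. **Bundles.** A free graded Weil algebra bundle of order $k$ over $M$ is a graded vector bundle $\mathbf A=\bigoplus_{i=0}^k\mathbf A^i$ locally trivialized as $U\times A$ with $A$ a free graded Weil algebra of order $k$ and smooth transition cocycles valued in graded algebra automorphisms of $A$. A Zakrzewski morphism $\psi$ from $E\to M$ to $F\to N$ consists of a smooth map $\underline\psi:N\to M$ and, for each $x\in N$, a degree-preserving linear map $\psi_x:E_{\underline\psi(x)}\to F_x$, such that the dual maps form a smooth vector bundle morphism $F^\ast\to E^\ast$ over $\underline\psi$. Morphisms in $FGWAB_k^\ast$ are Zakrzewski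 morphisms for which all $\psi_x$ are graded algebra homomorphisms. **Functors.** For $F\to M$ in $GB_k$, $F^{\ast[k]}_{\mathcal G}\to M$ has fibres $\mathrm{Hom}_{\mathcal G}(F_x,\mathbb A^{[k]})$, the algebra (pointwise operations) of smooth maps intertwining the actions; its degree-$i$ part ($0\le i\le k$) consists of maps valued in $\mathbb R\varepsilon^i$ and its smooth sections correspond to smooth functions $g$ on $F$ with $g\circ h_t=t^ig$. For $f:F\to E$ over $\underline f:M\to N$, $f^{\ast[k]}_{\mathcal G}$ is the Zakrzewski morphism from $E^{\ast[k]}_{\mathcal G}$ to $F^{\ast[k]}_{\mathcal G}$ over $\underline f$ given by $\alpha\mapsto\alpha\circ f_x$, $f_x:F_x\to E_{\underline f(x)}$. For $\mathbf A\to M$ in $FGWAB_k^\ast$, $\mathbf A^{\star[k]}_{\mathcal G}\to M$ has fibres $\mathrm{Hom}_{gr\text{-}alg}(\mathbf A_x,\mathbb A^{[k]})$ (graded algebra homomorphisms) with action $(h_t\psi)(a)=h_t(\psi(a))$; its smooth structure is induced from local trivializations by identifying $\psi$ with $\psi(y^a_i)=\lambda^a_i\varepsilon^i$ with $(\lambda^a_i)\in\mathbb R^{\mathbf d}$. For a morphism $\phi$ from $\mathbf B\to N$ to $\mathbf A\to M$ over $\underline\phi:M\to N$, $\phi^{\star[k]}_{\mathcal G}:\mathbf A^{\star[k]}_{\mathcal G}\to\mathbf B^{\star[k]}_{\mathcal G}$ is $\zeta\mapsto\zeta\circ\phi_x$ over $\underline\phi$. *)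

(* Defs.v *)
From HB Require Import structures.
From mathcomp Require Import all_boot all_order all_algebra.
From mathcomp Require Import generic_quotient ring_quotient qpoly.
From mathcomp Require Import boolp classical_sets functions reals.
From mathcomp Require Import topology normedtype landau derive.
From mathcomp Require Import -(notations) mpoly.

Set Implicit Arguments.
Unset Strict Implicit.
Unset Printing Implicit Defensive.

Import Order.TTheory GRing.Theory Num.Theory.
Import numFieldNormedType.Exports.

Local Open Scope classical_set_scope.
Local Open Scope ring_scope.
Local Open Scope quotient_scope.

Section GradedBundles.
Context (R : realType).

(* [Cdiff r U f]: the scalar function [f] is of class C^r on the open set [U];
   only used for open [U]. *)
Fixpoint Cdiff (r : nat) m (U : set 'rV[R]_m) (f : 'rV[R]_m -> R) : Prop :=
  match r with
  | 0 => forall x, U x -> {for x, continuous f}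
  | r'.+1 => (forall x, U x -> differentiable f x) /\
             (forall v, Cdiff r' U ('D_v f))
  end.

Definition smooth_fun m (U : set 'rV[R]_m) (f : 'rV[R]_m -> R) :=
  forall r, Cdiff r U f.

Definition smooth_map m n (U : set 'rV[R]_m) (g : 'rV[R]_m -> 'rV[R]_n) :=
  forall j, smooth_fun U (fun x => g x 0 j).

Lemma near_eq_differentiable (V W : normedModType R) (f g : V -> W) x :
  (\forall y \near x, f y = g y) -> differentiable f x -> differentiable g x.
Proof.
move=> fg df; have [dfc hf] := (diff_locallyP x f).1 df.
have {}hf := (eqaddoP _ _ _ _).1 hf.
have gE : g \o shift x = cst (g x) + 'd f x +o_ 0 id.
  apply/eqaddoP => e e0; have := hf e e0.
  have fg' : \forall h \near (0 : V), f (h + x) = g (h + x).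
    rewrite (near_shift x); near=> y; rewrite /= sub0r subrK.
    by near: y.
  have fgx := nbhs_singleton fg.
  move=> H; near=> h.
  have /= : `|(f \o shift x - (cst (f x) + 'd f x)) h| <= e * `|h| by near: h.
  rewrite !fctE /= -fgx.
  by rewrite (_ : f (h + x) = g (h + x)) //; near: h.
apply/diff_locallyP; split.
  by rewrite (diff_unique dfc gE).
by rewrite (diff_unique dfc gE).
Unshelve. all: by end_near. Qed.

Lemma near_eq_continuous (V W : normedModType R) (f g : V -> W) x :
  (\forall y \near x, f y = g y) -> {for x, continuous f} ->
  {for x, continuous g}.
Proof.
move=> fg; rewrite /prop_for /continuous_at -(nbhs_singleton fg).
by apply: cvg_trans; exact: near_eq_cvg.
Qed.

Lemma open_near_eq m (U : set 'rV[R]_m) (f g : 'rV[R]_m -> R) x :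
  open U -> (forall x, U x -> f x = g x) -> U x -> \forall y \near x, f y = g y.
Proof.
by move=> oU fg Ux; apply: filterS (open_nbhs_nbhs (conj oU Ux)) => y; exact: fg.
Qed.

Lemma Cdiff_ext r m (U : set 'rV[R]_m) f g :
  open U -> (forall x, U x -> f x = g x) -> Cdiff r U f -> Cdiff r U g.
Proof.
move=> oU; elim: r f g => [|r IH] f g fg /=.
  move=> cf x Ux; have nU := open_near_eq oU fg Ux.
  exact: near_eq_continuous nU (cf x Ux).
move=> [df Df]; split=> [x Ux|v].
  exact: near_eq_differentiable (open_near_eq oU fg Ux) (df x Ux).
apply: IH (Df v) => x Ux; apply: near_eq_derive => //.
exact: open_near_eq fg Ux.
Qed.

Lemma Cdiff_sub r m (U U' : set 'rV[R]_m) f :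
  U' `<=` U -> Cdiff r U f -> Cdiff r U' f.
Proof.
move=> sU; elim: r f => [|r IH] f /= => [cf x /sU|[df Df]]; first exact: cf.
by split=> [x /sU|v]; [exact: df | exact: IH].
Qed.

Lemma CdiffW r m (U : set 'rV[R]_m) f : Cdiff r.+1 U f -> Cdiff r U f.
Proof.
elim: r f => [|r IH] f [df Df] /=.
  by move=> x /df; exact: differentiable_continuous.
by split=> // v; apply: IH; exact: Df.
Qed.

Lemma Cdiff_cst r m (U : set 'rV[R]_m) a : Cdiff r U (fun=> a).
Proof.
elim: r a => [|r IH] a /=; first by move=> x _; exact: cst_continuous.
split=> [x _|v]; first exact: differentiable_cst.
rewrite (_ : 'D_v _ = fun=> 0); first exact: IH.
by apply/funext => x; exact: derive_cst.
Qed.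

Lemma CdiffD r m (U : set 'rV[R]_m) f g : open U ->
  Cdiff r U f -> Cdiff r U g -> Cdiff r U (fun x => f x + g x).
Proof.
move=> oU; elim: r f g => [|r IH] f g /=.
  by move=> cf cg x Ux; apply: continuousD; [exact: cf|exact: cg].
move=> [df Df] [dg Dg]; split=> [x Ux|v].
  by apply: differentiableD; [exact: df|exact: dg].
apply: Cdiff_ext (IH _ _ (Df v) (Dg v)) => // x Ux; apply/esym.
by apply: deriveD; apply: diff_derivable; [exact: df|exact: dg].
Qed.

Lemma CdiffM r m (U : set 'rV[R]_m) f g : open U ->
  Cdiff r U f -> Cdiff r U g -> Cdiff r U (fun x => f x * g x).
Proof.
move=> oU; elim: r f g => [|r IH] f g.
  by move=> cf cg x Ux; apply: continuousM; [exact: cf|exact: cg].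
move=> Cf Cg; move: (Cf) (Cg) => [df Df] [dg Dg]; split=> [x Ux|v].
  by apply: differentiableM; [exact: df|exact: dg].
apply: Cdiff_ext (CdiffD oU (IH _ _ (CdiffW Cf) (Dg v))
                            (IH _ _ (CdiffW Cg) (Df v))) => // x Ux; apply/esym.
by apply: deriveM; apply: diff_derivable; [exact: df|exact: dg].
Qed.

Lemma Cdiff_sum r m (U : set 'rV[R]_m) (I : Type) (s : seq I) (P : pred I)
    (F : I -> 'rV[R]_m -> R) :
  open U -> (forall i, Cdiff r U (F i)) ->
  Cdiff r U (fun x => \sum_(i <- s | P i) F i x).
Proof.
move=> oU CF; elim: s => [|i s IH].
  by under eq_fun do rewrite big_nil; exact: Cdiff_cst.
under eq_fun do rewrite big_cons; case: (P i) => //.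
exact: CdiffD.
Qed.

Lemma Cdiff_coord r m (U : set 'rV[R]_m) j : Cdiff r U (fun x => x 0 j).
Proof.
case: r => [|r] /=.
  by move=> x _; exact/differentiable_continuous/differentiable_coord.
split=> [x _|v]; first exact: differentiable_coord.
rewrite (_ : 'D_v _ = fun=> v 0 j); first exact: Cdiff_cst.
apply/funext => x; rewrite deriveE; last exact: differentiable_coord.
have lin : linear (fun x : 'rV[R]_m => x 0 j : R^o) by move=> a y z; rewrite !mxE.
pose L := GRing.isLinear.Build _ _ _ _ _ lin.
pose f : {linear 'rV[R]_m -> R^o} := HB.pack (fun x : 'rV[R]_m => x 0 j : R^o) L.
rewrite -[LHS]/('d f x v) diff_lin //.
exact: coord_continuous.
Qed.

Lemma differentiable_rowP m n (f : 'rV[R]_m -> 'rV[R]_n) x :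
  (forall j, differentiable (fun y => f y 0 j) x) -> differentiable f x.
Proof.
move=> df; have -> : f = \sum_(j < n) (fun y => f y 0 j *: delta_mx 0 j).
  by apply/funext => y; rewrite fct_sumE; exact: row_sum_delta.
by apply: differentiable_sum => j; exact: differentiableZl.
Qed.

Lemma continuous_rowP (V : normedModType R) n (f : V -> 'rV[R]_n) x :
  (forall j, {for x, continuous (fun y => f y 0 j)}) -> {for x, continuous f}.
Proof.
move=> cf; have -> : f = fun y => \sum_(j < n) f y 0 j *: delta_mx 0 j.
  by apply/funext => y; exact: row_sum_delta.
rewrite /prop_for /continuous_at; apply: cvg_big => [|j _].
  exact: add_continuous.
exact/continuousZr_tmp/cf.
Qed.

Lemma Cdiff_comp r m n (U : set 'rV[R]_m) (V : set 'rV[R]_n) f g :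
  open U -> (forall x, U x -> V (f x)) ->
  (forall j, Cdiff r U (fun x => f x 0 j)) -> Cdiff r V g ->
  Cdiff r U (g \o f).
Proof.
move=> oU UV; elim: r g => [|r IH] g Cf Cg.
  move=> x Ux; have cf := continuous_rowP (fun j => Cf j x Ux).
  exact: continuous_comp cf (Cg _ (UV _ Ux)).
have df x : U x -> differentiable f x.
  by move=> Ux; apply: differentiable_rowP => j; case: (Cf j) => d _; exact: d.
split=> [x Ux|v].
  by apply: differentiable_comp; [exact: df|apply: Cg.1; exact: UV].
have Cs j : Cdiff r U (fun x => 'D_v (fun y => f y 0 j) x *
                                 'D_(delta_mx 0 j) g (f x)).
  apply: CdiffM => //; first by case: (Cf j) => _; exact.
  by apply: (IH ('D_(delta_mx 0 j) g)) => [i|]; [exact: CdiffW|exact: Cg.2].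
apply: Cdiff_ext (Cdiff_sum (index_enum 'I_n) predT oU Cs) => // x Ux.
have dg : differentiable g (f x) by apply: Cg.1; exact: UV.
rewrite deriveE; last by apply: differentiable_comp => //; exact: df.
rewrite diff_comp //; last exact: df.
rewrite /= -(deriveE v (df x Ux)).
rewrite [in RHS](row_sum_delta ('D_v f x)) linear_sum.
apply: eq_bigr => j _; rewrite linearZ (deriveE _ dg) /=; congr (_ * _).
by rewrite (derive_mx (M := f)) ?mxE //; apply: diff_derivable; exact: df.
Qed.

Lemma smooth_map_comp m n p (U : set 'rV[R]_m) (V : set 'rV[R]_n)
    (f : 'rV[R]_m -> 'rV[R]_n) (g : 'rV[R]_n -> 'rV[R]_p) :
  open U -> (forall x, U x -> V (f x)) -> smooth_map U f -> smooth_map V g ->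
  smooth_map U (g \o f).
Proof.
move=> oU UV sf sg j r.
exact: (Cdiff_comp oU UV (fun i => sf i r) (sg j r)).
Qed.

Lemma smooth_map_sub m n (U U' : set 'rV[R]_m) (f : 'rV[R]_m -> 'rV[R]_n) :
  U' `<=` U -> smooth_map U f -> smooth_map U' f.
Proof. by move=> sU sf j r; exact: Cdiff_sub sU (sf j r). Qed.

Lemma smooth_map_continuous m n (U : set 'rV[R]_m) (f : 'rV[R]_m -> 'rV[R]_n) x :
  smooth_map U f -> U x -> {for x, continuous f}.
Proof. by move=> sf Ux; apply: continuous_rowP => j; exact: (sf j 0%N). Qed.

Lemma open_smooth_preimage m n (U : set 'rV[R]_m) (V : set 'rV[R]_n) f :
  open U -> open V -> smooth_map U f -> open (U `&` f @^-1` V).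
Proof.
move=> oU oV sf; rewrite openE => x [Ux Vfx].
have cf := smooth_map_continuous sf Ux.
apply: filterI; first exact: open_nbhs_nbhs.
by apply: cf; exact: open_nbhs_nbhs.
Qed.

(* Manifolds are given by atlases on bare sets: the topology is the one induced
   by the charts. *)

(* The values of [cmap] outside [cdom] are irrelevant. *)
Record chart (T : Type) := Chart {
  cdim : nat;
  cdom : set T;
  cmap : T -> 'rV[R]_cdim
}.

Record premfd := Premfd { pt :> Type; charts : set (chart pt) }.
Arguments charts : clear implicits.

(* Near [p], the map [f] read in the charts [c] and [c'], that is
   [c' \o f \o c^-1], is defined and smooth. *)
Definition local_rep T T' (c : chart T) (c' : chart T') (f : T -> T') (p : T) :=
  exists (V : set 'rV[R]_(cdim c)) (g : 'rV[R]_(cdim c) -> 'rV[R]_(cdim c')),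
    [/\ open V, V (cmap c p), smooth_map V g &
        forall q, cdom c q -> V (cmap c q) ->
          cdom c' (f q) /\ g (cmap c q) = cmap c' (f q)].

Definition smooth_at (M N : premfd) (f : M -> N) (p : M) :=
  forall c c', charts M c -> charts N c' -> cdom c p -> cdom c' (f p) ->
    local_rep c c' f p.

Definition smooth (M N : premfd) (f : M -> N) := forall p, smooth_at f p.

Definition mopen (M : premfd) (O : set M) :=
  forall c, charts M c -> open (cmap c @` (cdom c `&` O)).

Definition mhausdorff (M : premfd) := forall p q : M, p <> q ->
  exists O O' : set M, [/\ mopen O, mopen O', O p, O' q & O `&` O' = set0].

Definition second_countable_mfd (M : premfd) := exists B : nat -> set M,
  (forall i, mopen (B i)) /\
  forall O p, mopen O -> O p -> exists i, B i p /\ B i `<=` O.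

Definition mcover (M : premfd) := forall p : M, exists2 c, charts M c & cdom c p.

(* A smooth manifold: Hausdorff, second countable and of some pure dimension [n].
   [transition_smooth] says that all transition maps are smooth, and that the
   overlaps of charts are open. *)
Record is_manifold (M : premfd) : Prop := IsManifold {
  chart_inj : forall c, charts M c -> forall p q,
    cdom c p -> cdom c q -> cmap c p = cmap c q -> p = q;
  chart_open : forall c, charts M c -> open (cmap c @` cdom c);
  transition_smooth : smooth (fun p : M => p);
  chart_cover : exists n, forall p : M, exists c,
    [/\ charts M c, cdom c p & cdim c = n];
  manifold_hausdorff : mhausdorff M;
  manifold_second_countable : second_countable_mfd M
}.

Definition prod_chart T T' (c : chart T) (c' : chart T') : chart (T * T') :=
  Chart (fun z => cdom c z.1 /\ cdom c' z.2)
        (fun z => row_mx (cmap c z.1) (cmap c' z.2)).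

Definition prod_mfd (M N : premfd) : premfd := @Premfd (M * N)%type
  [set cc | exists c c', [/\ charts M c, charts N c' & cc = prod_chart c c']].

Definition real_line : premfd :=
  @Premfd R [set @Chart R 1 setT (fun t => const_mx t)].

Lemma local_rep_comp T1 T2 T3 (c1 : chart T1) (c2 : chart T2) (c3 : chart T3)
    (f : T1 -> T2) (g : T2 -> T3) p :
  cdom c1 p -> local_rep c1 c2 f p -> local_rep c2 c3 g (f p) ->
  local_rep c1 c3 (g \o f) p.
Proof.
move=> c1p [V [F [oV Vp sF FE]]] [W [G [oW Wp sG GE]]].
exists (V `&` F @^-1` W), (G \o F); split.
- exact: open_smooth_preimage.
- by split=> //=; rewrite (FE _ c1p Vp).2.
- apply: smooth_map_comp sG; [exact: open_smooth_preimage| |].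
    by move=> x [].
  by apply: smooth_map_sub sF => x [].
- move=> q c1q [Vq /= Wq]; have [c2q Fq] := FE _ c1q Vq.
  by rewrite Fq in Wq *; exact: GE.
Qed.

Lemma smooth_at_comp (M N P : premfd) (f : M -> N) (g : N -> P) p :
  mcover N -> smooth_at f p -> smooth_at g (f p) -> smooth_at (g \o f) p.
Proof.
move=> cN sf sg c c3 Mc Pc3 cp c3p; have [c2 Nc2 c2p] := cN (f p).
by apply: (@local_rep_comp _ _ _ c c2 c3) => //; [exact: sf|exact: sg].
Qed.

Lemma is_manifold_cover M : is_manifold M -> mcover M.
Proof. by case=> _ _ _ [n cn] _ _ p; have [c []] := cn p; exists c. Qed.

Lemma smooth_comp (M N P : premfd) (f : M -> N) (g : N -> P) :
  mcover N -> smooth f -> smooth g -> smooth (g \o f).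
Proof. by move=> cN sf sg p; apply: smooth_at_comp. Qed.
(* That the subsets [gpart i] form a grading is not part of this record: it holds
   for every fibre of a bundle below, such a fibre being isomorphic to some
   [weil k d], with its grading. *)
Record galg := Galg { gal :> comAlgType R; gpart : nat -> set gal }.
Arguments gpart : clear implicits.

Definition is_ghom (A B : galg) (f : A -> B) :=
  [/\ linear f, monoid_morphism f &
      forall i a, gpart A i a -> gpart B i (f a)].

Record ghom (A B : galg) := GHom { ghom_fun :> A -> B; ghomP : is_ghom ghom_fun }.

Definition is_giso (A B : galg) (f : A -> B) :=
  [/\ is_ghom f, bijective f & forall i a, gpart B i (f a) -> gpart A i a].

Lemma ghom_eq (A B : galg) (f g : ghom A B) : (forall a, f a = g a) -> f = g.
Proof.
case: f g => [f fP] [g gP] /= /funext fg; case: _ / fg gP => gP.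
by congr GHom; exact: Prop_irrelevance.
Qed.

Fact is_ghom_id (A : galg) : is_ghom (fun a : A => a).
Proof. by []. Qed.

Definition ghom_id (A : galg) : ghom A A := GHom (is_ghom_id A).

Fact is_ghom_comp (A B C : galg) (g : ghom B C) (f : ghom A B) :
  is_ghom (fun a => g (f a)).
Proof.
case: g f => [g [lg [g1 gM] gg]] [f [lf [f1 fM] gf]] /=; split.
- by move=> c x y; rewrite lf lg.
- by split=> [|x y]; rewrite ?f1 // fM gM.
- by move=> i a /gf /gg.
Qed.

Definition ghom_comp (A B C : galg) (g : ghom B C) (f : ghom A B) : ghom A C :=
  GHom (is_ghom_comp g f).

Local Notation tpoly k := {poly %/ (('X^(k.+1)) : {poly R})}.
Definition eps k : tpoly k := 'qX.

Definition trunc k : galg :=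
  @Galg (tpoly k) (fun i => [set a | exists c : R, a = c *: eps k ^+ i]).

Definition tcoef k (i : nat) (a : trunc k) : R := (a : {poly R})`_i.

Definition trunc_mfd k : premfd :=
  @Premfd (trunc k) [set @Chart (trunc k) k.+1 setT
                           (fun a => \row_(i < k.+1) tcoef i a)].

Definition tdil k (t : R) (a : trunc k) : trunc k :=
  \sum_(i < k.+1) (t ^+ i * tcoef i a) *: eps k ^+ i.

(* The graded vector space R^d; its coordinates are indexed by pairs (i, a) with
   i < size d and a < d_i, the coordinate (i, a) having weight i + 1. *)
Definition gen (d : seq nat) := {i : 'I_(size d) & 'I_(nth 0%N d i)}.

Definition rk (d : seq nat) : nat := #|{: gen d}|.

Definition wt (d : seq nat) (j : 'I_(rk d)) : nat :=
  (tag (enum_val j : gen d)).+1.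

Definition dil (d : seq nat) (t : R) (y : 'rV[R]_(rk d)) : 'rV[R]_(rk d) :=
  \row_j (t ^+ wt j * y 0 j).

Definition wtm (d : seq nat) (m : multinom (rk d)) : nat :=
  \sum_(j < rk d) m j * wt j.

Local Notation wpoly d := (mpoly (rk d) R).

(* The ideal A^{>k}(R^d) of the polynomial algebra A(R^d) *)
Definition high k d (p : wpoly d) : bool := all (fun m => k < wtm m)%N (msupp p).

Fact high_idealr k d : idealr_closed (@high k d).
Proof.
split.
- by rewrite unfold_in /high msupp0.
- by rewrite unfold_in /high msupp1 /= andbT -leqNgt /wtm big1 // => j _; rewrite mnm0E.
- move=> a u v /allP hu /allP hv; apply/allP => m /msuppD_le.
  rewrite mem_cat => /orP[/msuppM_le|/hv //].
  case/allpairsP => -[m1 m2] /= [_ /hu hm2 ->]; apply: leq_trans hm2 _.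
  rewrite /wtm -(leq_add2l 0); apply: leq_sum => j _.
  by rewrite mnmDE mulnDl leq_addl.
Qed.

HB.instance Definition _ k d := isIdealr.Build (wpoly d) (@high k d) (high_idealr k d).

Definition weil_quot k d := {ideal_quot (@high k d : idealr (wpoly d))}.
HB.instance Definition _ k d := GRing.ComNzRing.on (weil_quot k d).
HB.instance Definition _ k d := EqQuotient.on (weil_quot k d).

Definition weil_pi k d (p : wpoly d) : weil_quot k d := \pi p.

Arguments weil_pi : clear implicits.

Section WeilAlgebra.
Context (k : nat) (d : seq nat).
Local Notation I := (@high k d : idealr (wpoly d)).

Lemma weil_piD p q : weil_pi k d (p + q) = weil_pi k d p + weil_pi k d q.
Proof. exact: (rmorphD (\pi_({ideal_quot I}) : {rmorphism _ -> _})). Qed.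

Lemma weil_piM p q : weil_pi k d (p * q) = weil_pi k d p * weil_pi k d q.
Proof. exact: (rmorphM (\pi_({ideal_quot I}) : {rmorphism _ -> _})). Qed.

Lemma weil_pi1 : weil_pi k d (1 : wpoly d) = 1.
Proof. exact: (rmorph1 (\pi_({ideal_quot I}) : {rmorphism _ -> _})). Qed.

Definition weil_scale (a : R) (x : weil_quot k d) : weil_quot k d :=
  weil_pi k d (mpolyC (rk d) a) * x.

Fact weil_scaleA a b x : weil_scale a (weil_scale b x) = weil_scale (a * b) x.
Proof. by rewrite /weil_scale mulrA -weil_piM mpolyCM. Qed.

Fact weil_scale1 : left_id 1 weil_scale.
Proof. by move=> x; rewrite /weil_scale mpolyC1 weil_pi1 mul1r. Qed.

Fact weil_scaleDr : right_distributive weil_scale +%R.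
Proof. by move=> a x y; rewrite /weil_scale mulrDr. Qed.

Fact weil_scaleDl x : {morph weil_scale^~ x : a b / a + b}.
Proof. by move=> a b; rewrite /weil_scale mpolyCD weil_piD mulrDl. Qed.

HB.instance Definition _ := GRing.Zmodule_isLmodule.Build R (weil_quot k d)
  weil_scaleA weil_scale1 weil_scaleDr weil_scaleDl.

Fact weil_scaleAl (a : R) (x y : weil_quot k d) : a *: (x * y) = (a *: x) * y.
Proof. exact: mulrA. Qed.

HB.instance Definition _ :=
  GRing.Lmodule_isLalgebra.Build R (weil_quot k d) weil_scaleAl.

Fact weil_scaleAr (a : R) (x y : weil_quot k d) : a *: (x * y) = x * (a *: y).
Proof. by rewrite mulrC scalerAl mulrC. Qed.

HB.instance Definition _ :=
  GRing.Lalgebra_isAlgebra.Build R (weil_quot k d) weil_scaleAr.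

(* The free graded Weil algebra A^[k](R^d) = A(R^d)/A^{>k}(R^d) *)
Definition weil : galg :=
  @Galg (weil_quot k d)
    (fun i => [set a | exists p : wpoly d,
       (forall m, m \in msupp p -> wtm m = i) /\ a = weil_pi k d p]).

(* The monomials of weight at most [k] form a basis of [weil]. Their degree is at
   most [k], all weights being positive. *)
Definition wmon := {m : bmultinom (rk d) k.+1 | (wtm (bmnm m) <= k)%N}.

Definition wbasis (j : 'I_#|{: wmon}|) : weil :=
  weil_pi k d (mpolyX R (bmnm (val (enum_val j : wmon)))).

Definition wgen (j : 'I_(rk d)) : weil := weil_pi k d (mpolyX R (mnm1 j)).

Definition wcoord (a : weil) : 'rV[R]_#|{: wmon}| :=
  \row_j mcoeff (bmnm (val (enum_val j : wmon))) (repr (a : weil_quot k d)).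

Definition weil_mfd : premfd :=
  @Premfd weil [set @Chart weil #|{: wmon}| setT wcoord].

End WeilAlgebra.

Lemma tcoef_in k i p : (i < k.+1)%N ->
  tcoef i (in_qpoly ('X^(k.+1)) p : trunc k) = p`_i.
Proof.
by move=> ik; rewrite /tcoef /= mk_monic_Xn -Pdiv.RingMonic.take_poly_rmodp coef_take_poly ik.
Qed.

Lemma size_tpoly k (a : tpoly k) : (size (a : {poly R}) <= k.+1)%N.
Proof.
have := size_mk_monic a.
by rewrite [X in (_ < X)%N](_ : _ = k.+2) // mk_monic_Xn size_polyXn.
Qed.

Lemma tcoef_eq k (a b : trunc k) :
  (forall i, (i < k.+1)%N -> tcoef i a = tcoef i b) -> a = b.
Proof.
move=> ab; apply: val_inj; apply/polyP => i; case: (ltnP i k.+1) => [/ab //|ki].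
by rewrite !nth_default // (leq_trans (size_tpoly _)).
Qed.

Lemma tcoefD k i (a b : trunc k) : tcoef i (a + b) = tcoef i a + tcoef i b.
Proof. exact: coefD. Qed.

Lemma tcoef0 k i : tcoef i (0 : trunc k) = 0.
Proof. exact: coef0. Qed.

Lemma tcoefN k i (a : trunc k) : tcoef i (- a) = - tcoef i a.
Proof. exact: coefN. Qed.

Lemma tcoefZ k i (c : R) (a : trunc k) : tcoef i (c *: a) = c * tcoef i a.
Proof. exact: coefZ. Qed.

Lemma tcoefM k i (a b : trunc k) : (i < k.+1)%N ->
  tcoef i (a * b) = \sum_(j < i.+1) tcoef j a * tcoef (i - j)%N b.
Proof.
move=> ik; apply: etrans (coefM (a : tpoly k) (b : tpoly k) i).
exact: tcoef_in.
Qed.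

Lemma tcoef1 k i : tcoef i (1 : trunc k) = (i == 0%N)%:R.
Proof. exact: coef1. Qed.

Lemma tcoef_eps k i j : (i < k.+1)%N -> tcoef i (eps k ^+ j : trunc k) = (i == j)%:R.
Proof. by move=> ik; rewrite /eps -rmorphXn tcoef_in // coefXn. Qed.

Lemma tcoef_dil k i t (a : trunc k) : (i < k.+1)%N ->
  tcoef i (tdil t a) = t ^+ i * tcoef i a.
Proof.
move=> ik; rewrite /tdil (big_morph _ (@tcoefD k i) (@tcoef0 k i)).
rewrite (bigD1 (Ordinal ik)) //= tcoefZ tcoef_eps // eqxx mulr1 big1 ?addr0 //.
by move=> j /negbTE ji; rewrite tcoefZ tcoef_eps // eq_sym -val_eqE /= in ji *;
  rewrite ji mulr0.
Qed.

Lemma tdilD k t (a b : trunc k) : tdil t (a + b) = tdil t a + tdil t b.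
Proof.
by apply: tcoef_eq => i ik; rewrite !(tcoef_dil, tcoefD) // mulrDr.
Qed.

Lemma tdilN k t (a : trunc k) : tdil t (- a) = - tdil t a.
Proof.
by apply: tcoef_eq => i ik; rewrite !(tcoef_dil, tcoefN) // mulrN.
Qed.

Lemma tdilZ k t c (a : trunc k) : tdil t (c *: a) = c *: tdil t a.
Proof.
by apply: tcoef_eq => i ik; rewrite !(tcoef_dil, tcoefZ) // mulrCA.
Qed.

Lemma tdil1 k t : tdil t (1 : trunc k) = 1.
Proof.
apply: tcoef_eq => i ik; rewrite !(tcoef_dil, tcoef1) //.
by case: eqP => [->|_]; rewrite ?mulr0 // expr0 mulr1.
Qed.

Lemma tdilM k t (a b : trunc k) : tdil t (a * b) = tdil t a * tdil t b.
Proof.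
apply: tcoef_eq => i ik; rewrite tcoef_dil // !tcoefM // mulr_sumr.
apply: eq_bigr => j _; have ji : (j <= i)%N by rewrite -ltnS.
rewrite !tcoef_dil ?(leq_ltn_trans _ ik) ?leq_subr //.
by rewrite mulrACA -exprD subnKC.
Qed.

Lemma tdil_mul k t s (a : trunc k) : tdil (t * s) a = tdil t (tdil s a).
Proof. by apply: tcoef_eq => i ik; rewrite !tcoef_dil // exprMn mulrA. Qed.

Lemma tdil_id k (a : trunc k) : tdil 1 a = a.
Proof. by apply: tcoef_eq => i ik; rewrite tcoef_dil // expr1n mul1r. Qed.

Fact is_ghom_tdil k t : @is_ghom (trunc k) (trunc k) (tdil t).
Proof.
split.
- by move=> c a b; rewrite tdilD tdilZ.
- by split=> [|a b]; [exact: tdil1|exact: tdilM].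
- move=> i _ [c ->]; exists (c * t ^+ i); apply: tcoef_eq => j jk.
  rewrite tdilZ !tcoefZ tcoef_dil // tcoef_eps // -mulrA.
  by case: (eqVneq j i) => [->|_]; rewrite ?mulr0.
Qed.

Definition tdil_hom k t : ghom (trunc k) (trunc k) := GHom (is_ghom_tdil k t).

Definition trow k (a : trunc k) : 'rV[R]_k.+1 := \row_(i < k.+1) tcoef i a.

(* Smoothness of maps into [trunc_mfd] is preserved by pointwise operations that
   are smooth in coordinates. *)
Lemma smooth_at_trunc2 k (M : premfd) (op : trunc k -> trunc k -> trunc k)
    (Op : 'rV[R]_k.+1 -> 'rV[R]_k.+1 -> 'rV[R]_k.+1) (f g : M -> trunc_mfd k) p :
  (forall a b, trow (op a b) = Op (trow a) (trow b)) ->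
  (forall m (U : set 'rV[R]_m) F G, open U -> smooth_map U F -> smooth_map U G ->
     smooth_map U (fun x => Op (F x) (G x))) ->
  smooth_at f p -> smooth_at g p ->
  smooth_at (fun q => op (f q) (g q) : trunc_mfd k) p.
Proof.
move=> opE sOp sf sg c c' Mc Nc'; move: (Nc') => -> cp _.
have [V [F [oV Vp sF FE]]] := sf c _ Mc erefl cp I.
have [W [G [oW Wp sG GE]]] := sg c _ Mc erefl cp I.
exists (V `&` W), (fun x => Op (F x) (G x)); split.
- exact: openI.
- by split.
- by apply: sOp; [exact: openI|exact: smooth_map_sub sF|exact: smooth_map_sub sG].
- move=> q cq [Vq Wq]; split=> //=; rewrite [RHS]opE.
  by rewrite (FE _ cq Vq).2 (GE _ cq Wq).2.
Qed.

Lemma smooth_cst_trunc k (M : premfd) (a : trunc k) p :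
  smooth_at (fun _ : M => a : trunc_mfd k) p.
Proof.
move=> c c' Mc -> cp _; exists setT, (fun=> trow a); split=> //.
  exact: openT.
by move=> j r; exact: Cdiff_cst.
Qed.

Lemma smooth_at_truncD k (M : premfd) (f g : M -> trunc_mfd k) p :
  smooth_at f p -> smooth_at g p ->
  smooth_at (fun q => (f q : trunc k) + (g q : trunc k) : trunc_mfd k) p.
Proof.
apply: (@smooth_at_trunc2 k M +%R +%R).
  by move=> a b; apply/rowP => i; rewrite !mxE tcoefD.
move=> m U F G oU sF sG j r; under eq_fun do rewrite mxE.
by apply: CdiffD => //; [exact: sF|exact: sG].
Qed.

Lemma smooth_at_truncM k (M : premfd) (f g : M -> trunc_mfd k) p :
  smooth_at f p -> smooth_at g p ->
  smooth_at (fun q => (f q : trunc k) * (g q : trunc k) : trunc_mfd k) p.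
Proof.
pose Op (u v : 'rV[R]_k.+1) : 'rV[R]_k.+1 :=
  \row_i \sum_(j < i.+1) u 0 (inord j) * v 0 (inord (i - j)).
apply: (@smooth_at_trunc2 k M *%R Op).
  move=> a b; apply/rowP => i; rewrite !mxE tcoefM //; apply: eq_bigr => j _.
  have ik := ltn_ord i; have ji : (j <= i)%N by rewrite -ltnS.
  rewrite !mxE !inordK // ?(leq_ltn_trans (leq_subr _ _)) //.
  exact: leq_ltn_trans ji ik.
move=> m U F G oU sF sG j r; under eq_fun do rewrite mxE.
by apply: Cdiff_sum => // i; apply: CdiffM => //; [exact: sF|exact: sG].
Qed.

(* A manifold with an action of the multiplicative monoid of the reals; its
   smoothness and local triviality are the object of [is_gbundle] below. *)
Record gbundle := GBundle {
  tot :> premfd;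
  act : R -> tot -> tot;
  actM : forall t s p, act (t * s) p = act t (act s p);
  act1 : forall p, act 1 p = p
}.
Arguments act {_} t p.

(* The coordinates of a local isomorphism, over an open subset of the base which
   is itself a coordinate domain, with V x R^d, V open in R^n. *)
Record gtriv (F : gbundle) := GTriv {
  gbdim : nat;
  gtype : seq nat;
  gdom : set F;
  gbase : F -> 'rV[R]_gbdim;
  gfib : F -> 'rV[R]_(rk gtype)
}.

Definition gtriv_chart F (phi : gtriv F) : chart F :=
  Chart (gdom phi) (fun p => row_mx (gbase phi p) (gfib phi p)).

Record is_gtriv (F : gbundle) (phi : gtriv F) : Prop := IsGTriv {
  gtriv_sat : forall p, gdom phi p <-> gdom phi (act 0 p);
  gtriv_inj : forall p q, gdom phi p -> gdom phi q ->
    gbase phi p = gbase phi q -> gfib phi p = gfib phi q -> p = q;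
  gtriv_im : exists2 V : set 'rV[R]_(gbdim phi), open V &
    forall u y, V u <->
      exists p, [/\ gdom phi p, gbase phi p = u & gfib phi p = y];
  gtriv_compat : forall c p, charts F c -> cdom c p -> gdom phi p ->
    local_rep c (gtriv_chart phi) (fun q => q) p /\
    local_rep (gtriv_chart phi) c (fun q => q) p;
  gtriv_act : forall t p, gdom phi p ->
    gbase phi (act t p) = gbase phi p /\
    gfib phi (act t p) = dil t (gfib phi p)
}.

Record is_gbundle (k : nat) (F : gbundle) : Prop := IsGBundle {
  gbundle_mfd : is_manifold F;
  gbundle_smooth_act :
    smooth (fun z : prod_mfd real_line F => act (z.1 : R) z.2 : F);
  gbundle_triv : exists (n : nat) (d : seq nat), size d = k /\
    forall p : F, exists phi : gtriv F,
      [/\ is_gtriv phi, gbdim phi = n, gtype phi = d & gdom phi p]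
}.

Record gbmor (F E : gbundle) := GBMor {
  gb_fun :> F -> E;
  gb_smooth : smooth gb_fun;
  gb_act : forall t p, gb_fun (act t p) = act t (gb_fun p)
}.

(* The base M = h_0(F), with the structure of submanifold of [F]: the trivializing
   charts of [F] are adapted to it, M being given there by [gfib = 0]. *)
Definition base_pt (F : gbundle) := {p : F | act 0 p = p}.

Definition base_chart F (phi : gtriv F) : chart (base_pt F) :=
  Chart (fun x => gdom phi (sval x)) (fun x => gbase phi (sval x)).

Definition base (F : gbundle) : premfd :=
  @Premfd (base_pt F) [set c | exists2 phi, is_gtriv phi & c = base_chart phi].

Fact act00 (F : gbundle) t (p : F) : act 0 (act t p) = act 0 p.
Proof. by rewrite -actM mul0r. Qed.

Definition proj (F : gbundle) (p : F) : base F := exist _ (act 0 p) (act00 0 p).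

Fact base_map_subproof F E (f : gbmor F E) (x : base F) :
  act 0 (f (sval x)) = f (sval x).
Proof. by rewrite -gb_act (svalP x). Qed.

Definition base_map F E (f : gbmor F E) (x : base F) : base E :=
  exist _ (f (sval x)) (base_map_subproof f x).

Definition fibre_pt (F : gbundle) (x : base F) := {p : F | act 0 p = sval x}.

Definition fibre_chart F (phi : gtriv F) (x : base F) : chart (fibre_pt x) :=
  Chart (fun _ => gdom phi (sval x)) (fun p => gfib phi (sval p)).

Definition fibre (F : gbundle) (x : base F) : premfd :=
  @Premfd (fibre_pt x)
    [set c | exists2 phi, is_gtriv phi & c = fibre_chart phi x].

Definition fibre_act (F : gbundle) (x : base F) (t : R) (p : fibre x) : fibre x :=
  exist _ (act t (sval p)) (etrans (act00 t (sval p)) (svalP p)).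

Definition fibre_base (F : gbundle) (x : base F) : fibre x :=
  exist (fun p : F => act 0 p = sval x) (sval x) (svalP x).

Definition to_fibre (F : gbundle) (p : F) : fibre (proj p) :=
  exist (fun q : F => act 0 q = sval (proj p)) p erefl.

Fact fibre_map_subproof F E (f : gbmor F E) (x : base F) (p : fibre x) :
  act 0 (f (sval p)) = sval (base_map f x).
Proof. by rewrite -gb_act (svalP p). Qed.

Definition fibre_map F E (f : gbmor F E) (x : base F) (p : fibre x) :
    fibre (base_map f x) :=
  exist _ (f (sval p)) (fibre_map_subproof f p).

(* The algebra Hom_G(F_x, A^[k]) *)
Record homG (k : nat) (F : gbundle) (x : base F) := HomG {
  homG_fun :> fibre x -> trunc k;
  homG_smooth : @smooth (fibre x) (trunc_mfd k) homG_fun;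
  homG_act : forall t p, homG_fun (fibre_act t p) = tdil t (homG_fun p)
}.

Section HomGAlgebra.
Context (k : nat) (F : gbundle) (x : base F).
Local Notation H := (homG k x).

Lemma homG_eq (a b : H) : (forall p, a p = b p) -> a = b.
Proof.
case: a b => [a a1 a2] [b b1 b2] /= /funext ab.
case: _ / ab b1 b2 => b1 b2.
by congr HomG; exact: Prop_irrelevance.
Qed.

Fact homG_cst_act (c : trunc k) : (forall t, tdil t c = c) ->
  forall t (p : fibre x), c = tdil t c.
Proof. by move=> h t _; rewrite h. Qed.

Fact tdil0 t : tdil t (0 : trunc k) = 0.
Proof. by apply: tcoef_eq => i ik; rewrite tcoef_dil // tcoef0 mulr0. Qed.

Definition homG_zero : H :=
  @HomG k F x (fun=> 0) (@smooth_cst_trunc k (fibre x) 0) (homG_cst_act tdil0).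

Definition homG_one : H :=
  @HomG k F x (fun=> 1) (@smooth_cst_trunc k (fibre x) 1) (homG_cst_act (@tdil1 k)).

Fact homG_add_act (a b : H) t p :
  a (fibre_act t p) + b (fibre_act t p) = tdil t (a p + b p).
Proof. by rewrite !homG_act tdilD. Qed.

Definition homG_add (a b : H) : H := @HomG k F x (fun p => a p + b p)
  (fun p => smooth_at_truncD (@homG_smooth _ _ _ a p) (@homG_smooth _ _ _ b p))
  (homG_add_act a b).

Fact homG_mul_act (a b : H) t p :
  a (fibre_act t p) * b (fibre_act t p) = tdil t (a p * b p).
Proof. by rewrite !homG_act tdilM. Qed.

Definition homG_mul (a b : H) : H := @HomG k F x (fun p => a p * b p)
  (fun p => smooth_at_truncM (@homG_smooth _ _ _ a p) (@homG_smooth _ _ _ b p))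
  (homG_mul_act a b).

Fact homG_scale_smooth (c : R) (a : H) :
  @smooth (fibre x) (trunc_mfd k) (fun p => c *: a p).
Proof.
move=> p; rewrite (_ : (fun p => _) = fun p => c%:A * a p); last first.
  by apply/funext => q; rewrite -scalerAl mul1r.
apply: (@smooth_at_truncM k (fibre x) (fun=> c%:A)); last exact: homG_smooth.
exact: smooth_cst_trunc.
Qed.

Fact homG_scale_act (c : R) (a : H) t p : c *: a (fibre_act t p) = tdil t (c *: a p).
Proof. by rewrite homG_act tdilZ. Qed.

Definition homG_scale (c : R) (a : H) : H :=
  HomG (@homG_scale_smooth c a) (homG_scale_act c a).

Definition homG_opp (a : H) : H := homG_scale (-1) a.

HB.instance Definition _ := gen_eqMixin H.
HB.instance Definition _ := gen_choiceMixin H.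

Fact homG_addA : associative homG_add.
Proof. by move=> a b c; apply: homG_eq => p /=; rewrite addrA. Qed.
Fact homG_addC : commutative homG_add.
Proof. by move=> a b; apply: homG_eq => p /=; rewrite addrC. Qed.
Fact homG_add0 : left_id homG_zero homG_add.
Proof. by move=> a; apply: homG_eq => p /=; rewrite add0r. Qed.
Fact homG_addN : left_inverse homG_zero homG_opp homG_add.
Proof. by move=> a; apply: homG_eq => p /=; rewrite scaleN1r addNr. Qed.

HB.instance Definition _ :=
  GRing.isZmodule.Build H homG_addA homG_addC homG_add0 homG_addN.

Fact homG_mulA : associative homG_mul.
Proof. by move=> a b c; apply: homG_eq => p /=; rewrite mulrA. Qed.
Fact homG_mulC : commutative homG_mul.
Proof. by move=> a b; apply: homG_eq => p /=; rewrite mulrC. Qed.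
Fact homG_mul1 : left_id homG_one homG_mul.
Proof. by move=> a; apply: homG_eq => p /=; rewrite mul1r. Qed.
Fact homG_mulD : left_distributive homG_mul homG_add.
Proof. by move=> a b c; apply: homG_eq => p /=; rewrite mulrDl. Qed.
Fact homG_one_neq0 : homG_one != homG_zero.
Proof.
apply/eqP => /(congr1 (fun a : H => a (fibre_base x))) /= /eqP.
by rewrite oner_eq0.
Qed.

HB.instance Definition _ := GRing.Zmodule_isComNzRing.Build H
  homG_mulA homG_mulC homG_mul1 homG_mulD homG_one_neq0.

Fact homG_scaleA (a b : R) (v : H) :
  homG_scale a (homG_scale b v) = homG_scale (a * b) v.
Proof. by apply: homG_eq => p /=; rewrite scalerA. Qed.
Fact homG_scale1 : left_id 1 homG_scale.
Proof. by move=> v; apply: homG_eq => p /=; rewrite scale1r. Qed.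
Fact homG_scaleDr : right_distributive homG_scale +%R.
Proof. by move=> a u v; apply: homG_eq => p /=; rewrite scalerDr. Qed.
Fact homG_scaleDl (v : H) : {morph homG_scale^~ v : a b / a + b}.
Proof. by move=> a b; apply: homG_eq => p /=; rewrite scalerDl. Qed.

HB.instance Definition _ := GRing.Zmodule_isLmodule.Build R H
  homG_scaleA homG_scale1 homG_scaleDr homG_scaleDl.

Fact homG_scaleAl (a : R) (u v : H) : a *: (u * v) = (a *: u) * v.
Proof. by apply: homG_eq => p /=; rewrite scalerAl. Qed.

HB.instance Definition _ := GRing.Lmodule_isLalgebra.Build R H homG_scaleAl.

Fact homG_scaleAr (a : R) (u v : H) : a *: (u * v) = u * (a *: v).
Proof. by rewrite mulrC scalerAl mulrC. Qed.

HB.instance Definition _ := GRing.Lalgebra_isAlgebra.Build R H homG_scaleAr.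

Definition homG_galg : galg :=
  @Galg H (fun i => [set a : H | forall p, gpart (trunc k) i (a p)]).

End HomGAlgebra.

(* A family of trivializations lmap_x : A^[k](R^d) -> A_x, for x in [ldom] *)
Record ltriv (k : nat) (M : premfd) (A : M -> galg) := LTriv {
  ltype : seq nat;
  ldom : set M;
  lmap : forall x, weil k ltype -> A x
}.
Arguments lmap {k M A} tau x a : rename.

Record wbundle (k : nat) := WBundle {
  wbase : premfd;
  wfib : wbase -> galg;
  wtrivs : set (ltriv k wfib)
}.
Arguments wfib {k} A x : rename.
Arguments wtrivs {k} A _ : rename.

Record is_wbundle k (A : wbundle k) : Prop := IsWBundle {
  wbundle_mfd : is_manifold (wbase A);
  wbundle_triv : forall tau, wtrivs A tau ->
    [/\ size (ltype tau) = k, mopen (ldom tau) &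
        forall x, ldom tau x -> is_giso (lmap tau x)];
  wbundle_cover : exists d : seq nat, size d = k /\
    forall x : wbase A, exists tau,
      [/\ wtrivs A tau, ltype tau = d & ldom tau x];
  (* the transition cocycle tau_x^-1 \o tau'_x is a smooth function of x *)
  wbundle_cocycle : forall tau tau', wtrivs A tau -> wtrivs A tau' ->
    forall a : weil k (ltype tau'),
    exists g : wbase A -> weil_mfd k (ltype tau),
      forall x, ldom tau x -> ldom tau' x ->
        lmap tau' x a = lmap tau x (g x) /\ smooth_at g x
}.

Definition dual_pt k (A : wbundle k) :=
  {x : wbase A & {xi : wfib A x -> R^o | linear xi}}.

Definition dual_chart k (A : wbundle k) (c : chart (wbase A))
    (tau : ltriv k (wfib A)) : chart (dual_pt A) :=
  Chart (fun z => cdom c (tag z) /\ ldom tau (tag z))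
        (fun z => row_mx (cmap c (tag z))
           (\row_j (sval (tagged z) (lmap tau (tag z) (wbasis j)) : R))).

Definition dual k (A : wbundle k) : premfd :=
  @Premfd (dual_pt A) [set cc | exists c tau,
    [/\ charts (wbase A) c, wtrivs A tau & cc = dual_chart c tau]].

(* A Zakrzewski morphism from [A] to [B] goes backwards on the bases. *)
Record zak k (A B : wbundle k) := Zak {
  zbase : wbase B -> wbase A;
  zmap : forall x, ghom (wfib A (zbase x)) (wfib B x)
}.

Fact zdual_subproof k (A B : wbundle k) (psi : zak A B) x
    (xi : {xi : wfib B x -> R^o | linear xi}) :
  linear (fun a => sval xi (zmap psi x a)).
Proof. by case: (zmap psi x) => f [lf _ _] c a b /=; rewrite lf (svalP xi). Qed.

Definition zdual k (A B : wbundle k) (psi : zak A B) (z : dual B) : dual A :=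
  existT _ (zbase psi (tag z)) (exist _ _ (@zdual_subproof k A B psi _ (tagged z))).

Record wbmor k (A B : wbundle k) := WBMor {
  wb_zak :> zak A B;
  wb_smooth : smooth (zbase wb_zak);
  wb_dual_smooth : smooth (zdual wb_zak)
}.

(* A section s of the family Hom_G(F_x, A^[k]) is identified with the A^[k]-valued
   function p |-> s_{h_0(p)}(p) on [F], and is smooth if this function is. The
   trivializations tau are those for which all sections x |-> tau_x(a), with [a]
   constant, are smooth. *)
Definition star k (F : gbundle) : wbundle k :=
  @WBundle k (base F) (fun x => homG_galg k x)
    [set tau : ltriv k (fun x : base F => homG_galg k x) |
      [/\ size (ltype tau) = k, mopen (ldom tau),
      forall x, ldom tau x -> is_giso (lmap tau x) &
      forall (a : weil k (ltype tau)) (p : F), ldom tau (proj p) ->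
        @smooth_at F (trunc_mfd k)
          (fun q => (lmap tau (proj q) a : homG k (proj q)) (to_fibre q)) p]].

(* In a trivialization tau, the point psi of the fibre over [x] has coordinates
   lambda_j, where psi(tau_x(y_j)) = lambda_j eps^(wt j). *)
Definition costar_pt k (A : wbundle k) :=
  {x : wbase A & ghom (wfib A x) (trunc k)}.

Definition costar_chart k (A : wbundle k) (c : chart (wbase A))
    (tau : ltriv k (wfib A)) : chart (costar_pt A) :=
  Chart (fun z => cdom c (tag z) /\ ldom tau (tag z))
        (fun z : costar_pt A =>
           let psi : ghom (wfib A (tag z)) (trunc k) := tagged z in
           row_mx (cmap c (tag z))
             (\row_j tcoef (wt j) (psi (lmap tau (tag z) (wgen k j))))).

Definition costar_tot k (A : wbundle k) : premfd :=
  @Premfd (costar_pt A) [set cc | exists c tau,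
    [/\ charts (wbase A) c, wtrivs A tau & cc = costar_chart c tau]].

Definition costar_act k (A : wbundle k) (t : R) (z : costar_tot A) : costar_tot A :=
  existT _ (tag z) (ghom_comp (tdil_hom k t) (tagged z)).

Fact costar_actM k (A : wbundle k) t s (z : costar_tot A) :
  costar_act (t * s) z = costar_act t (costar_act s z).
Proof.
congr existT; apply: ghom_eq => a; exact: tdil_mul.
Qed.

Fact costar_act1 k (A : wbundle k) (z : costar_tot A) : costar_act 1 z = z.
Proof.
case: z => x psi; congr existT; apply: ghom_eq => a; exact: tdil_id.
Qed.

Definition costar k (A : wbundle k) : gbundle :=
  GBundle (@costar_actM k A) (@costar_act1 k A).

Definition costar_map k (B A : wbundle k) (phi : zak B A) (z : costar A) : costar B :=
  existT _ (zbase phi (tag z)) (ghom_comp (tagged z) (zmap phi (tag z))).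

Record category := Category {
  obj :> Type;
  hom : obj -> obj -> Type;
  idm : forall X, hom X X;
  comp : forall X Y Z, hom Y Z -> hom X Y -> hom X Z;
  compA : forall X Y Z W (h : hom Z W) (g : hom Y Z) (f : hom X Y),
    comp h (comp g f) = comp (comp h g) f;
  comp1m : forall X Y (f : hom X Y), comp (idm Y) f = f;
  compm1 : forall X Y (f : hom X Y), comp f (idm X) = f
}.
Arguments hom {_} X Y.
Arguments idm {_} X.
Arguments comp {_ X Y Z} g f.

Record cofunctor (C D : category) (S : C -> D) := CoFunctor {
  fmap : forall X Y, hom X Y -> hom (S Y) (S X);
  fmap_id : forall X, fmap (idm X) = idm (S X);
  fmap_comp : forall X Y Z (g : hom Y Z) (f : hom X Y),
    fmap (comp g f) = comp (fmap f) (fmap g)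
}.

Definition is_iso (C : category) (X Y : C) (f : hom X Y) :=
  exists g : hom Y X, comp g f = idm X /\ comp f g = idm Y.

(* The identity of [C] is naturally isomorphic to the (covariant) composite
   [T \o S]. *)
Definition unit_iso (C D : category) (S : C -> D) (T : D -> C)
    (FS : cofunctor S) (FT : cofunctor T) :=
  exists eta : forall X : C, hom X (T (S X)),
    (forall X, is_iso (eta X)) /\
    forall X Y (f : hom X Y),
      comp (fmap FT (fmap FS f)) (eta X) = comp (eta Y) f.

Definition dual_equivalence (C D : category) (S : C -> D) (T : D -> C)
    (FS : cofunctor S) (FT : cofunctor T) :=
  unit_iso FS FT /\ unit_iso FT FS.

Lemma weil_piZ k d (c : R) p :
  weil_pi k d (c *: p) = c *: (weil_pi k d p : weil_quot k d).
Proof. by rewrite -mul_mpolyC weil_piM. Qed.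

Lemma weil_pi_high k d (p : wpoly d) : high k p -> weil_pi k d p = 0.
Proof.
move=> hp; have -> : (0 : weil_quot k d) = weil_pi k d 0 by rewrite /weil_pi !piE.
apply/eqP; rewrite /weil_pi -(Quotient.idealrBE (@high k d : idealr (wpoly d))).
by rewrite subr0.
Qed.

Lemma mdeg_wtm d (m : multinom (rk d)) : (mdeg m <= wtm m)%N.
Proof. by rewrite mdegE; apply: leq_sum => j _; rewrite leq_pmulr. Qed.

Lemma weil_decomp k d (a : weil k d) :
  a = \sum_j wcoord a 0 j *: (wbasis j : weil k d).
Proof.
pose p : wpoly d := repr (a : weil_quot k d).
pose mon (j : 'I_#|{: wmon k d}|) := bmnm (val (enum_val j : wmon k d)).
pose q : wpoly d := \sum_j mcoeff (mon j) p *: mpolyX R (mon j).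
have -> : \sum_j wcoord a 0 j *: (wbasis j : weil k d) = weil_pi k d q.
  rewrite (big_morph _ (@weil_piD k d) (weil_pi_high (p := 0) _)); last first.
    by rewrite /high msupp0.
  by apply: eq_bigr => j _; rewrite weil_piZ mxE.
have <- : weil_pi k d p = a by exact: reprK.
apply/eqP; rewrite -subr_eq0; apply/eqP.
have -> : weil_pi k d p - weil_pi k d q = weil_pi k d (p - q).
  by rewrite -scaleN1r -[LHS]/(weil_pi k d p + (-1) *: (weil_pi k d q : weil_quot k d))
    -weil_piZ -weil_piD scaleN1r.
apply: weil_pi_high; apply/allP => m; rewrite mcoeff_msupp ltnNge.
apply: contra => wm; rewrite mcoeffB subr_eq0.
have bm : (mdeg m < k.+1)%N by rewrite ltnS (leq_trans (mdeg_wtm m)).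
pose w : wmon k d := exist _ (BMultinom bm) wm.
rewrite /q raddf_sum (bigD1 (enum_rank w)) //= mcoeffZ mcoeffX /mon enum_rankK.
rewrite eqxx mulr1 big1 ?addr0 // => j jw.
rewrite mcoeffZ mcoeffX; case: eqP => [mj|]; last by rewrite mulr0.
case/eqP: jw; rewrite -[j]enum_valK; congr enum_rank.
by apply: val_inj; apply: val_inj.
Qed.

Lemma smooth_lsubmx m n p (U : set 'rV[R]_m) (F : 'rV[R]_m -> 'rV[R]_p) r j :
  open U -> smooth_map U F ->
  Cdiff r (fun w : 'rV[R]_(m + n) => U (lsubmx w)) (fun w => F (lsubmx w) 0 j).
Proof.
move=> oU sF; have sl : smooth_map setT (fun w : 'rV[R]_(m + n) => lsubmx w).
  by move=> i s; under eq_fun do rewrite mxE; exact: Cdiff_coord.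
have oU' : open (fun w : 'rV[R]_(m + n) => U (lsubmx w)).
  have := open_smooth_preimage openT oU sl; congr open.
  by rewrite setTI.
apply: (smooth_map_comp (f := fun w => lsubmx w) oU' _ _ sF) => //.
exact: smooth_map_sub sl.
Qed.

Lemma open_lsubmx m n (U : set 'rV[R]_m) :
  open U -> open (fun w : 'rV[R]_(m + n) => U (lsubmx w)).
Proof.
move=> oU; have sl : smooth_map setT (fun w : 'rV[R]_(m + n) => lsubmx w).
  by move=> i s; under eq_fun do rewrite mxE; exact: Cdiff_coord.
have := open_smooth_preimage openT oU sl; congr open.
by rewrite setTI.
Qed.

Lemma dual_cover k (A : wbundle k) : is_wbundle A -> mcover (dual A).
Proof.
move=> wA [x xi]; have [c Ac cx] := is_manifold_cover (wbundle_mfd wA) x.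
have [d [_ /(_ x)[tau [At _ tx]]]] := wbundle_cover wA.
by exists (dual_chart c tau) => //; exists c, tau.
Qed.

Lemma dual_id_smooth k (A : wbundle k) :
  is_wbundle A -> smooth (fun z : dual A => z).
Proof.
move=> wA [x xi] _ _ [c [tau [Ac At ->]]] [c' [tau' [Ac' At' ->]]] /=.
move=> [cx tx] [c'x t'x].
have mA := wbundle_mfd wA.
have [V [F [oV Vx sF FE]]] := transition_smooth mA Ac Ac' cx c'x.
have [_ oD _] := wbundle_triv wA At.
have [_ oD' _] := wbundle_triv wA At'.
have mem0 q D : D q -> cdom c q -> (cmap c @` (cdom c `&` D)) (cmap c q).
  by move=> Dq cq; exists q.
have mem1 q D : cdom c q -> (cmap c @` (cdom c `&` D)) (cmap c q) -> D q.
  by move=> cq [q' [cq' Dq'] e]; rewrite -(chart_inj mA Ac cq' cq e).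
have {}oD := oD _ Ac; have {}oD' := oD' _ Ac.
set O := (cmap c @` _) in oD; set O' := (cmap c @` _) in oD'.
pose n' := #|{: wmon k (ltype tau')}|; pose n := #|{: wmon k (ltype tau)}|.
have H (j : 'I_n') : exists WG : set 'rV[R]_(cdim c) * ('rV[R]_(cdim c) -> 'rV[R]_n),
    [/\ open WG.1, WG.1 (cmap c x), smooth_map WG.1 WG.2 &
     forall q, cdom c q -> ldom tau q -> ldom tau' q -> WG.1 (cmap c q) ->
       lmap tau' q (wbasis j) =
       \sum_i WG.2 (cmap c q) 0 i *: (lmap tau q (wbasis i) : wfib A q)].
  have [g gE] := wbundle_cocycle wA At At' (wbasis j).
  have [_ /(_ c _ Ac erefl cx I)[W [G [oW Wx sG GE]]]] := gE _ tx t'x.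
  exists (W, G); split=> //= q cq tq t'q Wq.
  have [-> _] := gE _ tq t'q.
  have [_ _ /(_ _ tq)[[lin _ _] _ _]] := wbundle_triv wA At.
  pose L := GRing.isLinear.Build _ _ _ _ _ lin.
  pose l : {linear _ -> _} := HB.pack (lmap tau q : weil k (ltype tau) -> wfib A q) L.
  have lE a : lmap tau q a = l a by [].
  rewrite [in LHS](weil_decomp (g q)) lE linear_sum; apply: eq_bigr => i _.
  by rewrite linearZ /= (GE _ cq Wq).2.
have [WG WGP] := choice H.
pose W := \big[setI/setT]_(j < n') (WG j).1.
have oW : open W by apply: big_ind => [||j _]; [exact: openT|exact: openI|case: (WGP j)].
have WP u : W u <-> forall j, (WG j).1 u.
  rewrite /W -bigcap_seq; split=> [h j|h j _]; last exact: h.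
  by apply: h; rewrite /= mem_index_enum.
pose U u := [/\ V u, O u, O' u & W u].
have oU : open U.
  have := openI (openI oV oD) (openI oD' oW); congr open.
  by apply/seteqP; split=> [u [[? ?] [? ?]]|u [? ? ? ?]].
pose G (w : 'rV[R]_(cdim c + n)) : 'rV[R]_(cdim c' + n') :=
  row_mx (F (lsubmx w))
    (\row_j \sum_i (WG j).2 (lsubmx w) 0 i * w 0 (rshift (cdim c) i)).
exists (fun w => U (lsubmx w)), G; split=> /=.
- exact: open_lsubmx.
- rewrite row_mxKl; split=> //; [exact: mem0|exact: mem0|].
  by apply/WP => j; case: (WGP j).
- move=> j r; rewrite /G; case: (split_ordP j) => i ->.
    apply: (Cdiff_ext (f := fun w => F (lsubmx w) 0 i)).
    - exact: open_lsubmx.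
    - by move=> w _; rewrite row_mxEl.
    - by apply: smooth_lsubmx => //; apply: smooth_map_sub sF => u [].
  apply: (Cdiff_ext (f := fun w => \sum_l (WG i).2 (lsubmx w) 0 l *
                                          w 0 (rshift (cdim c) l))).
  - exact: open_lsubmx.
  - by move=> w _; rewrite row_mxEr mxE.
  apply: Cdiff_sum => [|l]; first exact: open_lsubmx.
  apply: CdiffM; [exact: open_lsubmx| |exact: Cdiff_coord].
  apply: smooth_lsubmx => //; case: (WGP i) => _ _ sW _.
  by apply: smooth_map_sub sW => u [_ _ _ /WP].
- move=> [q eta] /= [cq tq]; rewrite row_mxKl => -[Vq Oq O'q Wq].
  have t'q : ldom tau' q := mem1 _ _ cq O'q.
  have [c'q Fq] := FE _ cq Vq.
  split=> //; rewrite /G row_mxKl Fq; congr row_mx; apply/rowP => j; rewrite !mxE.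
  have [_ _ _ ->//] := WGP j; last by move/WP : Wq; exact.
  have leta := svalP eta.
  pose L := GRing.isLinear.Build _ _ _ _ _ leta.
  pose l : {linear _ -> _} := HB.pack (sval eta) L.
  rewrite -[RHS]/(l _) linear_sum; apply: eq_bigr => i _.
  by rewrite linearZ row_mxEr mxE.
Qed.

Record gbobj (k : nat) := GBObj { gb_bundle :> gbundle; gbP : is_gbundle k gb_bundle }.

Lemma gbmor_eq (F E : gbundle) (f g : gbmor F E) : (forall p, f p = g p) -> f = g.
Proof.
case: f g => [f f1 f2] [g g1 g2] /= /funext fg.
case: _ / fg g1 g2 => g1 g2; congr GBMor; exact: Prop_irrelevance.
Qed.

Definition gb_id k (F : gbobj k) : gbmor F F :=
  @GBMor F F (fun p => p) (transition_smooth (gbundle_mfd (gbP F)))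
    (fun _ _ => erefl).

Fact gb_comp_act F E G (g : gbmor E G) (f : gbmor F E) t p :
  g (f (act t p)) = act t (g (f p)).
Proof. by rewrite !gb_act. Qed.

Definition gb_comp k (F E G : gbobj k) (g : gbmor E G) (f : gbmor F E) :
    gbmor F G :=
  @GBMor F G (fun p => g (f p))
    (smooth_comp (is_manifold_cover (gbundle_mfd (gbP E)))
       (@gb_smooth _ _ f) (@gb_smooth _ _ g))
    (gb_comp_act g f).

Fact gb_compA k (F E G H : gbobj k) (h : gbmor G H) (g : gbmor E G)
    (f : gbmor F E) :
  gb_comp h (gb_comp g f) = gb_comp (gb_comp h g) f.
Proof. exact: gbmor_eq. Qed.

Fact gb_comp1m k (F E : gbobj k) (f : gbmor F E) : gb_comp (gb_id E) f = f.
Proof. exact: gbmor_eq. Qed.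

Fact gb_compm1 k (F E : gbobj k) (f : gbmor F E) : gb_comp f (gb_id F) = f.
Proof. exact: gbmor_eq. Qed.

Definition GB (k : nat) : category :=
  @Category (gbobj k) (fun F E => gbmor F E) (@gb_id k) (@gb_comp k)
    (@gb_compA k) (@gb_comp1m k) (@gb_compm1 k).

Record wobj (k : nat) := WObj { w_bundle :> wbundle k; wP : is_wbundle w_bundle }.

Lemma wbmor_eq k (A B : wbundle k) (f g : wbmor A B) :
  wb_zak f = wb_zak g -> f = g.
Proof.
case: f g => [f f1 f2] [g g1 g2] /= fg.
case: _ / fg g1 g2 => g1 g2; congr WBMor; exact: Prop_irrelevance.
Qed.

Lemma zak_eq k (A B : wbundle k) (b : wbase B -> wbase A)
    (f g : forall x, ghom (wfib A (b x)) (wfib B x)) :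
  (forall x a, f x a = g x a) -> Zak f = Zak g.
Proof.
by move=> fg; congr Zak; apply: functional_extensionality_dep => x; apply: ghom_eq.
Qed.

Lemma dual_eq k (A : wbundle k) (x : wbase A)
    (f g : {xi : wfib A x -> R^o | linear xi}) :
  sval f = sval g -> existT _ x f = existT _ x g :> dual A.
Proof.
case: f g => [f lf] [g lg] /= fg; case: _ / fg lg => lg; congr existT.
congr exist; exact: Prop_irrelevance.
Qed.

Definition zak_id k (A : wbundle k) : zak A A :=
  @Zak k A A (fun x => x) (fun x => ghom_id (wfib A x)).

Definition zak_comp k (A B C : wbundle k) (g : zak B C) (f : zak A B) : zak A C :=
  @Zak k A C (fun x => zbase f (zbase g x))
    (fun x => ghom_comp (zmap g x) (zmap f (zbase g x))).

Fact zdual_id k (A : wbundle k) : zdual (zak_id A) = fun z => z.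
Proof. by apply/funext => -[x xi]; exact: dual_eq. Qed.

Fact zdual_comp k (A B C : wbundle k) (g : zak B C) (f : zak A B) :
  zdual (zak_comp g f) = zdual f \o zdual g.
Proof. by apply/funext => -[x xi]; exact: dual_eq. Qed.

Fact wb_id_smooth k (A : wobj k) : smooth (zdual (zak_id A)).
Proof. by rewrite zdual_id; exact: dual_id_smooth (wP A). Qed.

Definition wb_id k (A : wobj k) : wbmor A A :=
  @WBMor k A A (zak_id A) (transition_smooth (wbundle_mfd (wP A)))
    (@wb_id_smooth k A).

Fact wb_comp_smooth k (A B C : wobj k) (g : wbmor B C) (f : wbmor A B) :
  smooth (zdual (zak_comp g f)).
Proof.
rewrite zdual_comp; apply: smooth_comp; first exact: dual_cover (wP B).
  exact: wb_dual_smooth.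
exact: wb_dual_smooth.
Qed.

Definition wb_comp k (A B C : wobj k) (g : wbmor B C) (f : wbmor A B) :
    wbmor A C :=
  @WBMor k A C (zak_comp g f)
    (smooth_comp (is_manifold_cover (wbundle_mfd (wP B)))
       (@wb_smooth _ _ _ g) (@wb_smooth _ _ _ f))
    (@wb_comp_smooth k A B C g f).

Fact wb_compA k (A B C D : wobj k) (h : wbmor C D) (g : wbmor B C)
    (f : wbmor A B) :
  wb_comp h (wb_comp g f) = wb_comp (wb_comp h g) f.
Proof. by apply: wbmor_eq; exact: zak_eq. Qed.

Fact wb_comp1m k (A B : wobj k) (f : wbmor A B) : wb_comp (wb_id B) f = f.
Proof. by apply: wbmor_eq => /=; case: f => -[b m] ? ? /=; exact: zak_eq. Qed.

Fact wb_compm1 k (A B : wobj k) (f : wbmor A B) : wb_comp f (wb_id A) = f.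
Proof. by apply: wbmor_eq => /=; case: f => -[b m] ? ? /=; exact: zak_eq. Qed.

Definition FGWAB (k : nat) : category :=
  @Category (wobj k) (fun A B => wbmor A B) (@wb_id k) (@wb_comp k)
    (@wb_compA k) (@wb_comp1m k) (@wb_compm1 k).

Lemma gbundle_fibre_cover k (F : gbobj k) (x : base F) : mcover (fibre x).
Proof.
have [n [d [_ /(_ (sval x))[phi [tphi _ _ phix]]]]] := gbundle_triv (gbP F).
by move=> p; exists (fibre_chart phi x) => //; exists phi.
Qed.

Lemma fibre_map_smooth k (F E : gbobj k) (f : gbmor F E) (x : base F) :
  smooth (fibre_map f (x := x)).
Proof.
move=> p _ _ [phi tphi ->] [psi tpsi ->] /= phix psifx.
have inF (q : fibre x) : gdom phi (sval q).
  by apply/(gtriv_sat tphi); rewrite (svalP q).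
have inE : gdom psi (f (sval p)).
  by apply/(gtriv_sat tpsi); rewrite -gb_act (svalP p).
have [c Fc cp] := is_manifold_cover (gbundle_mfd (gbP F)) (sval p).
have [c' Ec' c'p] := is_manifold_cover (gbundle_mfd (gbP E)) (f (sval p)).
have [_ r1] := gtriv_compat tphi Fc cp (inF p).
have [r3 _] := gtriv_compat tpsi Ec' c'p inE.
have r2 := gb_smooth Fc Ec' cp c'p.
have r12 := local_rep_comp (inF p : cdom (gtriv_chart phi) _) r1 r2.
have [V [G [oV Vp sG GE]]] :=
  local_rep_comp (inF p : cdom (gtriv_chart phi) _) r12 r3.
have bE (q : fibre x) : gbase phi (sval q) = gbase phi (sval x).
  by rewrite -(gtriv_act tphi 0 (inF q)).1 (svalP q).
pose i (y : 'rV[R]_(rk (gtype phi))) := row_mx (gbase phi (sval x)) y.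
have si : smooth_map setT i.
  move=> j r; rewrite /i; case: (split_ordP j) => l ->.
    by under eq_fun do rewrite row_mxEl; exact: Cdiff_cst.
  by under eq_fun do rewrite row_mxEr; exact: Cdiff_coord.
have oW : open (i @^-1` V).
  have := open_smooth_preimage openT oV si; congr open; exact: setTI.
exists (i @^-1` V), (fun y => rsubmx (G (i y))); split=> //=.
- by rewrite /i -(bE p).
- move=> j r; under eq_fun do rewrite mxE.
  apply: (smooth_map_comp oW _ (smooth_map_sub _ si) sG (rshift _ j) r) => //.
- move=> q _; rewrite /i -(bE q) => Vq; split=> //.
  by rewrite (GE _ (inF q) Vq).2 /= row_mxKr.
Qed.

Fact star_fun_smooth k (F E : gbobj k) (f : gbmor F E) (x : base F)
    (alpha : homG k (base_map f x)) :
  @smooth (fibre x) (trunc_mfd k) (fun p => alpha (fibre_map f p)).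
Proof.
apply: (smooth_comp (f := fibre_map f (x := x))).
- exact: gbundle_fibre_cover.
- exact: fibre_map_smooth.
- exact: homG_smooth.
Qed.

Fact star_fun_act k (F E : gbundle) (f : gbmor F E) (x : base F)
    (alpha : homG k (base_map f x)) t (p : fibre x) :
  alpha (fibre_map f (fibre_act t p)) = tdil t (alpha (fibre_map f p)).
Proof.
rewrite -homG_act; congr (homG_fun alpha); apply: eq_exist => /=.
exact: gb_act.
Qed.

Definition star_fun k (F E : gbobj k) (f : gbmor F E) (x : base F)
    (alpha : homG_galg k (base_map f x)) : homG_galg k x :=
  HomG (@star_fun_smooth k F E f x alpha) (@star_fun_act k F E f x alpha).

Fact star_fun_ghom k (F E : gbobj k) (f : gbmor F E) (x : base F) :
  is_ghom (star_fun (f := f) (x := x)).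
Proof.
split.
- by move=> c a b; exact: homG_eq.
- by split=> [|a b]; exact: homG_eq.
- by move=> i a ai p; exact: ai.
Qed.

Definition star_map k (F E : gbobj k) (f : gbmor F E) : zak (star k E) (star k F) :=
  @Zak k (star k E) (star k F) (base_map f) (fun x => GHom (star_fun_ghom f x)).

End GradedBundles.

(* Main.v *)
(* A smooth function [f] on R^d with [f(t.y) = t^i f(y)] is a polynomial of weight
   [i]: its partial derivatives are homogeneous of smaller weight, and Euler's
   identity recovers [f] from them.  Hence in a local trivialization of [F] the
   algebra Hom_G(F_x, A^[k]) is the free Weil algebra A^[k](R^d), evaluation at
   the point with fibre coordinates [y] being the homomorphism
   [y_j |-> y_j eps^(wt j)], and by freeness these are all the homomorphisms to
   A^[k].  So the points of [F_x] are the graded characters of Hom_G(F_x, A^[k]),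
   and dually for the fibres of an algebra bundle.

   For smoothness, the monomials in [y] being linearly independent characters,
   the coefficients of a smooth section are linear combinations of its values at
   points with constant fibre coordinates, hence smooth; transition matrices
   between frames are then inverted by Cramer's rule.  In the trivializations
   induced from one of [F] (resp. [A]), both units are the identity. *)
Require Import Defs.
From HB Require Import structures.
From mathcomp Require Import all_boot all_order all_algebra.
From mathcomp Require Import generic_quotient.
From mathcomp Require Import boolp classical_sets functions reals.
From mathcomp Require Import topology normedtype derive.
From mathcomp Require Import -(notations) mpoly.

Set Implicit Arguments.
Unset Strict Implicit.
Unset Printing Implicit Defensive.

Import Order.TTheory GRing.Theory Num.Theory.
Import numFieldNormedType.Exports.

Local Open Scope classical_set_scope.
Local Open Scope ring_scope.

(** * Smooth functions and germs *)

Section Calculus.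
Context (R : realType).

(** Two features of the definitions shape the proof. First, [smooth_at] quantifies over a whole
    atlas, to which the trivializations of a graded bundle need not belong. Smoothness is therefore
    treated as a property [smc] of scalar functions read in one chart, and [compat] moves it between
    charts. Second, fibres are types depending on a base point, and base points are often equal
    without being convertible. Sections are therefore turned into functions on the total space by
    [secfun], and fibre elements are transported by [castg]. Polynomiality uses the action at
    [t = 0]: powers of [t] cancel only for [t != 0], and continuity at 0 then excludes negative
    degrees. Independence of monomials is proved for any class of functions closed under linear
    combinations, so that one lemma yields both the injectivity of evaluation and the smoothness of
    coefficients. An isomorphism of algebra bundles needs an inverse whose dual is smooth; this is
    obtained by viewing the image of a frame as another frame of the target. *)

Lemma Cdiff_local r m (U : set 'rV[R]_m) f :
  (forall x, U x -> exists V : set 'rV[R]_m, V x /\ Cdiff r V f) -> Cdiff r U f.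
Proof.
elim: r f => [|r IH] f H /=.
  move=> x Ux; have [V [Vx cV]] := H x Ux.
  exact: (cV x Vx).
split=> [x Ux|v]; first by have [V [Vx [df _]]] := H x Ux; exact: df.
by apply: IH => x Ux; have [V [Vx [_ Df]]] := H x Ux; exists V; split; last exact: Df.
Qed.

Lemma smooth_fun_local m (U : set 'rV[R]_m) f :
  (forall x, U x -> exists2 V : set 'rV[R]_m, V x & smooth_fun V f) ->
  smooth_fun U f.
Proof.
by move=> H r; apply: Cdiff_local => x /H[V Vx sf]; exists V.
Qed.

Lemma Cdiff_inv r m (U : set 'rV[R]_m) f : open U ->
  (forall x, U x -> f x != 0) -> Cdiff r U f -> Cdiff r U (fun x => (f x)^-1).
Proof.
move=> oU f0; elim: r => [|r IH] Cf.
  by move=> x Ux; apply: continuousV; [exact: f0|exact: Cf].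
have [df Df] := Cf; split=> [x Ux|v].
  by apply: differentiableV; [exact: df|exact: f0].
have Cv := IH (CdiffW Cf).
have := CdiffM oU (CdiffM oU (Cdiff_cst r U (-1)) (CdiffM oU Cv Cv)) (Df v).
apply: Cdiff_ext => // x Ux; rewrite deriveV ?f0 //; last first.
  by apply: diff_derivable; exact: df.
by rewrite mulN1r -expr2 exprVn.
Qed.

End Calculus.

(** * Germs of smooth functions in a chart, and change of chart *)

Section Germs.
Context (R : realType).

(** Manifolds carry only atlases, so neighbourhoods are the ones cut out by a given chart. *)
Definition nearc T (c : chart R T) (P : T -> Prop) (p : T) :=
  exists V : set 'rV[R]_(cdim c), [/\ open V, V (cmap c p) &
    forall q, cdom c q -> V (cmap c q) -> P q].

(** Scalar counterpart of [local_rep]. Being closed under arithmetic, it reduces the smoothness of a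
    coordinate formula to that of its ingredients. *)
Definition smc T (c : chart R T) (f : T -> R) (p : T) :=
  exists (V : set 'rV[R]_(cdim c)) (g : 'rV[R]_(cdim c) -> R),
    [/\ open V, V (cmap c p), smooth_fun V g &
        forall q, cdom c q -> V (cmap c q) -> f q = g (cmap c q)].

Section OneChart.
Context (T : Type) (c : chart R T) (p : T).

Lemma nearcT (P : T -> Prop) : (forall q, cdom c q -> P q) -> nearc c P p.
Proof. by move=> H; exists setT; split=> // [|q /H//]; exact: openT. Qed.

Lemma nearcW (P Q : T -> Prop) :
  (forall q, cdom c q -> P q -> Q q) -> nearc c P p -> nearc c Q p.
Proof.
by move=> PQ [V [oV Vp H]]; exists V; split=> // q cq Vq; apply: PQ => //; exact: H.
Qed.

Lemma nearcI (P Q : T -> Prop) :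
  nearc c P p -> nearc c Q p -> nearc c (fun q => P q /\ Q q) p.
Proof.
move=> [V [oV Vp VP]] [W [oW Wp WQ]]; exists (V `&` W); split=> //.
  exact: openI.
by move=> q cq [Vq Wq]; split; [exact: VP|exact: WQ].
Qed.

Lemma nearc_self (P : T -> Prop) : cdom c p -> nearc c P p -> P p.
Proof. by move=> cp [V [_ Vp]]; exact. Qed.

Lemma smc_near f g : nearc c (fun q => f q = g q) p -> smc c f p -> smc c g p.
Proof.
move=> [V [oV Vp fg]] [W [h [oW Wp sh hE]]]; exists (V `&` W), h; split=> //.
- exact: openI.
- by move=> r; apply: Cdiff_sub (sh r) => x [].
- by move=> q cq [Vq Wq]; rewrite -fg // hE.
Qed.

Lemma smc_ext f g : (forall q, cdom c q -> f q = g q) -> smc c f p -> smc c g p.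
Proof. by move=> fg; apply: smc_near; exact: nearcT. Qed.

Lemma smc_cst a : smc c (fun=> a) p.
Proof.
by exists setT, (fun=> a); split=> //; [exact: openT|move=> r; exact: Cdiff_cst].
Qed.

Lemma smc_coord j : smc c (fun q => cmap c q 0 j) p.
Proof.
exists setT, (fun u => u 0 j); split=> //; first exact: openT.
by move=> r; exact: Cdiff_coord.
Qed.

Lemma smc2 (op : R -> R -> R) f g :
  (forall r m (U : set 'rV[R]_m) F G, open U -> Cdiff r U F -> Cdiff r U G ->
     Cdiff r U (fun x => op (F x) (G x))) ->
  smc c f p -> smc c g p -> smc c (fun q => op (f q) (g q)) p.
Proof.
move=> Cop [V [F [oV Vp sF FE]]] [W [G [oW Wp sG GE]]].
exists (V `&` W), (fun u => op (F u) (G u)); split=> //; first exact: openI.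
  move=> r; apply: Cop; first exact: openI.
    by apply: Cdiff_sub (sF r) => x [].
  by apply: Cdiff_sub (sG r) => x [].
by move=> q cq [Vq Wq]; rewrite FE // GE.
Qed.

Lemma smcD f g : smc c f p -> smc c g p -> smc c (fun q => f q + g q) p.
Proof. by apply: smc2 => *; exact: CdiffD. Qed.

Lemma smcM f g : smc c f p -> smc c g p -> smc c (fun q => f q * g q) p.
Proof. by apply: smc2 => *; exact: CdiffM. Qed.

Lemma smcZ a f : smc c f p -> smc c (fun q => a * f q) p.
Proof. by apply: smcM; exact: smc_cst. Qed.

Lemma smcX n f : smc c f p -> smc c (fun q => f q ^+ n) p.
Proof.
move=> sf; elim: n => [|n IH]; first exact: smc_cst.
by under eq_fun do rewrite exprS; exact: smcM.
Qed.

Lemma smc_sum (I : Type) (s : seq I) (P : pred I) (F : I -> T -> R) :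
  (forall i, P i -> smc c (F i) p) -> smc c (fun q => \sum_(i <- s | P i) F i q) p.
Proof.
move=> sF; elim: s => [|i s IH].
  by under eq_fun do rewrite big_nil; exact: smc_cst.
under eq_fun do rewrite big_cons; case: (boolP (P i)) => // Pi.
by apply: smcD => //; exact: sF.
Qed.

Lemma smc_prod (I : Type) (s : seq I) (P : pred I) (F : I -> T -> R) :
  (forall i, P i -> smc c (F i) p) -> smc c (fun q => \prod_(i <- s | P i) F i q) p.
Proof.
move=> sF; elim: s => [|i s IH].
  by under eq_fun do rewrite big_nil; exact: smc_cst.
under eq_fun do rewrite big_cons; case: (boolP (P i)) => // Pi.
by apply: smcM => //; exact: sF.
Qed.

Lemma smcV f : cdom c p -> f p != 0 -> smc c f p -> smc c (fun q => (f q)^-1) p.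
Proof.
move=> cp fp [V [F [oV Vp sF FE]]].
have Fp : F (cmap c p) != 0 by rewrite -FE.
exists [set u | V u /\ F u != 0], (fun u => (F u)^-1); split=> //.
- rewrite openE => u [Vu Fu]; apply: filterI; first exact: open_nbhs_nbhs.
  exact: (cvgr_neq0 (F u) (sF 0%N u Vu) Fu).
- move=> r; apply: Cdiff_inv; last by apply: Cdiff_sub (sF r) => x [].
    rewrite openE => u [Vu Fu]; apply: filterI; first exact: open_nbhs_nbhs.
    exact: (cvgr_neq0 (F u) (sF 0%N u Vu) Fu).
  by move=> x [].
- by move=> q cq [Vq Fq]; rewrite FE.
Qed.

Lemma nearc_neq0 f : cdom c p -> f p != 0 -> smc c f p ->
  nearc c (fun q => f q != 0) p.
Proof.
move=> cp fp [V [F [oV Vp sF FE]]].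
have Fp : F (cmap c p) != 0 by rewrite -FE.
exists [set u | V u /\ F u != 0]; split=> //.
- rewrite openE => u [Vu Fu]; apply: filterI; first exact: open_nbhs_nbhs.
  exact: (cvgr_neq0 (F u) (sF 0%N u Vu) Fu).
- by move=> q cq [Vq Fq]; rewrite FE.
Qed.

End OneChart.

(** The bridge between the vector-valued definition and the scalar calculus; in the converse
    direction the finitely many neighbourhoods, one per coordinate, are intersected. *)
Lemma local_repP T T' (c : chart R T) (c' : chart R T') (F : T -> T') p :
  local_rep c c' F p <->
  nearc c (fun q => cdom c' (F q)) p /\
  forall j, smc c (fun q => cmap c' (F q) 0 j) p.
Proof.
split=> [[V [G [oV Vp sG GE]]]|[[V [oV Vp VF]] /choice[W /choice[G H]]]].
  split; first by exists V; split=> // q cq /GE[].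
  move=> j; exists V, (fun u => G u 0 j); split=> //.
  by move=> q cq Vq; rewrite (GE _ cq Vq).2.
pose O := \big[setI/setT]_j W j.
have oO : open O.
  by apply: big_ind => [||j _]; [exact: openT|exact: openI|case: (H j)].
have OP u : O u <-> forall j, W j u.
  rewrite /O -bigcap_seq; split=> [h j|h j _]; last exact: h.
  by apply: h; rewrite /= mem_index_enum.
exists (V `&` O), (fun u => \row_j G j u); split.
- exact: openI.
- by split=> //; apply/OP => j; case: (H j).
- move=> j r; under eq_fun do rewrite mxE.
  by case: (H j) => _ _ sG _; apply: Cdiff_sub (sG r) => u [_ /OP].
- move=> q cq [Vq /OP Wq]; split; first exact: VF.
  by apply/rowP => j; rewrite mxE; case: (H j) => _ _ _ ->.
Qed.

Lemma smc_comp T T' (c : chart R T) (c' : chart R T') (F : T -> T') f p :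
  cdom c p -> local_rep c c' F p -> smc c' f (F p) -> smc c (f \o F) p.
Proof.
move=> cp [V [G [oV Vp sG GE]]] [W [g [oW Wp sg gE]]].
have [c'p Gp] := GE _ cp Vp.
exists (V `&` G @^-1` W), (g \o G); split.
- exact: open_smooth_preimage.
- by split=> //=; rewrite Gp.
- move=> r; apply: (Cdiff_comp (V := W) (f := G) (g := g)) => //.
  + exact: open_smooth_preimage.
  + by move=> x [].
  + by move=> j; apply: Cdiff_sub (sG j r) => x [].
- move=> q cq [Vq /= Wq]; have [c'q Gq] := GE _ cq Vq.
  by rewrite Gq in Wq *; exact: gE.
Qed.

Lemma nearc_comp T T' (c : chart R T) (c' : chart R T') (F : T -> T') P p :
  cdom c p -> local_rep c c' F p -> nearc c' P (F p) -> nearc c (P \o F) p.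
Proof.
move=> cp [V [G [oV Vp sG GE]]] [W [oW Wp WP]].
have [c'p Gp] := GE _ cp Vp.
exists (V `&` G @^-1` W); split.
- exact: open_smooth_preimage.
- by split=> //=; rewrite Gp.
- move=> q cq [Vq /= Wq]; have [c'q Gq] := GE _ cq Vq.
  by rewrite Gq in Wq; exact: WP.
Qed.

Lemma local_rep_idl T T' (c1 c2 : chart R T) (c3 : chart R T') (f : T -> T') p :
  cdom c1 p -> local_rep c1 c2 (fun q => q) p -> local_rep c2 c3 f p ->
  local_rep c1 c3 f p.
Proof. exact: (@local_rep_comp R T T T' c1 c2 c3 (fun q => q) f p). Qed.

Lemma local_rep_idr T T' (c1 : chart R T) (c2 c3 : chart R T') (f : T -> T') p :
  cdom c1 p -> local_rep c1 c2 f p -> local_rep c2 c3 (fun q => q) (f p) ->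
  local_rep c1 c3 f p.
Proof. exact: (@local_rep_comp R T T' T' c1 c2 c3 f (fun q => q) p). Qed.

(* The chart [c0] need not belong to the atlas of [M]. *)
Definition compat (M : premfd R) (c0 : chart R M) (p : M) :=
  forall c, charts c -> cdom c p ->
    local_rep c c0 (fun q => q) p /\ local_rep c0 c (fun q => q) p.

Lemma compat_chart (M : premfd R) (c0 : chart R M) p :
  smooth (fun q : M => q) -> charts c0 -> cdom c0 p -> compat c0 p.
Proof. by move=> sM Mc0 c0p c Mc cp; split; exact: sM. Qed.

(** One well-chosen pair of charts suffices, even outside the atlases: all other representatives
    arise by composing with changes of chart. *)
Lemma compat_smooth_at (M N : premfd R) (f : M -> N) c0 c0' p :
  compat c0 p -> compat c0' (f p) -> cdom c0 p -> cdom c0' (f p) ->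
  local_rep c0 c0' f p -> smooth_at f p.
Proof.
move=> Mc0 Nc0' c0p c0'p h c c' Mc Nc' cp c'p.
have [h1 _] := Mc0 _ Mc cp; have [_ h2] := Nc0' _ Nc' c'p.
exact: local_rep_idr cp (local_rep_idl cp h1 h) h2.
Qed.

(** [compat] compares a chart with those of the atlas only, so an atlas chart around [p] serves as
    intermediary. *)
Lemma compat_smc (M : premfd R) (c0 c1 : chart R M) f p :
  mcover M -> compat c0 p -> compat c1 p -> cdom c0 p -> cdom c1 p ->
  smc c0 f p -> smc c1 f p.
Proof.
move=> cM C0 C1 c0p c1p; have [c Mc cp] := cM p.
have [h1 _] := C0 _ Mc cp; have [_ h2] := C1 _ Mc cp.
have := local_rep_idl c1p h2 h1.
exact: smc_comp.
Qed.

(** The two clauses of [is_manifold] that make [mopen] a local condition, isolated because open sets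
    are already handled while the base and the space of characters are being shown to be
    manifolds. *)
Definition good_charts (M : premfd R) :=
  (forall c, @charts R M c -> forall p q,
     cdom c p -> cdom c q -> cmap c p = cmap c q -> p = q) /\
  (forall c, @charts R M c -> open (cmap c @` cdom c)).

Lemma manifold_good_charts M : is_manifold M -> good_charts M.
Proof. by case. Qed.

Lemma mopenP (M : premfd R) (O : set M) : good_charts M ->
  mopen O <-> forall c p, @charts R M c -> cdom c p -> O p -> nearc c O p.
Proof.
move=> [iM oM]; split=> [oO c p Mc cp Op|H c Mc].
  exists (cmap c @` (cdom c `&` O)); split; [exact: oO|by exists p|].
  by move=> q cq [q' [cq' Oq'] e]; rewrite -(iM _ Mc _ _ cq' cq e).
rewrite openE => _ [p [cp Op] <-]; have [V [oV Vp VO]] := H c p Mc cp Op.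
apply: filterS (open_nbhs_nbhs (conj (openI oV (oM _ Mc)) (conj Vp _))).
  by move=> u [Vu [q cq qu]]; exists q => //; split=> //; apply: VO => //; rewrite qu.
by exists p.
Qed.

Lemma mopen_preimage (M N : premfd R) (f : M -> N) (O : set N) :
  good_charts M -> good_charts N -> mcover N ->
  smooth f -> mopen O -> mopen (f @^-1` O).
Proof.
move=> gM gN cN sf /(mopenP _ gN) oO; apply/mopenP => // c p Mc cp Op.
have [c' Nc' c'p] := cN (f p).
by apply: (nearc_comp (c' := c') cp (sf p _ _ Mc Nc' cp c'p)); exact: oO.
Qed.

Lemma mopen_cdom (M : premfd R) c : good_charts M -> smooth (fun p : M => p) ->
  @charts R M c -> mopen (cdom c).
Proof.
move=> gM sM Mc; apply/mopenP => // c' p Mc' c'p cp.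
by have /local_repP[] := sM p _ _ Mc' Mc c'p cp.
Qed.

Lemma mopenI (M : premfd R) (O O' : set M) : good_charts M ->
  mopen O -> mopen O' -> mopen (O `&` O').
Proof.
move=> gM /(mopenP _ gM) oO /(mopenP _ gM) oO'; apply/mopenP => // c p Mc cp [Op O'p].
by apply: nearcI; [exact: oO|exact: oO'].
Qed.

Lemma smooth_at_truncP k (M : premfd R) (f : M -> trunc_mfd R k) p :
  smooth_at f p <-> forall c, @charts R M c -> cdom c p ->
    forall i : 'I_k.+1, smc c (fun q => tcoef i (f q)) p.
Proof.
split=> [sf c Mc cp i|H c _ Mc -> cp _].
  have /local_repP[_ /(_ i)] := sf c _ Mc erefl cp I.
  by apply: smc_ext => q _; rewrite mxE.
apply/local_repP; split=> [|j]; first exact: nearcT.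
by apply: smc_ext (H c Mc cp j) => q _; rewrite mxE.
Qed.

Lemma smooth_at_weilP k d (M : premfd R) (f : M -> weil_mfd R k d) p :
  smooth_at f p <-> forall c, @charts R M c -> cdom c p ->
    forall j, smc c (fun q => wcoord (f q) 0 j) p.
Proof.
split=> [sf c Mc cp j|H c _ Mc -> cp _].
  by have /local_repP[_ /(_ j)] := sf c _ Mc erefl cp I.
by apply/local_repP; split=> [|j]; [exact: nearcT|exact: H].
Qed.

Lemma smc_det T (c : chart R T) p n (A : T -> 'M[R]_n) :
  (forall i j, smc c (fun q => A q i j) p) -> smc c (fun q => \det (A q)) p.
Proof.
move=> sA; apply: smc_sum => s _; apply: smcZ.
by apply: smc_prod => i _; exact: sA.
Qed.

Lemma smc_mulmx T (c : chart R T) p m n l (A : T -> 'M[R]_(m, n))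
    (B : T -> 'M[R]_(n, l)) :
  (forall i j, smc c (fun q => A q i j) p) ->
  (forall i j, smc c (fun q => B q i j) p) ->
  forall i j, smc c (fun q => (A q *m B q) i j) p.
Proof.
move=> sA sB i j; under eq_fun do rewrite mxE.
by apply: smc_sum => h _; apply: smcM.
Qed.

Lemma smc_invmx T (c : chart R T) p n (A : T -> 'M[R]_n) :
  cdom c p -> A p \in unitmx -> (forall i j, smc c (fun q => A q i j) p) ->
  forall i j, smc c (fun q => invmx (A q) i j) p.
Proof.
move=> cp; rewrite unitmxE unitfE => Ap sA i j.
have sdet := smc_det sA.
(* On singular matrices [invmx] takes a default value, so the cofactor formula is used only near
   [p], where the determinant stays nonzero. *)
apply: (@smc_near _ _ _ (fun q => (\det (A q))^-1 * cofactor (A q) j i)).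
  apply: nearcW (nearc_neq0 cp Ap sdet) => q _ Aq.
  by rewrite /invmx unitmxE unitfE Aq !mxE.
apply: smcM; first exact: smcV.
apply: smcZ; apply: smc_det => i' j'.
by under eq_fun do rewrite !mxE; exact: sA.
Qed.

(* A left inverse of [T p] reduces the system to a square one, which is solved
   smoothly near [p]. *)
Lemma smc_solve M (c : chart R M) p m n (g : M -> 'rV[R]_m) (T : M -> 'M[R]_(m, n))
    (s : M -> 'rV[R]_n) :
  cdom c p -> row_free (T p) -> nearc c (fun q => g q *m T q = s q) p ->
  (forall i j, smc c (fun q => T q i j) p) ->
  (forall j, smc c (fun q => s q 0 j) p) ->
  forall j, smc c (fun q => g q 0 j) p.
Proof.
move=> cp fT gT sT ss j.
pose L := pinvmx (T p); pose D q := T q *m L.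
have Dp : D p = 1%:M by rewrite /D mulmxVp.
have sD := smc_mulmx sT (B := fun=> L) (fun _ _ => smc_cst _ _ _).
have uD : D p \in unitmx by rewrite Dp unitmx1.
have dD : \det (D p) != 0 by rewrite -unitfE -unitmxE.
have near_det := nearc_neq0 cp dD (smc_det sD).
apply: (@smc_near _ _ _ (fun q => ((s q *m L) *m invmx (D q)) 0 j)).
  apply: nearcW (nearcI gT near_det) => q _ [<- Dq].
  by rewrite -(mulmxA (g q)) mulmxK // unitmxE unitfE.
apply: (@smc_mulmx _ c p _ _ _ (fun q => s q *m L)); last exact: smc_invmx.
apply: smc_mulmx; last by move=> *; exact: smc_cst.
by move=> i l; rewrite (ord1 i); exact: ss.
Qed.

End Germs.

(** * Homogeneous smooth functions *)

Section Homogeneous.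
Context (R : realType).

Lemma derive_scale_coord m (a : R) (l : 'I_m) (x v : 'rV[R]_m) :
  'D_v (fun y : 'rV[R]_m => a * y 0 l) x = a * v 0 l.
Proof.
have dc := @differentiable_coord R 1 m x 0 l.
have := deriveZ a (@diff_derivable _ _ _ (fun y : 'rV[R]_m => y 0 l : R^o) x v dc).
move=> Da; apply: etrans Da _.
congr (_ * _); rewrite deriveE //.
have lin : linear (fun x : 'rV[R]_m => x 0 l : R^o) by move=> b y z; rewrite !mxE.
pose L := GRing.isLinear.Build _ _ _ _ _ lin.
pose f : {linear 'rV[R]_m -> R^o} := HB.pack (fun x : 'rV[R]_m => x 0 l : R^o) L.
rewrite -[LHS]/('d f x v) diff_lin //.
exact: coord_continuous.
Qed.

Lemma derive_comp_row m n (f : 'rV[R]_m -> 'rV[R]_n) (g : 'rV[R]_n -> R) x v :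
  differentiable f x -> differentiable g (f x) ->
  'D_v (g \o f) x =
  \sum_j 'D_v (fun y => f y 0 j) x * 'D_(delta_mx 0 j) g (f x).
Proof.
move=> df dg.
rewrite deriveE; last exact: differentiable_comp.
rewrite diff_comp //= -(deriveE v df).
rewrite [in LHS](row_sum_delta ('D_v f x)) linear_sum.
apply: eq_bigr => j _; rewrite linearZ (deriveE _ dg) /=; congr (_ * _).
by rewrite (derive_mx (M := f)) ?mxE //; exact: diff_derivable.
Qed.

Lemma continuous_eq0 (h : R -> R) :
  {for 0, continuous h} -> (forall t, t != 0 -> h t = 0) -> h 0 = 0.
Proof.
move=> ch h0; apply/eqP; apply: contraT => hn0.
have [e /= e0 H] := (nbhs_ballP _ _).1 (cvgr_neq0 _ ch hn0).
have e2 : 0 < e / 2 by rewrite divr_gt0.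
have := h0 (e / 2); rewrite gt_eqF // => /(_ isT)/eqP; apply: contraTT => _.
apply: H; rewrite /ball /= sub0r normrN gtr0_norm //.
by rewrite ltr_pdivrMr // ltr_pMr // ltr1n.
Qed.

Lemma continuous_exprn n : continuous (fun t : R => t ^+ n).
Proof.
elim: n => [|n IH] t; first exact: cst_continuous.
under eq_fun do rewrite exprS.
have ci : {for t, continuous (fun t : R => t)} by exact: cvg_id.
exact: continuousM ci (IH t).
Qed.

Section Degree.
Context (d : seq nat).
Local Notation n := (rk d).
Implicit Types (f : 'rV[R]_n -> R) (y : 'rV[R]_n).

Lemma wt_gt0 (j : 'I_n) : (0 < wt j)%N.
Proof. by []. Qed.

Lemma dil0 y : dil 0 y = 0.
Proof. by apply/rowP => j; rewrite !mxE expr0n mul0r. Qed.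

Lemma smooth_dil t : smooth_map setT (@dil R d t).
Proof.
move=> j r; under eq_fun do rewrite mxE.
by apply: CdiffM; [exact: openT|exact: Cdiff_cst|exact: Cdiff_coord].
Qed.

Lemma smooth_dil_time y : smooth_map setT (fun s : 'rV[R]_1 => dil (s 0 0) y).
Proof.
move=> j r; under eq_fun do rewrite mxE.
apply: CdiffM; [exact: openT| |exact: Cdiff_cst].
elim: (wt j) => [|w IH]; first exact: Cdiff_cst.
under eq_fun do rewrite exprS.
by apply: CdiffM; [exact: openT|exact: Cdiff_coord|].
Qed.

Lemma smooth_map_differentiable p q (F : 'rV[R]_p -> 'rV[R]_q) x :
  smooth_map setT F -> differentiable F x.
Proof.
by move=> sF; apply: differentiable_rowP => j; case: (sF j 1%N) => df _; exact: df.
Qed.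

Lemma continuous_dil_time f y :
  smooth_fun setT f -> {for 0, continuous (fun t => f (dil t y))}.
Proof.
move=> sf.
have cs : continuous (fun t : R => const_mx t : 'rV[R]_1).
  move=> t; apply: continuous_rowP => j.
  rewrite (_ : (fun t : R => (const_mx t : 'rV[R]_1) 0 j) = id).
    exact: cvg_id.
  by apply/funext => s; rewrite mxE.
have -> : (fun t => f (dil t y)) =
    (f \o (fun s : 'rV[R]_1 => dil (s 0 0) y)) \o (fun t : R => const_mx t).
  by apply/funext => t /=; rewrite mxE.
apply: continuous_comp; first exact: cs.
have := @Cdiff_comp R 0%N _ _ setT setT _ f openT (fun _ _ => I)
  (fun j => smooth_dil_time y j 0%N) (sf 0%N).
exact.
Qed.

Definition homogeneous i f := forall t y, f (dil t y) = t ^+ i * f y.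

(** Differentiate the homogeneity relation in the direction [j]: only the [j]-th component of
    [dil t] varies, at rate [t ^+ wt j]. *)
Lemma derive_homogeneous i f (j : 'I_n) t y : smooth_fun setT f ->
  homogeneous i f ->
  t ^+ wt j * 'D_(delta_mx 0 j) f (dil t y) = t ^+ i * 'D_(delta_mx 0 j) f y.
Proof.
move=> sf hf; have df x : differentiable f x by case: (sf 1%N) => df _; exact: df.
have := derive_comp_row (delta_mx 0 j)
  (smooth_map_differentiable y (smooth_dil t)) (df (dil t y)).
rewrite (bigD1 j) //= big1 => [|l lj]; last first.
  under eq_fun do rewrite mxE.
  by rewrite derive_scale_coord mxE (negbTE lj) andbF mulr0 mul0r.
have -> : (fun z : 'rV[R]_n => dil t z 0 j) = (fun z => t ^+ wt j * z 0 j).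
  by apply/funext => z; rewrite mxE.
rewrite derive_scale_coord mxE !eqxx mulr1 addr0 => <-.
have -> : f \o dil t = t ^+ i \*: f by apply/funext => z; exact: hf.
by rewrite deriveZ //; exact: diff_derivable.
Qed.

(** Derivative at [t = 1] of the homogeneity relation. Time is a row vector of length one, so that
    the chain rule for row vectors applies. *)
Lemma euler i f y : smooth_fun setT f -> homogeneous i f ->
  i%:R * f y = \sum_j (wt j)%:R * y 0 j * 'D_(delta_mx 0 j) f y.
Proof.
move=> sf hf; have df x : differentiable f x by case: (sf 1%N) => df _; exact: df.
have dX (w : nat) (a : R) :
    'D_(const_mx 1) (fun s : 'rV[R]_1 => s 0 0 ^+ w * a) (const_mx 1) = w%:R * a.
  have dc := @diff_derivable _ _ _ (fun s : 'rV[R]_1 => s 0 0 : R) _ (const_mx 1 : 'rV[R]_1)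
    (@differentiable_coord R 1 1 (const_mx 1) 0 0).
  have dXw := @derivableX _ _ _ w _ _ dc.
  have -> : (fun s : 'rV[R]_1 => s 0 0 ^+ w * a) =
      a *: ((fun s : 'rV[R]_1 => s 0 0 : R) ^+ w).
    by apply/funext => s; rewrite exprfctE mulrC.
  rewrite deriveZ // deriveX // mxE expr1n.
  have := derive_scale_coord 1 0 (const_mx 1 : 'rV[R]_1) (const_mx 1).
  have -> : (fun z : 'rV[R]_1 => 1 * z 0 0) = (fun z => z 0 0).
    by apply/funext => z; rewrite mul1r.
  by rewrite mxE mulr1 => ->; rewrite /GRing.scale /= !mulr1 mulrC.
have d1 : dil 1 y = y by apply/rowP => j; rewrite mxE expr1n mul1r.
have := derive_comp_row (const_mx 1)
  (smooth_map_differentiable (const_mx 1) (smooth_dil_time y)) (df _).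
rewrite mxE d1.
have -> : f \o (fun s : 'rV[R]_1 => dil (s 0 0) y) = (fun s => s 0 0 ^+ i * f y).
  by apply/funext => s; exact: hf.
rewrite dX => ->; apply: eq_bigr => j _.
by under eq_fun do rewrite mxE; rewrite dX.
Qed.

(** For [t != 0] a power of [t] cancels in [derive_homogeneous], and continuity extends the result
    to [t = 0]. When [wt j > i], a positive power of [t] is left in front of the derivative at
    [dil t y], and [t = 0] makes the derivative at [y] vanish. *)
Lemma homogeneous_derive i f (j : 'I_n) : smooth_fun setT f -> homogeneous i f ->
  if (wt j <= i)%N then homogeneous (i - wt j) ('D_(delta_mx 0 j) f)
  else forall y, 'D_(delta_mx 0 j) f y = 0.
Proof.
move=> sf hf; set g := 'D_(delta_mx 0 j) f.
have sg : smooth_fun setT g by move=> r; case: (sf r.+1) => _; exact.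
have H t y := derive_homogeneous j t y sf hf.
have cg y := @continuous_dil_time _ y sg.
case: ifP => [ji t y|/negbT]; last rewrite -ltnNge => ij y.
  have {}H s : s != 0 -> g (dil s y) - s ^+ (i - wt j) * g y = 0.
    move=> s0; apply/eqP; rewrite subr_eq0; apply/eqP.
    apply: (mulfI (expf_neq0 (wt j) s0)); rewrite H.
    by rewrite mulrA -exprD subnKC.
  apply/eqP; rewrite -subr_eq0; have [->|t0] := eqVneq t 0; last by rewrite H.
  apply/eqP; apply: (@continuous_eq0 (fun s => g (dil s y) - s ^+ (i - wt j) * g y)) => //.
  apply: continuousB; first exact: cg.
  apply: continuousM; last exact: cst_continuous.
  exact: continuous_exprn.
have {}H s : s != 0 -> s ^+ (wt j - i) * g (dil s y) - g y = 0.
  move=> s0; apply/eqP; rewrite subr_eq0; apply/eqP.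
  apply: (mulfI (expf_neq0 i s0)); rewrite -H.
  by rewrite mulrA -exprD subnKC // ltnW.
apply/eqP; rewrite -oppr_eq0; apply/eqP.
have := @continuous_eq0 (fun s => s ^+ (wt j - i) * g (dil s y) - g y).
rewrite expr0n subn_eq0 leqNgt ij mul0r add0r; apply=> //.
apply: continuousB; last exact: cst_continuous.
by apply: continuousM; [exact: continuous_exprn|exact: cg].
Qed.

(* Euler's identity expresses f through its partial derivatives, which are
   homogeneous of smaller degree. *)
Lemma homogeneous_poly i f : smooth_fun setT f -> homogeneous i f ->
  exists p : mpoly n R, (forall m, m \in msupp p -> wtm m = i) /\
    forall y, f y = meval (fun j => y 0 j) p.
Proof.
elim/ltn_ind: i f => i IH f sf hf.
have [i0|i0] := posnP i.
  (* In degree 0, homogeneity at [t = 0] reads [f 0 = f y], because [0 ^+ 0 = 1]. *)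
  exists (mpolyC n (f 0)); split=> [m|y]; last first.
    by rewrite mevalC -(dil0 y) hf i0 mul1r.
  rewrite msuppC; case: ifP => // _; rewrite inE => /eqP ->.
  by rewrite i0 /wtm big1 // => j _; rewrite mnm0E.
have H (j : 'I_n) : exists p : mpoly n R,
    (forall m, m \in msupp p -> (wtm m + wt j)%N = i) /\
    forall y, 'D_(delta_mx 0 j) f y = meval (fun j => y 0 j) p.
  have := homogeneous_derive j sf hf; case: ifP => [ji hD|_ D0]; last first.
    by exists 0; split=> [m|y]; rewrite ?msupp0 // D0 meval0.
  have sD : smooth_fun setT ('D_(delta_mx 0 j) f).
    by move=> r; case: (sf r.+1) => _; exact.
  have [|p [pi pE]] := IH (i - wt j)%N _ _ sD hD.
    by rewrite ltn_subrL i0 wt_gt0.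
  by exists p; split=> // m /pi ->; rewrite subnK.
have {H}[p H] := choice H.
(* The coefficients are those of Euler's identity divided by the degree [i > 0]; the monomials of
   [p j] have weight [i - wt j], and the factor of weight [wt j] restores [i]. *)
exists (\sum_j ((wt j)%:R / i%:R) *: (mpolyX R (mnm1 j) * p j)); split=> [m|y].
  move=> /msupp_sum_le /flattenP[s /mapP[j _ ->]].
  move=> /msuppZ_le; rewrite mulrC (perm_mem (msuppMX _ _)) => /mapP[m' m'p ->].
  rewrite -((H j).1 _ m'p) addnC /wtm.
  under eq_bigr do rewrite mnmDE mulnDl.
  rewrite big_split /=; congr (_ + _)%N.
  rewrite (bigD1 j) //= mnm1E eqxx mul1n big1 ?addn0 // => l lj.
  by rewrite mnm1E eq_sym (negbTE lj).
rewrite raddf_sum /=; apply: (mulfI (_ : i%:R != 0 :> R)).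
  by rewrite pnatr_eq0 -lt0n.
rewrite (euler y sf hf) mulr_sumr; apply: eq_bigr => j _.
rewrite mevalZ mevalM mevalXU -(H j).2 !mulrA; congr (_ * _ * _).
by rewrite mulrAC divff ?mul1r // pnatr_eq0 -lt0n.
Qed.

End Degree.
End Homogeneous.

(** * Characters of the free Weil algebra *)

Section Weil.
Context (R : realType).

Definition monv n (m : multinom n) (y : 'rV[R]_n) : R := \prod_i y 0 i ^+ m i.

Lemma monv1 n (m : multinom n) : monv m (const_mx 1) = 1.
Proof. by rewrite /monv big1 // => i _; rewrite mxE expr1n. Qed.

Lemma monv_scale n (m : multinom n) (j : 'I_n) (y : 'rV[R]_n) :
  monv m (\row_i ((if i == j then 2 else 1) * y 0 i)) = 2 ^+ m j * monv m y.
Proof.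
rewrite /monv (bigD1 j) //= [in RHS](bigD1 j) //= mxE eqxx exprMn -!mulrA.
congr (_ * (_ * _)); apply: eq_bigr => i /negbTE ij.
by rewrite mxE ij mul1r.
Qed.

(* Distinct monomials are distinct characters; doubling one variable and
   subtracting eliminates the head of the list. *)
Lemma monv_independent n (J : eqType) (mm : J -> multinom n) (U : Type)
    (C : (U -> R) -> Prop) (s : seq J) (c : J -> U -> R) :
  injective mm ->
  (forall f g, C f -> C g -> C (fun u => f u + g u)) ->
  (forall a f, C f -> C (fun u => a * f u)) ->
  uniq s ->
  (forall y, C (fun u => \sum_(j <- s) c j u * monv (mm j) y)) ->
  forall j, j \in s -> C (c j).
Proof.
move=> mi CD CZ; elim: s c => [|j0 s IH] c //= /andP[j0s us] H.
have Cs j : j \in s -> C (c j).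
  move=> js.
  have [l jl] : exists l, mm j l != mm j0 l.
    apply/existsP; rewrite -[X in is_true X]negbK negb_exists; apply/forallP => e.
    have e' : mm j = mm j0.
      by apply/mnmP => l; apply/eqP; have := e l; rewrite negbK.
    by rewrite -(mi _ _ e') js in j0s.
  (* The factor that [c j] acquires when the variable [l] is doubled and [2 ^+ mm j0 l] times the
     original sum is subtracted; it is zero at [j0], and nonzero at the present [j] since the
     exponents of [l] differ. *)
  pose a j : R := 2 ^+ mm j l - 2 ^+ mm j0 l.
  have aj : a j != 0.
    rewrite subr_eq0; apply: contra jl => /eqP e.
    apply/eqP; apply: (@ieexprIn R 2) e => //; 
    by rewrite (eqr_nat R 2 1).
  have := IH (fun j u => a j * c j u) us _ j js.
  have CE f g : C f -> (forall u, f u = g u) -> C g.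
    by move=> Cf fg; rewrite (_ : g = f) //; apply/funext => u; rewrite fg.
  move=> CI; apply: (CE (fun u => (a j)^-1 * (a j * c j u))); last first.
    by move=> u; rewrite mulKf.
  apply: (CZ); apply: CI => y.
  pose y' := \row_i ((if i == l then 2 else 1) * y 0 i) : 'rV[R]_n.
  apply: CE (CD _ _ (H y') (CZ (- 2 ^+ mm j0 l) _ (H y))) _ => u.
  rewrite !big_cons monv_scale mulrDr addrACA mulrCA.
  rewrite mulNr subrr add0r mulNr mulr_sumr -sumrB; apply: eq_bigr => i _.
  by rewrite /a monv_scale !mulrBl mulrCA !mulrA.
move=> j; rewrite inE => /orP[/eqP->|/Cs //].
have CE f g : C f -> (forall u, f u = g u) -> C g.
  by move=> Cf fg; rewrite (_ : g = f) //; apply/funext => u; rewrite fg.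
(* At the point with all coordinates 1 every monomial is 1, so the head coefficient is the whole sum
   minus the tail. For an empty tail, the zero function is obtained as 0 times an instance of
   [H]. *)
have C0 : C (fun u => \sum_(j <- s) c j u).
  elim: (s) Cs => [_|i s' IHs Cs'].
    by apply: CE (CZ 0 _ (H 0)) _ => u; rewrite big_nil mul0r.
  have Ci : C (c i) by apply: Cs'; rewrite inE eqxx.
  have Cs'' : forall j, j \in s' -> C (c j).
    by move=> i' i's'; apply: Cs'; rewrite inE i's' orbT.
  by apply: CE (CD _ _ Ci (IHs Cs'')) _ => u; rewrite big_cons.
apply: CE (CD _ _ (H (const_mx 1)) (CZ (-1) _ C0)) _ => u.
rewrite big_cons monv1 mulr1 mulN1r.
under [X in _ + X - _]eq_bigr do rewrite monv1 mulr1.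
by rewrite addrK.
Qed.

(** * Evaluation homomorphisms from the Weil algebra to A^[k] *)

Section Evaluation.
Context (k : nat) (d : seq nat).
Local Notation n := (rk d).
Local Notation W := (weil R k d).
Local Notation T := (trunc R k).
Local Notation pi := (@weil_pi R k d).

Definition epsmap (y : 'rV[R]_n) (j : 'I_n) : T := y 0 j *: ((eps R k : T) ^+ wt j).

Definition pev (y : 'rV[R]_n) (p : mpoly n R) : T :=
  mmap (GRing.in_alg T) (epsmap y) p.

(** Computed on a chosen representative. By [wev_pi] the choice is immaterial: polynomials of weight
    above [k] go to multiples of vanishing powers of [eps]. *)
Definition wev (y : 'rV[R]_n) (a : W) : T := pev y (repr (a : weil_quot R k d)).

Lemma eps_high i : (k < i)%N -> eps R k ^+ i = 0 :> T.
Proof.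
move=> ki; apply: tcoef_eq => j jk; rewrite tcoef_eps // tcoef0.
by rewrite (ltn_eqF (leq_trans jk ki)).
Qed.

Lemma pevX y m : pev y (mpolyX R m) = monv m y *: ((eps R k : T) ^+ wtm m).
Proof.
rewrite /pev mmapX /mmap1 /monv /wtm.
have E i : epsmap y i ^+ m i = (y 0 i ^+ m i) *: (((eps R k : T) ^+ wt i) ^+ m i).
  exact: exprZn.
rewrite (eq_bigr _ (fun i _ => E i)).
rewrite [LHS](_ : _ = (\prod_i y 0 i ^+ m i) *: \prod_i (((eps R k : T) ^+ wt i) ^+ m i)).
  by congr (_ *: _); rewrite expr_sum; apply: eq_bigr => i _; rewrite mulnC exprM.
exact: scaler_prod.
Qed.

Lemma pevZ y c p : pev y (c *: p) = c *: pev y p.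
Proof. by rewrite /pev mmapZ mulr_algl. Qed.

Lemma pevD y p q : pev y (p + q) = pev y p + pev y q.
Proof. exact: mmapD. Qed.

Lemma pev_high y p : high k p -> pev y p = 0.
Proof.
move=> /allP hp; rewrite (mpolyE p) /pev raddf_sum big_seq big1 //= => m /hp km.
by rewrite -[LHS]/(pev _ _) pevZ pevX eps_high // !scaler0.
Qed.

Lemma pi_eq p q : pi p = pi q -> high k (p - q).
Proof.
move=> /eqP; rewrite /weil_pi.
by rewrite -(Quotient.idealrBE (@high R k d : idealr (mpoly n R))).
Qed.

Lemma wev_pi y p : wev y (pi p) = pev y p.
Proof.
apply/eqP; rewrite -subr_eq0 /wev /pev -mmapB; apply/eqP; apply: pev_high.
by apply: pi_eq; rewrite /weil_pi reprK.
Qed.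

Lemma wpiP (a : W) : exists p, a = pi p.
Proof. by exists (repr (a : weil_quot R k d)); rewrite /weil_pi reprK. Qed.

Lemma is_ghom_wev y : is_ghom (wev y : W -> T).
Proof.
split.
- move=> c a b; have [p ->] := wpiP a; have [q ->] := wpiP b.
  rewrite [X in wev y X](_ : _ = pi (c *: p + q)); last by rewrite weil_piD weil_piZ.
  by rewrite !wev_pi pevD pevZ.
- split=> [|a b].
    rewrite [X in wev y X](_ : _ = pi 1); last by rewrite weil_pi1.
    by rewrite wev_pi /pev rmorph1.
  have [p ->] := wpiP a; have [q ->] := wpiP b.
  rewrite [X in wev y X](_ : _ = pi (p * q)); last by rewrite weil_piM.
  by rewrite !wev_pi /pev rmorphM.
- move=> i _ [p [pw ->]]; rewrite wev_pi /=.
  exists (\sum_(m <- msupp p) mcoeff m p * monv m y).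
  rewrite {1}(mpolyE p) /pev raddf_sum scaler_suml /=.
  rewrite big_seq [RHS]big_seq; apply: eq_bigr => m mp.
  by rewrite -[LHS]/(pev _ _) pevZ pevX scalerA (pw _ mp).
Qed.

Definition wmonom (j : 'I_#|{: wmon k d}|) : multinom n :=
  bmnm (val (enum_val j : wmon k d)).

Lemma wmonom_inj : injective wmonom.
Proof.
move=> i j e; apply: enum_val_inj; apply: val_inj; apply: val_inj; exact: e.
Qed.

Lemma wtm_wmonom j : (wtm (wmonom j) < k.+1)%N.
Proof. exact: (valP (enum_val j : wmon k d)). Qed.

(** The chosen representative differs from [p] only by monomials of weight above [k], and no
    [wmonom j] is of that kind. *)
Lemma wcoord_pi p j : wcoord (pi p) 0 j = mcoeff (wmonom j) p.
Proof.
rewrite mxE -/(wmonom j); apply/eqP; rewrite -subr_eq0 -mcoeffB; apply/eqP.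
apply: memN_msupp_eq0; apply/negP.
have /pi_eq/allP H : pi (repr (pi p)) = pi p by rewrite /weil_pi reprK.
by move/H; rewrite ltnNge -ltnS wtm_wmonom.
Qed.

Lemma wcoordP c (a b : W) j :
  wcoord (c *: a + b) 0 j = c * wcoord a 0 j + wcoord b 0 j.
Proof.
have [p ->] := wpiP a; have [q ->] := wpiP b.
rewrite [X in wcoord X](_ : _ = pi (c *: p + q)); last by rewrite weil_piD weil_piZ.
by rewrite !wcoord_pi mcoeffD mcoeffZ.
Qed.

Lemma wcoord_is_linear : linear (@wcoord R k d : W -> 'rV_#|{: wmon k d}|).
Proof. by move=> c a b; apply/rowP => j; rewrite wcoordP !mxE. Qed.

Lemma wcoord_inj : injective (@wcoord R k d).
Proof. by move=> a b e; rewrite (weil_decomp a) (weil_decomp b) e. Qed.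

Lemma wcoord_basis i j : wcoord (wbasis R i : W) 0 j = (i == j)%:R.
Proof. by rewrite wcoord_pi mcoeffX (inj_eq wmonom_inj). Qed.

Lemma wev_basis y j :
  wev y (wbasis R j) = monv (wmonom j) y *: ((eps R k : T) ^+ wtm (wmonom j)).
Proof. by rewrite wev_pi pevX. Qed.

Lemma wev_gen y j : wev y (wgen R k j) = y 0 j *: ((eps R k : T) ^+ wt j).
Proof.
rewrite wev_pi pevX; congr (_ *: _).
  rewrite /monv (bigD1 j) //= mnm1E eqxx big1 ?mulr1 // => i ij.
  by rewrite mnm1E eq_sym (negbTE ij).
congr (_ ^+ _).
rewrite /wtm (bigD1 j) //= mnm1E eqxx mul1n big1 ?addn0 // => i ij.
by rewrite mnm1E eq_sym (negbTE ij).
Qed.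

Lemma wevE y (a : W) :
  wev y a = \sum_j (wcoord a 0 j * monv (wmonom j) y) *:
              ((eps R k : T) ^+ wtm (wmonom j)).
Proof.
rewrite [in LHS](weil_decomp a).
have [lin _ _] := is_ghom_wev y.
pose L := GRing.isLinear.Build _ _ _ _ _ lin.
pose l : {linear W -> T} := HB.pack (wev y : W -> T) L.
rewrite -[LHS]/(l _) linear_sum; apply: eq_bigr => j _.
by rewrite linearZ /= wev_basis scalerA.
Qed.

Lemma tcoef_sum i (I : Type) (s : seq I) (P : pred I) (F : I -> T) :
  tcoef i (\sum_(j <- s | P j) F j) = \sum_(j <- s | P j) tcoef i (F j).
Proof. exact: (big_morph _ (@tcoefD R k i) (@tcoef0 R k i)). Qed.

Lemma tcoef_wev y i (a : W) : (i < k.+1)%N ->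
  tcoef i (wev y a) =
  \sum_j wcoord a 0 j * (i == wtm (wmonom j))%:R * monv (wmonom j) y.
Proof.
move=> ik; rewrite wevE tcoef_sum; apply: eq_bigr => j _.
by rewrite tcoefZ tcoef_eps // mulrAC.
Qed.

(** Summing the coefficients amounts to setting [eps] to 1. It turns an evaluation into a
    combination of monomials in [y], the form required by [monv_independent]. *)
Lemma sum_tcoef_wev y (a : W) :
  \sum_(i < k.+1) tcoef i (wev y a) = \sum_j wcoord a 0 j * monv (wmonom j) y.
Proof.
under eq_bigr do rewrite tcoef_wev //.
rewrite exchange_big; apply: eq_bigr => j _ /=.
rewrite (bigD1 (Ordinal (wtm_wmonom j))) //= eqxx mulr1 big1 ?addr0 // => i.
by rewrite -val_eqE /= => /negbTE ->; rewrite mulr0 mul0r.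
Qed.

Lemma wcoord_eq0 (P : pred 'I_#|{: wmon k d}|) (a : W) :
  (forall y, \sum_j wcoord a 0 j * (P j)%:R * monv (wmonom j) y = 0) ->
  forall j, P j -> wcoord a 0 j = 0.
Proof.
move=> H j Pj.
(* Constant coefficients are functions on a one-point type, and the class [C] consists of the zero
   function. *)
have := @monv_independent n _ wmonom unit (fun f => f tt = 0)
  (index_enum _) (fun j _ => wcoord a 0 j * (P j)%:R) wmonom_inj.
move=> /(_ _ _ _ _ j); rewrite Pj mulr1; apply.
- by move=> f g -> ->; rewrite addr0.
- by move=> b f ->; rewrite mulr0.
- exact: index_enum_uniq.
- exact: H.
- exact: mem_index_enum.
Qed.

Lemma wev_inj (a b : W) : (forall y, wev y a = wev y b) -> a = b.
Proof.
move=> ab; apply: wcoord_inj; apply/rowP => j; apply/eqP.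
rewrite -subr_eq0 -mulN1r addrC -wcoordP; apply/eqP.
apply: (@wcoord_eq0 predT) => // y.
under eq_bigr do rewrite mulr1.
rewrite -sum_tcoef_wev big1 // => i _.
have [lin _ _] := is_ghom_wev y.
by rewrite lin ab scaleN1r addNr tcoef0.
Qed.

(** The part of [a] in weights other than [i] evaluates to 0 at every [y], so its coefficients
    vanish; the monomials of weight [i] then form a homogeneous representative. *)
Lemma wev_gpart i (a : W) :
  (forall y, @gpart R T i (wev y a)) -> @gpart R W i a.
Proof.
move=> H; have a0 : forall j, i != wtm (wmonom j) -> wcoord a 0 j = 0.
  apply: wcoord_eq0 => y.
  have Hl (l : 'I_k.+1) : tcoef l (wev y a) * (i != l)%:R = 0.
    have [c ->] := H y; rewrite tcoefZ tcoef_eps // eq_sym.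
    by case: eqP; rewrite ?mulr0 ?mul0r.
  have : \sum_(l < k.+1) tcoef l (wev y a) * (i != l)%:R = 0 by rewrite big1.
  move=> e; apply: etrans e; apply/esym.
  under eq_bigr do rewrite tcoef_wev // mulr_suml.
  rewrite exchange_big; apply: eq_bigr => j _ /=.
  rewrite (bigD1 (Ordinal (wtm_wmonom j))) //= eqxx mulr1 big1 ?addr0 => [|l].
    by rewrite mulrAC.
  by rewrite -val_eqE /= => /negbTE ->; rewrite mulr0 !mul0r.
exists (\sum_(j | i == wtm (wmonom j)) wcoord a 0 j *: mpolyX R (wmonom j)); split.
  move=> m /msupp_sum_le /flattenP[s /mapP[j]].
  rewrite mem_filter => /andP[/eqP ij _] -> /msuppZ_le.
  by rewrite msuppX inE => /eqP ->.
apply: wcoord_inj; apply/rowP => j; rewrite wcoord_pi raddf_sum /=.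
have [ij|/a0 a00] := eqVneq i (wtm (wmonom j)); last first.
  rewrite big1 // => l /eqP il; rewrite mcoeffZ mcoeffX.
  case: eqP => [lj|_]; last by rewrite mulr0.
  by rewrite (wmonom_inj lj) a00 mul0r.
rewrite (bigD1 j) ?ij //= mcoeffZ mcoeffX eqxx mulr1 big1 ?addr0 // => l /andP[_ lj].
by rewrite mcoeffZ mcoeffX (inj_eq wmonom_inj) (negbTE lj) mulr0.
Qed.

Lemma wgen_gpart (j : 'I_n) : @gpart R W (wt j) (wgen R k j).
Proof.
exists (mpolyX R (mnm1 j)); split=> // m; rewrite msuppX inE => /eqP ->.
rewrite /wtm (bigD1 j) //= mnm1E eqxx mul1n big1 ?addn0 // => i ij.
by rewrite mnm1E eq_sym (negbTE ij).
Qed.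

Lemma wbasis_prod j : (wbasis R j : W) = \prod_i (wgen R k i : W) ^+ wmonom j i.
Proof.
rewrite /wbasis -/(wmonom j) mpolyXE_id.
have piX p e : pi (p ^+ e) = pi p ^+ e.
  by elim: e => [|e IH]; rewrite ?weil_pi1 // !exprS weil_piM IH.
rewrite (big_morph _ (@weil_piM R k d) (@weil_pi1 R k d)).
by apply: eq_bigr => i _; rewrite piX.
Qed.

Lemma ghom_gen (B : galg R) (f g : W -> B) : is_ghom f -> is_ghom g ->
  (forall j, f (wgen R k j) = g (wgen R k j)) -> forall a, f a = g a.
Proof.
move=> [lf [f1 fM] _] [lg [g1 gM] _] fg a.
pose Lf := GRing.isLinear.Build _ _ _ _ _ lf.
pose f' : {linear W -> B} := HB.pack f Lf.
pose Lg := GRing.isLinear.Build _ _ _ _ _ lg.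
pose g' : {linear W -> B} := HB.pack g Lg.
rewrite (weil_decomp a) -[LHS]/(f' _) -[RHS]/(g' _) !linear_sum.
apply: eq_bigr => j _; rewrite !linearZ /=; congr (_ *: _).
rewrite wbasis_prod (big_morph _ fM f1) (big_morph _ gM g1).
apply: eq_bigr => i _; elim: (wmonom j i) => [|e IH]; first by rewrite f1 g1.
by rewrite !exprS fM gM IH fg.
Qed.

Definition wlam (f : W -> T) : 'rV[R]_n :=
  \row_j tcoef (wt j) (f (wgen R k j)).

Hypothesis dk : size d = k.

Lemma wt_le (j : 'I_n) : (wt j < k.+1)%N.
Proof. by rewrite ltnS -[X in (_ <= X)%N]dk /wt. Qed.

(** A graded homomorphism sends the generator [j] to a multiple of [eps ^+ wt j], and [wlam] records
    the factor. As [wt j <= k], this power is nonzero and the factor can be read off. *)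
Lemma wlamK (f : W -> T) : is_ghom f -> forall a, wev (wlam f) a = f a.
Proof.
move=> gf; apply: ghom_gen => //; first exact: is_ghom_wev.
move=> j; rewrite wev_gen mxE; case: gf => _ _ /(_ _ _ (wgen_gpart j))[c ->].
by rewrite tcoefZ tcoef_eps ?wt_le // eqxx mulr1.
Qed.

Lemma wevK y : wlam (wev y) = y.
Proof.
by apply/rowP => j; rewrite mxE wev_gen tcoefZ tcoef_eps ?wt_le // eqxx mulr1.
Qed.

End Evaluation.
End Weil.

(** * The base of a graded bundle *)

Section GradedBundles.
Context (R : realType) (k : nat) (F : gbundle R) (gF : is_gbundle k F).
Implicit Types (phi psi : gtriv F) (x : base F) (p q : F).

Let mF := gbundle_mfd gF.
Let cF := is_manifold_cover mF.

Lemma compat_gtriv phi p : is_gtriv phi -> gdom phi p ->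
  compat (M := F) (gtriv_chart phi) p.
Proof. by move=> tphi phip c Fc cp; exact: gtriv_compat. Qed.

Lemma base_eq x y : sval x = sval y -> x = y.
Proof.
case: x y => [x hx] [y hy] /= e; case: _ / e hy => hy.
by congr exist; exact: Prop_irrelevance.
Qed.

Lemma gtriv_rep phi psi p : is_gtriv phi -> is_gtriv psi -> gdom phi p ->
  gdom psi p -> local_rep (gtriv_chart phi) (gtriv_chart psi) (fun q => q) p.
Proof.
move=> tphi tpsi phip psip; have [c Fc cp] := cF p.
have [_ h1] := gtriv_compat tphi Fc cp phip.
have [h2 _] := gtriv_compat tpsi Fc cp psip.
exact: (local_rep_idl (phip : cdom (gtriv_chart phi) p) h1 h2).
Qed.

Lemma smc_gbase phi p j : smc (gtriv_chart phi) (fun q => gbase phi q 0 j) p.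
Proof.
apply: smc_ext (@smc_coord _ _ (gtriv_chart phi) p (lshift _ j)) => q _ /=.
by rewrite row_mxEl.
Qed.

Lemma smc_gfib phi p j : smc (gtriv_chart phi) (fun q => gfib phi q 0 j) p.
Proof.
apply: smc_ext (@smc_coord _ _ (gtriv_chart phi) p (rshift _ j)) => q _ /=.
by rewrite row_mxEr.
Qed.

Lemma proj_dom phi p : is_gtriv phi -> gdom phi (sval (proj p)) <-> gdom phi p.
Proof. by move=> tphi; rewrite [in X in _ <-> X](gtriv_sat tphi). Qed.

Lemma gbase_proj phi p : is_gtriv phi -> gdom phi p ->
  gbase phi (act 0 p) = gbase phi p.
Proof. by move=> tphi phip; case: (gtriv_act tphi 0 phip). Qed.

Lemma gfib_proj phi p : is_gtriv phi -> gdom phi p -> gfib phi (act 0 p) = 0.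
Proof. by move=> tphi phip; case: (gtriv_act tphi 0 phip) => _ ->; exact: dil0. Qed.

Lemma gfib_base phi x : is_gtriv phi -> gdom phi (sval x) -> gfib phi (sval x) = 0.
Proof. by move=> tphi phix; rewrite -(svalP x) gfib_proj. Qed.

Lemma proj_sval x : proj (sval x) = x.
Proof. by apply: base_eq; exact: (svalP x). Qed.

(** The image of a trivialization is a full product of an open set with R^d, so fibre coordinates
    may be changed at will. *)
Lemma gpt_ex phi p y : is_gtriv phi -> gdom phi p ->
  exists q, [/\ gdom phi q, gbase phi q = gbase phi p & gfib phi q = y].
Proof.
move=> tphi phip; have [V oV VP] := gtriv_im tphi.
by apply/(VP _ y)/(VP _ (gfib phi p)); exists p.
Qed.

(* Junk value [p] outside the domain of [phi]. *)
Definition gpt phi (y : 'rV[R]_(rk (gtype phi))) (p : F) : F :=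
  if pselect (exists q, [/\ gdom phi q, gbase phi q = gbase phi p & gfib phi q = y])
  is left H then projT1 (cid H) else p.

Lemma gptP phi p y : is_gtriv phi -> gdom phi p ->
  [/\ gdom phi (gpt y p), gbase phi (gpt y p) = gbase phi p,
      gfib phi (gpt y p) = y & act 0 (gpt y p) = act 0 p].
Proof.
move=> tphi phip; rewrite /gpt; case: pselect => [H|[]]; last exact: gpt_ex.
case: (cid H) => /= q [phiq qp qy].
(* The two projections have the same base coordinates, and both have fibre coordinates 0. *)
split=> //; apply: (gtriv_inj tphi).
- exact: (gtriv_sat tphi q).1.
- exact: (gtriv_sat tphi p).1.
- by rewrite !gbase_proj.
- by rewrite !gfib_proj.
Qed.

Lemma base_chart_rep phi x : is_gtriv phi ->
  local_rep (base_chart phi) (gtriv_chart phi) (fun x => sval x) x.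
Proof.
move=> tphi; apply/local_repP; split=> [|j]; first exact: nearcT.
rewrite /=; case: (split_ordP j) => i ->.
  by apply: smc_ext (@smc_coord _ _ (base_chart phi) x i) => q _; rewrite row_mxEl.
apply: smc_ext (smc_cst _ _ 0) => q phiq.
by rewrite row_mxEr gfib_base // mxE.
Qed.

Lemma proj_rep phi p : is_gtriv phi ->
  local_rep (gtriv_chart phi) (base_chart phi) (@proj R F) p.
Proof.
move=> tphi; apply/local_repP; split=> [|j].
  by apply: nearcT => q phiq; exact/proj_dom.
apply: smc_ext (@smc_gbase phi p j) => q phiq.
by rewrite /= gbase_proj.
Qed.

(** The local section of the projection with constant fibre coordinates [y], along which families of
    functions on the fibres will be sampled. *)
Lemma gpt_rep phi (y : 'rV[R]_(rk (gtype phi))) x : is_gtriv phi ->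
  local_rep (base_chart phi) (gtriv_chart phi) (fun x => gpt y (sval x)) x.
Proof.
move=> tphi; apply/local_repP; split=> [|j].
  by apply: nearcT => q phiq; case: (gptP y tphi phiq).
rewrite /=; case: (split_ordP j) => i ->.
  apply: smc_ext (@smc_coord _ _ (base_chart phi) x i) => q phiq; rewrite row_mxEl.
  by have [_ -> _ _] := gptP y tphi phiq.
apply: smc_ext (smc_cst _ _ (y 0 i)) => q phiq; rewrite row_mxEr.
by have [_ _ -> _] := gptP y tphi phiq.
Qed.

Lemma base_chart_compat phi psi x : is_gtriv phi -> is_gtriv psi ->
  gdom phi (sval x) -> gdom psi (sval x) ->
  local_rep (base_chart phi) (base_chart psi) (fun x => x) x.
Proof.
move=> tphi tpsi phix psix.
(* Passing through the total space turns a change of base charts into a change of trivializations of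
   [F]. *)
have -> : (fun x => x) = @proj R F \o (fun x : base F => sval x).
  by apply/funext => z; rewrite /= proj_sval.
apply: (@local_rep_comp _ _ _ _ (base_chart phi) (gtriv_chart psi)) => //.
  by apply: (local_rep_idr _ (base_chart_rep _ tphi)) => //; exact: gtriv_rep.
exact: proj_rep.
Qed.

Lemma base_id_smooth : smooth (fun x : base F => x).
Proof. by move=> x _ _ [phi tphi ->] [psi tpsi ->]; exact: base_chart_compat. Qed.

Lemma base_good_charts : good_charts (base F).
Proof.
split=> [_ [phi tphi ->] x y /= phix phiy e|_ [phi tphi ->]].
  by apply: base_eq; apply: (gtriv_inj tphi) => //; rewrite !gfib_base.
have [V oV VP] := gtriv_im tphi.
rewrite (_ : [set _ | _ in _] = V) //; apply/seteqP; split=> [u [x phix <-]|u Vu].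
  by apply/(VP _ (gfib phi (sval x))); exists (sval x).
have [p [phip pu p0]] := (VP u 0).1 Vu.
exists (proj p); first exact/proj_dom.
by rewrite /= gbase_proj.
Qed.

Lemma base_cover : mcover (base F).
Proof.
move=> x; have [n [d [_ /(_ (sval x))[phi [tphi _ _ phix]]]]] := gbundle_triv gF.
by exists (base_chart phi) => //; exists phi.
Qed.

Lemma sval_base_smooth : smooth (fun x : base F => sval x : F).
Proof.
move=> x _ c [phi tphi ->] Fc phix cx.
have [_ h] := gtriv_compat tphi Fc cx phix.
exact: local_rep_idr phix (base_chart_rep _ tphi) h.
Qed.

Lemma proj_smooth : smooth (@proj R F).
Proof.
move=> p c _ Fc [phi tphi ->] cp /= phip.
have {}phip : gdom phi p by exact/(gtriv_sat tphi).
have [h _] := gtriv_compat tphi Fc cp phip.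
exact: local_rep_idl cp h (proj_rep _ tphi).
Qed.

Lemma base_manifold : is_manifold (base F).
Proof.
have gFc := manifold_good_charts mF.
have gb := base_good_charts.
split; [exact: gb.1|exact: gb.2|exact: base_id_smooth| | |].
- have [n [d [_ H]]] := gbundle_triv gF; exists n => x.
  have [phi [tphi phin _ phix]] := H (sval x).
  by exists (base_chart phi); split=> //; exists phi.
- move=> x y xy; have sxy : sval x <> sval y by move=> e; apply: xy; exact: base_eq.
  have [U [W [oU oW Ux Wy UW]]] := manifold_hausdorff mF sxy.
  exists ((fun x : base F => sval x) @^-1` U), ((fun x : base F => sval x) @^-1` W).
  split=> //; try by apply: mopen_preimage => //; exact: sval_base_smooth.
  apply/seteqP; split=> // z [/= Uz Wz].
  by have : (U `&` W) (sval z) by []; rewrite UW.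
- have [B [oB HB]] := manifold_second_countable mF.
  exists (fun i => (fun x : base F => sval x) @^-1` B i); split=> [i|O x oO Ox].
    by apply: mopen_preimage => //; exact: sval_base_smooth.
  (* To compare [O] with the basis of [F] it is thickened to its preimage under the projection,
     which meets the base exactly in [O]. *)
  have oO' : mopen (@proj R F @^-1` O).
    by apply: mopen_preimage => //; [exact: base_cover|exact: proj_smooth].
  have [|i [Bx BO]] := HB _ (sval x) oO'; first by rewrite /= proj_sval.
  by exists i; split=> // z /= /BO /=; rewrite proj_sval.
Qed.

End GradedBundles.

Local Notation lm tau x := (@lmap _ _ _ _ tau x).

Lemma inj_surj_bijective (A B : Type) (f : A -> B) :
  injective f -> (forall b, exists a, f a = b) -> bijective f.
Proof. by move=> fi /choice[g fg]; exists g => // a; apply: fi; rewrite fg. Qed.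

(** * The Weil algebra bundle of a graded bundle *)

Section Frames.
Context (R : realType) (k : nat).

(* Junk value [0] outside the range of [f]. *)
Definition winv d (B : galg R) (f : weil R k d -> B) (b : B) : weil R k d :=
  if pselect (exists a, f a = b) is left H then projT1 (cid H) else 0.

Lemma winvK d (B : galg R) (f : weil R k d -> B) : bijective f -> cancel (winv f) f.
Proof.
move=> [g fg gf] b; rewrite /winv; case: pselect => [H|[]]; first by case: (cid H).
by exists (g b).
Qed.

Lemma winvE d (B : galg R) (f : weil R k d -> B) : bijective f -> cancel f (winv f).
Proof. by move=> bf a; apply: (bij_inj bf); rewrite winvK. Qed.

Definition fcoord d (B : galg R) (f : weil R k d -> B) (b : B) := wcoord (winv f b).

Lemma fcoord_linear d (B : galg R) (f : weil R k d -> B) :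
  is_ghom f -> bijective f -> linear (fcoord f).
Proof.
move=> [lf _ _] bf c a b; rewrite /fcoord -wcoord_is_linear; congr wcoord.
by apply: (bij_inj bf); rewrite lf !winvK.
Qed.

Lemma ghom_sum (A B : galg R) (f : A -> B) n (u : 'I_n -> R) (b : 'I_n -> A) :
  is_ghom f -> f (\sum_j u j *: b j) = \sum_j u j *: f (b j).
Proof.
move=> [lf _ _]; pose Lf := GRing.isLinear.Build _ _ _ _ _ lf.
pose f' : {linear A -> B} := HB.pack f Lf.
by rewrite -[LHS]/(f' _) linear_sum; apply: eq_bigr => j _; rewrite linearZ.
Qed.

Lemma ghom0 (A B : galg R) (f : A -> B) : is_ghom f -> f 0 = 0.
Proof.
move=> [lf _ _]; pose Lf := GRing.isLinear.Build _ _ _ _ _ lf.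
pose f' : {linear A -> B} := HB.pack f Lf; exact: (linear0 f').
Qed.

Lemma wcoord0 d : wcoord (0 : weil R k d) = 0.
Proof.
pose L := GRing.isLinear.Build _ _ _ _ _ (@wcoord_is_linear R k d).
pose l : {linear weil R k d -> _} := HB.pack (@wcoord R k d) L.
exact: (linear0 l).
Qed.

Lemma wcoordZ d c (a : weil R k d) j : wcoord (c *: a) 0 j = c * wcoord a 0 j.
Proof. by rewrite -[c *: a]addr0 wcoordP wcoord0 [X in _ + X]mxE addr0. Qed.

Lemma wcoord_sum d (u : 'rV[R]_#|{: wmon k d}|) :
  wcoord (\sum_j u 0 j *: wbasis R j : weil R k d) = u.
Proof.
pose L := GRing.isLinear.Build _ _ _ _ _ (@wcoord_is_linear R k d).
pose l : {linear weil R k d -> _} := HB.pack (@wcoord R k d) L.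
rewrite -[LHS]/(l _) linear_sum; apply/rowP => j; rewrite summxE (bigD1 j) //=.
rewrite wcoordZ wcoord_basis eqxx mulr1 big1 ?addr0 // => i ij.
by rewrite wcoordZ wcoord_basis (negbTE ij) mulr0.
Qed.

Lemma fcoord_decomp d (B : galg R) (f : weil R k d -> B) (b : B) :
  is_ghom f -> bijective f -> \sum_j fcoord f b 0 j *: f (wbasis R j) = b.
Proof.
move=> gf bf; by rewrite -ghom_sum // -(weil_decomp (winv f b)) winvK.
Qed.

(** The coordinates of [s] in the frame [f] solve a linear system whose matrix expresses [f] in [f']
    and is injective at [x0]. The types [d] and [d'] may differ, so the matrix is not presented as a
    square one and [smc_solve] is used. *)
Lemma smc_frame (M : premfd R) (c : chart R M) x0 d d' (V : M -> galg R)
    (f : forall x, weil R k d -> V x) (f' : forall x, weil R k d' -> V x)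
    (s : forall x, V x) :
  cdom c x0 ->
  nearc c (fun x => is_ghom (f x) /\ bijective (f x)) x0 ->
  nearc c (fun x => is_ghom (f' x) /\ bijective (f' x)) x0 ->
  (forall j l, smc c (fun x => fcoord (f' x) (f x (wbasis R j)) 0 l) x0) ->
  (forall l, smc c (fun x => fcoord (f' x) (s x) 0 l) x0) ->
  forall j, smc c (fun x => fcoord (f x) (s x) 0 j) x0.
Proof.
move=> cx0 nf nf' sT ss.
pose T x := \matrix_(j, l) fcoord (f' x) (f x (wbasis R j)) 0 l.
have TE x u : is_ghom (f' x) -> bijective (f' x) ->
    u *m T x = fcoord (f' x) (\sum_j u 0 j *: f x (wbasis R j)).
  move=> gf' bf'; pose L := GRing.isLinear.Build _ _ _ _ _ (fcoord_linear gf' bf').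
  pose l : {linear V x -> _} := HB.pack (fcoord (f' x)) L.
  rewrite -[RHS]/(l _) linear_sum; apply/rowP => j; rewrite mxE summxE.
  by apply: eq_bigr => i _; rewrite linearZ !mxE.
apply: (smc_solve (T := T) (s := fun x => fcoord (f' x) (s x))) => //.
- have [gf bf] := nearc_self cx0 nf; have [gf' bf'] := nearc_self cx0 nf'.
  apply: inj_row_free => u; rewrite TE // => e0.
  have {}e0 : winv (f' x0) (\sum_j u 0 j *: f x0 (wbasis R j)) = 0.
    by apply: wcoord_inj; rewrite wcoord0 -e0.
  have := winvK bf' (\sum_j u 0 j *: f x0 (wbasis R j)).
  rewrite e0 ghom0 // -ghom_sum // -[in LHS](ghom0 gf) => /(bij_inj bf) e1.
  by rewrite -(wcoord_sum u) -e1 wcoord0.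
- apply: nearcW (nearcI nf nf') => x _ [[gf bf] [gf' bf']].
  by rewrite TE // fcoord_decomp.
- by move=> i j; apply: smc_ext (sT i j) => x _; rewrite [RHS]mxE.
Qed.

Lemma smc_wev T (c : chart R T) p d (Y : T -> 'rV[R]_(rk d)) (a : T -> weil R k d) i :
  (i < k.+1)%N ->
  (forall j, smc c (fun q => Y q 0 j) p) ->
  (forall j, smc c (fun q => wcoord (a q) 0 j) p) ->
  smc c (fun q => tcoef i (wev (Y q) (a q))) p.
Proof.
move=> ik sY sa; under eq_fun do rewrite tcoef_wev //.
apply: smc_sum => j _; apply: smcM.
  by apply: smcM; [exact: sa|exact: smc_cst].
by apply: smc_prod => l _; exact: smcX.
Qed.

Lemma is_giso_bij (A B : galg R) (f : A -> B) : is_giso f -> bijective f.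
Proof. by case. Qed.

Lemma pev_homogeneous d (y : 'rV[R]_(rk d)) i (p : mpoly (rk d) R) :
  (forall m, m \in msupp p -> wtm m = i) ->
  pev k y p = meval (fun j => y 0 j) p *: ((eps R k : trunc R k) ^+ i).
Proof.
move=> pi; rewrite mevalE [in LHS](mpolyE p) /pev raddf_sum scaler_suml /=.
rewrite big_seq [RHS]big_seq; apply: eq_bigr => m mp.
by rewrite -[LHS]/(pev _ _ _) pevZ pevX scalerA (pi _ mp).
Qed.

End Frames.

(** * Local trivializations of the algebras Hom_G(F_x, A^[k]) *)

Section FibreTriv.
Context (R : realType) (k : nat) (F : gbundle R) (gF : is_gbundle k F).
Context (phi : gtriv F) (tphi : is_gtriv phi).
Local Notation d := (gtype phi).

Lemma fibre_eq (x : base F) (p q : fibre x) : sval p = sval q -> p = q.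
Proof.
case: p q => [p hp] [q hq] /= e; case: _ / e hq => hq.
by congr exist; exact: Prop_irrelevance.
Qed.

Lemma fibreP (x : base F) (p : fibre x) : act 0 (sval p) = sval x.
Proof. exact: (svalP p). Qed.

Lemma fibre_dom (psi : gtriv F) (x : base F) (p : fibre x) : is_gtriv psi ->
  gdom psi (sval x) <-> gdom psi (sval p).
Proof. by move=> tpsi; rewrite [in X in _ <-> X](gtriv_sat tpsi) fibreP. Qed.

Lemma smc_fibre (psi : gtriv F) (x : base F) (p : fibre x) (G : F -> R) :
  is_gtriv psi -> gdom psi (sval x) -> smc (gtriv_chart psi) G (sval p) ->
  smc (fibre_chart psi x) (fun q => G (sval q)) p.
Proof.
move=> tpsi psix; apply: (smc_comp (F := fun q : fibre x => sval q) (p := p)) => //.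
apply/local_repP; split=> [|j].
  by apply: nearcT => q _; exact/(fibre_dom _ tpsi).
rewrite /=; case: (split_ordP j) => i ->.
  apply: smc_ext (smc_cst _ _ (gbase psi (sval x) 0 i)) => q _; rewrite row_mxEl.
  have psiq : gdom psi (sval (q : fibre x)) by exact/(fibre_dom _ tpsi).
  by rewrite -(gbase_proj tpsi psiq) fibreP.
apply: smc_ext (@smc_coord _ _ (fibre_chart psi x) p i) => q _.
by rewrite row_mxEr.
Qed.

Lemma ftriv_smooth (x : base F) (phix : gdom phi (sval x)) (a : weil R k d) :
  @smooth _ (fibre x) (trunc_mfd R k) (fun p => wev (gfib phi (sval p)) a).
Proof.
move=> p; apply/smooth_at_truncP => _ [psi tpsi ->] /= psix i.
apply: (smc_fibre (G := fun q => tcoef i (wev (gfib phi q) a))) => //.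
have phip : gdom phi (sval p) by exact/(fibre_dom _ tphi).
have psip : gdom psi (sval p) by exact/(fibre_dom _ tpsi).
apply: smc_wev => // j; last exact: smc_cst.
have rep := gtriv_rep gF tpsi tphi psip phip.
exact: (smc_comp (c := gtriv_chart psi) (F := fun q => q) psip rep (smc_gfib _ j)).
Qed.

Lemma wev_dil e t (y : 'rV[R]_(rk e)) (a : weil R k e) :
  wev (dil t y) a = tdil t (wev y a).
Proof.
pose h := ghom_comp (tdil_hom k t) (GHom (is_ghom_wev k y)).
apply: (ghom_gen (f := wev (dil t y)) (g := h)); [exact: is_ghom_wev|exact: ghomP|].
move=> j; rewrite /= !wev_gen mxE tdilZ mulrC -scalerA; congr (_ *: _).
apply: tcoef_eq => i ik; rewrite tcoef_dil // tcoefZ tcoef_eps //.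
by case: eqP => [->|_] //; rewrite !mulr0.
Qed.

Lemma ftriv_act (x : base F) (phix : gdom phi (sval x)) (a : weil R k d) t
    (p : fibre x) :
  wev (gfib phi (sval (fibre_act t p))) a = tdil t (wev (gfib phi (sval p)) a).
Proof.
have phip : gdom phi (sval p) by exact/(fibre_dom _ tphi).
by rewrite /= (gtriv_act tphi t phip).2 wev_dil.
Qed.

(** An element of the Weil algebra becomes the function on the fibre that evaluates it at the fibre
    coordinates; 0 is a default value outside the domain of [phi]. *)
Definition ftriv : ltriv k (fun x : base F => homG_galg k x) :=
  @LTriv R k (base F) (fun x : base F => homG_galg k x) d
    (fun x => gdom phi (sval x))
    (fun x a => if pselect (gdom phi (sval x)) is left H
                then HomG (@ftriv_smooth x H a) (@ftriv_act x H a) else 0).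

Lemma ftrivE (x : base F) (a : weil R k d) (p : fibre x) : gdom phi (sval x) ->
  (lm ftriv x a : homG k x) p = wev (gfib phi (sval p)) a.
Proof. by rewrite /=; case: pselect. Qed.

Section OverPoint.
Context (x : base F) (phix : gdom phi (sval x)).

Lemma fpt_subproof y : act 0 (gpt (phi := phi) y (sval x)) = sval x.
Proof. by have [_ _ _ ->] := gptP y tphi phix; exact: (svalP x). Qed.

Definition fpt y : fibre x :=
  exist (fun p : F => act 0 p = sval x) _ (fpt_subproof y).

Lemma gfib_fpt y : gfib phi (sval (fpt y)) = y.
Proof. by have [_ _ ->] := gptP y tphi phix. Qed.

Lemma gfib_inj (p q : fibre x) : gfib phi (sval p) = gfib phi (sval q) -> p = q.
Proof.
move=> pq; have phip (r : fibre x) : gdom phi (sval r) by exact/(fibre_dom _ tphi).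
apply: fibre_eq; apply: (gtriv_inj tphi) => //.
by rewrite -(gbase_proj tphi (phip p)) -(gbase_proj tphi (phip q)) !fibreP.
Qed.

Lemma homG_coef_smooth (alpha : homG k x) i : (i < k.+1)%N ->
  smooth_fun setT (fun y => tcoef i (alpha (fpt y))).
Proof.
move=> ik; apply: smooth_fun_local => y _.
have /smooth_at_truncP sa := @homG_smooth _ _ _ _ alpha (fpt y).
have Fphi : @charts R (fibre x) (fibre_chart phi x) by exists phi.
have [V [g [oV Vy sg gE]]] := sa _ Fphi phix (Ordinal ik).
exists V; first by rewrite /= gfib_fpt in Vy.
move=> r; apply: Cdiff_ext (sg r) => // z Vz.
by rewrite (gE (fpt z)) //= gfib_fpt.
Qed.

Lemma homG_coef_homogeneous (alpha : homG k x) i : (i < k.+1)%N ->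
  homogeneous i (fun y => tcoef i (alpha (fpt y))).
Proof.
move=> ik t y; rewrite -tcoef_dil // -homG_act; congr (tcoef i (homG_fun alpha _)).
apply: gfib_inj; rewrite gfib_fpt /=.
have phip : gdom phi (sval (fpt y)) by exact/(fibre_dom _ tphi).
by rewrite (gtriv_act tphi t phip).2 gfib_fpt.
Qed.

Lemma ftriv_giso : is_giso (lm ftriv x).
Proof.
have E a p := ftrivE a p phix.
have ev p := is_ghom_wev k (gfib phi (sval (p : fibre x))).
split.
- split=> [c a b||i a ai p]; [|split=> [|a b]|]; try apply: homG_eq => p;
    rewrite E; have [lin [e1 eM] eg] := ev p.
  + by rewrite lin /= -!E.
  + exact: e1.
  + by rewrite eM /= -!E.
  + exact: eg.
- apply: inj_surj_bijective => [a b ab|alpha].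
    apply: wev_inj => y; rewrite -(gfib_fpt y) -!E.
    by rewrite ab.
  (* Surjectivity: the coefficient of [eps ^+ i] in [alpha] is homogeneous of degree [i], hence a
     polynomial of weight [i]. Evaluation puts it back in front of [eps ^+ i], so the sum over [i]
     represents [alpha]. *)
  have H (i : 'I_k.+1) : exists p : mpoly (rk d) R,
      (forall m, m \in msupp p -> wtm m = i) /\
      forall y, tcoef i (alpha (fpt y)) = meval (fun j => y 0 j) p.
    apply: homogeneous_poly; first exact: homG_coef_smooth.
    exact: homG_coef_homogeneous.
  have [P HP] := choice H.
  exists (weil_pi k (\sum_i P i)); apply: homG_eq => p; rewrite E wev_pi.
  rewrite /pev raddf_sum; apply: tcoef_eq => i ik.
  rewrite tcoef_sum (bigD1 (Ordinal ik)) //= big1 => [|j /negbTE ji]; last first.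
    rewrite -[X in tcoef _ X]/(pev _ _ _) (pev_homogeneous k _ (HP j).1).
    by rewrite tcoefZ tcoef_eps // eq_sym -val_eqE /= in ji *; rewrite ji mulr0.
  rewrite -[X in tcoef _ X]/(pev _ _ _) (pev_homogeneous k _ (HP _).1).
  rewrite tcoefZ tcoef_eps // eqxx mulr1 addr0 -(HP _).2 /=.
  by congr (tcoef i (homG_fun alpha _)); apply: gfib_inj; rewrite gfib_fpt.
- move=> i a ai; apply: wev_gpart => y.
  by rewrite -(gfib_fpt y) -E; exact: ai.
Qed.

End OverPoint.
Lemma ftriv_open : mopen (ldom ftriv).
Proof.
apply: (@mopen_cdom _ (base F) (base_chart phi)).
- exact: base_good_charts.
- exact: (base_id_smooth gF).
- by exists phi.
Qed.

(** The function on the total space through which [star] defines smooth sections; its type no longer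
    involves fibres. *)
Definition secfun (s : forall x : base F, homG k x) (q : F) : trunc R k :=
  s (proj q) (to_fibre q).

Lemma secfunE (s : forall x : base F, homG k x) (x : base F) (p : fibre x) :
  secfun s (sval p) = s x p.
Proof.
have e : proj (sval p) = x by apply: base_eq; exact: (fibreP p).
case: p e => p hp /= e; case: _ / e hp => hp.
by congr (homG_fun _ _); exact: fibre_eq.
Qed.

Lemma smooth_at_compat (G : F -> trunc_mfd R k) p : gdom phi p ->
  (forall i, (i < k.+1)%N -> smc (gtriv_chart phi) (fun q => tcoef i (G q)) p) <->
  smooth_at G p.
Proof.
move=> phip; have cF := is_manifold_cover (gbundle_mfd gF).
split=> [H|/smooth_at_truncP H i ik].
  apply/smooth_at_truncP => c Fc cp i.
  apply: (compat_smc cF (compat_gtriv tphi phip)) => //; last exact: H.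
  exact: compat_chart (transition_smooth (gbundle_mfd gF)) Fc cp.
have [c Fc cp] := cF p.
apply: (compat_smc (c0 := c) cF) => //.
- exact: compat_chart (transition_smooth (gbundle_mfd gF)) Fc cp.
- exact: compat_gtriv.
- exact: (H c Fc cp (Ordinal ik)).
Qed.

Lemma ftriv_section_smooth (a : weil R k d) p : gdom phi p ->
  @smooth_at R F (trunc_mfd R k) (secfun (fun x => lm ftriv x a)) p.
Proof.
move=> phip; apply/smooth_at_compat => // i ik.
apply: (smc_ext (f := fun q => tcoef i (wev (gfib phi q) a))) => [q phiq|].
  by rewrite /secfun ftrivE //; apply/proj_dom.
by apply: smc_wev => // j; [exact: smc_gfib|exact: smc_cst].
Qed.

(* Evaluating a section at the points with fixed fibre coordinates [y] gives a
   linear combination of its coefficients with weights the monomials at [y]. *)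
Lemma smc_ftriv_coef (s : forall x : base F, homG k x) (x0 : base F) :
  gdom phi (sval x0) ->
  (forall p, gdom phi p -> proj p = x0 -> @smooth_at R F (trunc_mfd R k) (secfun s) p) ->
  forall j, smc (base_chart phi) (fun x => fcoord (lm ftriv x) (s x) 0 j) x0.
Proof.
move=> phix0 ss j.
pose J := 'I_#|{: wmon k d}|.
(* Here the class [C] is smoothness at [x0], for functions on the base. *)
apply: (@monv_independent R _ J (@wmonom k d) (base F)
  (fun f => smc (base_chart phi) f x0) (index_enum J)
  (fun j x => fcoord (lm ftriv x) (s x) 0 j)) => //.
- exact: wmonom_inj.
- by move=> f g; exact: smcD.
- by move=> a f; exact: smcZ.
- exact: index_enum_uniq.
- move=> y; apply: (smc_ext
    (f := fun x => \sum_(i < k.+1) tcoef i (secfun s (gpt (phi := phi) y (sval x))))).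
    move=> x phix; have bx := is_giso_bij (ftriv_giso phix).
    rewrite -(sum_tcoef_wev y (winv (lm ftriv x) (s x))); apply: eq_bigr => i _.
    have -> : secfun s (gpt (phi := phi) y (sval x)) = s x (fpt phix y).
      exact: (secfunE s (fpt phix y)).
    have e := congr1 (fun h : homG k x => h (fpt phix y)) (winvK bx (s x)).
    have e' := ftrivE (winv (lm ftriv x) (s x)) (fpt phix y) phix.
    rewrite gfib_fpt in e'.
    congr tcoef; exact: etrans (esym e) e'.
  apply: smc_sum => i _.
  have [phiy _ _ ey] := gptP y tphi phix0.
  apply: (smc_comp (f := fun q => tcoef i (secfun s q)) _ (gpt_rep y x0 tphi)) => //.
  have py : proj (gpt (phi := phi) y (sval x0)) = x0.
    by apply: base_eq; rewrite /= ey; exact: (svalP x0).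
  exact: ((smooth_at_compat _ phiy).2 (ss _ phiy py) i (ltn_ord i)).
- exact: mem_index_enum.
Qed.

End FibreTriv.

(** * The algebra bundle [star k F] and its cocycles *)

Section Star.
Context (R : realType) (k : nat) (F : gbundle R) (gF : is_gbundle k F).

Lemma ftriv_ex (x : base F) : exists phi : gtriv F,
  [/\ is_gtriv phi, size (gtype phi) = k & gdom phi (sval x)].
Proof.
have [n [d [dk /(_ (sval x))[phi [tphi _ phid phix]]]]] := gbundle_triv gF.
by exists phi; rewrite phid.
Qed.

Lemma ftriv_wtriv (phi : gtriv F) (tphi : is_gtriv phi) : size (gtype phi) = k ->
  @wtrivs R k (star k F) (ftriv gF tphi).
Proof.
move=> dk; split=> //.
- exact: ftriv_open.
- by move=> x phix; exact: ftriv_giso.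
- move=> a p phip; have {}phip : gdom phi p by exact/(gtriv_sat tphi).
  exact: (@ftriv_section_smooth R k F gF phi tphi a p phip).
Qed.

(** The trivializations of [star k F] include all those with smooth constant sections, not just the
    [ftriv]. Coefficients are first found smooth in the frame of an [ftriv], then carried to [tau]
    by a change of frame. *)
Lemma smc_star_coef tau (x0 : base F) (s : forall x : base F, homG k x) c :
  @wtrivs R k (star k F) tau -> ldom tau x0 -> charts c -> cdom c x0 ->
  (forall p, proj p = x0 -> @smooth_at R F (trunc_mfd R k) (secfun s) p) ->
  forall j, smc c (fun x => fcoord (lm tau x) (s x) 0 j) x0.
Proof.
move=> [sz oD iso sm] tx0 bc cx0 ss j.
have [phi [tphi dk phix0]] := ftriv_ex x0.
have cb := base_cover gF; have sb := base_id_smooth gF.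
have bphi : @charts R (base F) (base_chart phi) by exists phi.
have C0 := compat_chart (p := x0) sb bphi phix0.
have C1 := compat_chart sb bc cx0.
apply: (compat_smc (M := base F) cb C0 C1 phix0 cx0).
apply: (smc_frame (f' := fun x => lm (ftriv gF tphi) x)) => //.
- have /mopenP oD' := oD; have := oD' (@base_good_charts R F) _ _ bphi phix0 tx0.
  apply: nearcW => x _ tx; have := iso x tx; by case.
- by apply: nearcT => x phix; case: (ftriv_giso gF tphi phix).
- move=> i l; apply: (smc_ftriv_coef (s := fun x => lm tau x (wbasis R i))) => //.
  by move=> p phip px; apply: (sm (wbasis R i) p); rewrite px.
- by move=> l; apply: smc_ftriv_coef => // p _; exact: ss.
Qed.

Lemma star_wbundle : is_wbundle (star k F).
Proof.
split.
- exact: (base_manifold gF).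
- by move=> tau [sz oD iso _].
- have [n [d [dk H]]] := gbundle_triv gF; exists d; split=> // x.
  have [phi [tphi _ phid phix]] := H (sval x).
  exists (ftriv gF tphi); split=> //; apply: ftriv_wtriv.
  by rewrite phid.
- move=> tau tau' At At' a; exists (fun x => winv (lm tau x) (lm tau' x a)) => x tx t'x.
  have [_ _ iso _] := At; have [_ _ _ sm'] := At'.
  split; first by rewrite winvK //; exact: is_giso_bij (iso x tx).
  apply/smooth_at_weilP => c bc cx j.
  apply: (smc_star_coef (s := fun x => lm tau' x a)) => // p px.
  by apply: (sm' a p); rewrite px.
Qed.

End Star.

(** * The graded bundle of a Weil algebra bundle *)

Section Countability.
Context (R : realType).

Lemma rV_countable_basis m : exists Q : nat -> set 'rV[R]_m,
  (forall l, open (Q l)) /\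
  forall (O : set 'rV[R]_m) x, open O -> O x -> exists l, Q l x /\ Q l `<=` O.
Proof.
pose T := ('rV[rat]_m * nat)%type.
exists (fun l => if unpickle l is Some a
  then ball (map_mx ratr (a : T).1 : 'rV[R]_m) ((a : T).2.+1%:R^-1) else set0).
split=> [l|O x oO Ox]; first by case: (unpickle l) => [a|]; [exact: ball_open|exact: open0].
have [e /= e0 eO] := (nbhs_ballP _ _).1 (open_nbhs_nbhs (conj oO Ox)).
have e2 : 0 < e / 2 by rewrite divr_gt0.
(* This makes the radius smaller than [e / 2]; since the rational centre is within one radius of
   [x], every point of its ball is within [e] of [x]. *)
pose n := Num.truncn ((e / 2)^-1).
have ne : n.+1%:R^-1 < e / 2.
  by rewrite invf_plt ?posrE // truncnS_gt.
have n0 : 0 < n.+1%:R^-1 :> R by rewrite invr_gt0 ltr0n.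
have H (j : 'I_m) : exists q : rat, `|ratr q - x 0 j| < n.+1%:R^-1.
  have [|q] := @rat_in_itvoo R (x 0 j) (x 0 j + n.+1%:R^-1); first by rewrite ltrDl.
  rewrite in_itv /= => /andP[q1 q2]; exists q.
  by rewrite gtr0_norm ?subr_gt0 // ltrBlDl.
have [a aP] := choice H.
exists (pickle (\row_j a j : 'rV[rat]_m, n)); rewrite pickleK /=; split.
  split=> // i j; rewrite (ord1 i) !mxE; exact: aP.
move=> y ay; apply: eO; split=> // i j; rewrite (ord1 i).
have := ay.2 0 j; rewrite !mxE /ball /= => ayj.
rewrite (_ : x 0 j - y 0 j = (x 0 j - ratr (a j)) + (ratr (a j) - y 0 j)).
  rewrite (le_lt_trans (ler_normD _ _)) // (splitr e) ltrD //.
    by rewrite distrC (lt_trans (aP j)).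
  exact: lt_trans ayj ne.
by rewrite addrA subrK.
Qed.

Lemma mopen_chart (M : premfd R) c (V : set 'rV[R]_(cdim c)) : good_charts M ->
  smooth (fun p : M => p) -> @charts R M c -> open V ->
  mopen [set q : M | cdom c q /\ V (cmap c q)].
Proof.
move=> gM sM Mc oV; apply/mopenP => // c' p Mc' c'p [cp Vp].
apply: (nearc_comp (P := fun q => cdom c q /\ V (cmap c q)) c'p (sM p _ _ Mc' Mc c'p cp)).
by exists V.
Qed.

(** One chart is chosen for each [S i] that lies in some chart domain; pulling back a countable
    basis of the coordinate space through each of these charts gives a countable basis of [M]. *)
Lemma second_countable_charts (M : premfd R) (S : nat -> set M) :
  good_charts M -> smooth (fun p : M => p) ->
  (forall p, exists i, S i p /\ exists2 c, @charts R M c & S i `<=` cdom c) ->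
  second_countable_mfd M.
Proof.
move=> gM sM SP.
pose Q m := projT1 (cid (@rV_countable_basis m)).
have QP m := projT2 (cid (@rV_countable_basis m)).
rewrite -/(Q _) in QP.
pose U (il : nat * nat) : set M :=
  if pselect (exists2 c, @charts R M c & S il.1 `<=` cdom c) is left H then
    let c := projT1 (cid2 H) in
    [set q | cdom c q /\ Q (cdim c) il.2 (cmap c q)]
  else set0.
have oU il : mopen (U il).
  rewrite /U; case: pselect => [H|_]; last first.
    by move=> c _; rewrite setI0 image_set0; exact: open0.
  case: (cid2 H) => c Mc Sc /=; apply: mopen_chart => //.
  by case: (QP (cdim c)) => h _; exact: h.
exists (fun n => if unpickle n is Some il then U il else set0); split=> [n|O p oO Op].
  case: (unpickle n) => // c _; rewrite setI0 image_set0; exact: open0.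
have [i [Sp H0]] := SP p.
have [c [Mc cp UE]] : exists c, [/\ @charts R M c, cdom c p &
    forall l, U (i, l) = [set q | cdom c q /\ Q (cdim c) l (cmap c q)]].
  rewrite /U /=; case: pselect => [H|//]; case: (cid2 H) => c Mc Sc /=.
  by exists c; split=> //; exact: Sc.
have oc : open (cmap c @` (cdom c `&` O)) by exact: oO.
have [|l [Ql QO]] := (QP (cdim c)).2 _ (cmap c p) oc; first by exists p.
exists (pickle (i, l)); rewrite pickleK UE; split=> // q [cq /QO[q' [cq' Oq'] e]].
by rewrite -(gM.1 _ Mc _ _ cq' cq e).
Qed.

Lemma chart_separate (M : premfd R) c (p q : M) : good_charts M ->
  smooth (fun p : M => p) -> @charts R M c -> cdom c p -> cdom c q -> p <> q ->
  exists O O' : set M, [/\ mopen O, mopen O', O p, O' q & O `&` O' = set0].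
Proof.
move=> gM sM Mc cp cq pq.
have e : cmap c p != cmap c q.
  by apply/eqP => e; apply: pq; exact: gM.1 e.
have := @norm_hausdorff R 'rV[R]_(cdim c); rewrite open_hausdorff.
move=> /(_ _ _ e)[[V W] /= [/set_mem Vp /set_mem Wq] [oV oW VW]].
exists [set r | cdom c r /\ V (cmap c r)], [set r | cdom c r /\ W (cmap c r)].
split=> //; try exact: mopen_chart.
apply/seteqP; split=> // r [[_ Vr] [_ Wr]].
suff : (set0 : set 'rV[R]_(cdim c)) (cmap c r) by [].
by rewrite -(eqP VW).
Qed.

End Countability.

(** * Charts, manifold structure and action on the space of characters *)

Section Costar.
Context (R : realType) (k : nat) (A : wbundle R k) (wA : is_wbundle A).
Implicit Types (tau : ltriv k (wfib (w := A))) (c : chart R (wbase A)).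
Implicit Types (z : costar_tot A) (x : wbase A).
Local Notation wtr tau := (@wtrivs R k A tau).
Local Notation T := (trunc R k).

Let mM := wbundle_mfd wA.
Let gM := manifold_good_charts mM.
Let cM := is_manifold_cover mM.
Let sM := transition_smooth mM.

Lemma wtr_size tau : wtr tau -> size (ltype tau) = k.
Proof. by move=> /(wbundle_triv wA)[]. Qed.

Lemma wtr_open tau : wtr tau -> mopen (ldom tau).
Proof. by move=> /(wbundle_triv wA)[]. Qed.

Lemma wtr_giso tau x : wtr tau -> ldom tau x -> is_giso (lm tau x).
Proof. by move=> /(wbundle_triv wA)[_ _]; apply. Qed.

Lemma wtr_bij tau x : wtr tau -> ldom tau x -> bijective (lm tau x).
Proof. by move=> At tx; case: (wtr_giso At tx). Qed.

Lemma wtr_ghom tau x : wtr tau -> ldom tau x -> is_ghom (lm tau x).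
Proof. by move=> At tx; case: (wtr_giso At tx). Qed.

Definition lam tau z : 'rV[R]_(rk (ltype tau)) :=
  wlam (fun a => (tagged z : ghom (wfib (tag z)) T) (lm tau (tag z) a)).

Lemma costar_chartE c tau z :
  cmap (costar_chart c tau) z = row_mx (cmap c (tag z)) (lam tau z).
Proof. by []. Qed.

(** By freeness, a character read through [tau] is evaluation at its own coordinates. *)
Lemma lamE tau z a : wtr tau -> ldom tau (tag z) ->
  (tagged z : ghom (wfib (tag z)) T) (lm tau (tag z) a) = wev (lam tau z) a.
Proof.
move=> At tz; apply/esym.
apply: (wlamK (wtr_size At)
  (f := fun a => (tagged z : ghom (wfib (tag z)) T) (lm tau (tag z) a))).
exact: (@is_ghom_comp R _ _ _ (tagged z) (GHom (wtr_ghom At tz))).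
Qed.

Lemma lam_inj tau z z' : wtr tau -> ldom tau (tag z) -> tag z = tag z' ->
  lam tau z = lam tau z' -> z = z'.
Proof.
case: z z' => x psi [x' psi'] At /= tx e; case: _ / e psi' => psi' lamz.
congr existT; apply: ghom_eq => b; rewrite -(winvK (wtr_bij At tx) b).
have := @lamE tau (existT _ x psi) (winv (lm tau x) b) At tx; rewrite /= => ->.
have := @lamE tau (existT _ x psi') (winv (lm tau x) b) At tx; rewrite /= => ->.
by rewrite lamz.
Qed.

Lemma winv_ghom d (B : galg R) (f : weil R k d -> B) : is_giso f -> is_ghom (winv f).
Proof.
move=> [[lf [f1 fM] gf] bf rf]; split.
- by move=> a u v; apply: (bij_inj bf); rewrite lf !winvK.
- split=> [|u v]; first by rewrite -f1 winvE.
  by apply: (bij_inj bf); rewrite fM !winvK.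
- by move=> i b bi; apply: rf; rewrite winvK.
Qed.

Lemma cpt_ex tau x (y : 'rV[R]_(rk (ltype tau))) : wtr tau -> ldom tau x ->
  exists z, tag z = x /\ lam tau z = y.
Proof.
move=> At tx.
pose psi := ghom_comp (GHom (is_ghom_wev k y)) (GHom (winv_ghom (wtr_giso At tx))).
exists (existT (fun x => ghom (wfib x) T) x psi); split=> //.
rewrite /lam /= -[RHS](wevK (wtr_size At)).
by apply/rowP => j; rewrite !mxE winvE //; exact: wtr_bij.
Qed.

Lemma tag_rep c tau z :
  local_rep (costar_chart c tau) c (fun z : costar_tot A => tag z) z.
Proof.
apply/local_repP; split=> [|j]; first by apply: nearcT => z' [].
apply: smc_ext (@smc_coord _ _ (costar_chart c tau) z (lshift _ j)) => z' _.
by rewrite /= row_mxEl.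
Qed.

Lemma smc_lam c tau z j : smc (costar_chart c tau) (fun z => lam tau z 0 j) z.
Proof.
apply: smc_ext (@smc_coord _ _ (costar_chart c tau) z (rshift _ j)) => z' _.
by rewrite costar_chartE row_mxEr.
Qed.

Lemma near_ldom c tau x : wtr tau -> charts c -> cdom c x -> ldom tau x ->
  nearc c (ldom tau) x.
Proof. by move=> At Mc cx tx; have /(mopenP _ gM) := wtr_open At; apply. Qed.

Lemma costar_charts_rep c tau c' tau' z : charts c -> wtr tau -> charts c' ->
  wtr tau' -> cdom (costar_chart c tau) z -> cdom (costar_chart c' tau') z ->
  local_rep (costar_chart c tau) (costar_chart c' tau') (fun z => z) z.
Proof.
move=> Mc At Mc' At' cz c'z; have [cx tx] := cz; have [c'x t'x] := c'z.
have trep := tag_rep c tau z.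
have rep := sM Mc Mc' cx c'x; have /local_repP[nc' sc'] := rep.
have nt' := near_ldom At' Mc cx t'x.
apply/local_repP; split=> [|j].
  exact: (nearc_comp (P := fun x => cdom c' x /\ ldom tau' x) cz trep (nearcI nc' nt')).
rewrite /=; case: (split_ordP j) => i ->.
  apply: smc_ext (smc_comp cz trep (sc' i)) => z' _.
  by rewrite row_mxEl.
(* The new fibre coordinate is the value of the character on the [i]-th generator of [tau']. The
   cocycle rewrites that generator in [tau], which gives a polynomial in the old fibre coordinates
   with smooth coefficients on the base. *)
have [g gP] := wbundle_cocycle wA At At' (wgen R k i).
have /smooth_at_weilP sg := (gP _ tx t'x).2.
apply: (smc_near (f := fun z => tcoef (wt i) (wev (lam tau z) (g (tag z))))).
  have := nearc_comp (P := ldom tau') cz trep nt'.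
  apply: nearcW => z' [_ tz'] t'z'.
  by rewrite row_mxEr mxE (gP _ tz' t'z').1 lamE.
apply: smc_wev; first exact: (wt_le (wtr_size At')).
  by move=> l; exact: smc_lam.
by move=> l; exact: (smc_comp cz trep (sg _ Mc cx l)).
Qed.

Lemma costar_id_smooth : smooth (fun z : costar_tot A => z).
Proof.
move=> z _ _ [c [tau [Mc At ->]]] [c' [tau' [Mc' At' ->]]].
exact: costar_charts_rep.
Qed.

Lemma costar_cover : mcover (costar_tot A).
Proof.
move=> z; have [c Mc cx] := cM (tag z).
have [d [_ /(_ (tag z))[tau [At _ tx]]]] := wbundle_cover wA.
by exists (costar_chart c tau) => //; exists c, tau.
Qed.

Lemma costar_good_charts : good_charts (costar_tot A).
Proof.
split=> [_ [c [tau [Mc At ->]]] z z' [cz tz] [cz' tz']|_ [c [tau [Mc At ->]]]].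
  rewrite !costar_chartE => /eq_row_mx[e1 e2].
  apply: (lam_inj At) => //; exact: (gM.1 _ Mc).
rewrite (_ : [set _ | _ in _] = fun w => (cmap c @` (cdom c `&` ldom tau)) (lsubmx w)).
  by apply: open_lsubmx; exact: (wtr_open At).
apply/seteqP; split=> [w [z [cz tz] <-]|w [x [cx tx] xw]].
  by rewrite /= row_mxKl; exists (tag z).
have [z [zx zw]] := cpt_ex (rsubmx w) At tx.
exists z; first by split; rewrite zx.
by rewrite -[LHS]/(row_mx _ (lam tau z)) zw zx xw hsubmxK.
Qed.

Lemma tag_smooth : smooth (fun z : costar_tot A => tag z).
Proof.
move=> z _ c' [c [tau [Mc At ->]]] Mc' [cx tx] c'x.
have trep := tag_rep c tau z.
by apply: (local_rep_idr _ trep) => //; exact: sM.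
Qed.

Lemma costar_manifold : is_manifold (costar_tot A).
Proof.
have gc := costar_good_charts; have sc := costar_id_smooth.
split; [exact: gc.1|exact: gc.2|exact: sc| | |].
- have [n nP] := chart_cover mM; have [d [_ dP]] := wbundle_cover wA.
  exists (n + rk d)%N => z; have [c [Mc cx cn]] := nP (tag z).
  have [tau [At td tx]] := dP (tag z).
  exists (costar_chart c tau); split=> //; first by exists c, tau.
  by rewrite /= cn td.
(* Points of one fibre lie in a common chart; points of different fibres are separated on the
   base. *)
- move=> z z' zz'; have [e|e] := pselect (tag z = tag z').
    have [c Mc cx] := cM (tag z).
    have [d [_ /(_ (tag z))[tau [At _ tx]]]] := wbundle_cover wA.
    apply: (@chart_separate _ (costar_tot A) (costar_chart c tau)) => //.
    + by exists c, tau.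
    + by split; rewrite -e.
  have [U [W [oU oW Uz Wz' UW]]] := manifold_hausdorff mM e.
  exists ((fun z : costar_tot A => tag z) @^-1` U), ((fun z : costar_tot A => tag z) @^-1` W).
  split=> //; try by apply: mopen_preimage => //; exact: tag_smooth.
  apply/seteqP; split=> // y [/= Uy Wy].
  by have : (U `&` W) (tag y) by []; rewrite UW.
- have [B [oB HB]] := manifold_second_countable mM.
  (* Preimages of a countable basis of the base: those over sets lying in both a chart domain and a
     trivialization domain are contained in charts, and they already cover. *)
  apply: (second_countable_charts
    (S := fun i => (fun z : costar_tot A => tag z) @^-1` B i)) => // z.
  have [c Mc cx] := cM (tag z).
  have [d [_ /(_ (tag z))[tau [At _ tx]]]] := wbundle_cover wA.
  have oD : mopen (cdom c `&` ldom tau).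
    by apply: mopenI => //; [exact: mopen_cdom|exact: wtr_open].
  have [|i [Bz BD]] := HB _ (tag z) oD; first by [].
  exists i; split=> //; exists (costar_chart c tau); first by exists c, tau.
  by move=> y /BD.
Qed.

Lemma lam_act tau t z : wtr tau -> lam tau (costar_act t z) = dil t (lam tau z).
Proof.
move=> At; apply/rowP => j; rewrite !mxE /= tcoef_dil //.
exact: (wt_le (wtr_size At)).
Qed.

Lemma costar_act_smooth :
  smooth (fun z : prod_mfd (real_line R) (costar A) => act (z.1 : R) z.2 : costar A).
Proof.
move=> [t z] _ c' [_ [_ [-> [c [tau [Mc At ->]]] ->]]] Ac' /= [_ cz] c'z.
set rc := Chart _ _.
have cA : @charts R (costar_tot A) (costar_chart c tau) by exists c, tau.
have rep := @costar_id_smooth (act t z) _ _ cA Ac' cz c'z.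
apply: (@local_rep_idr R _ _ (prod_chart rc (costar_chart c tau)) (costar_chart c tau) c'
  (fun q : R * costar_pt A => costar_act q.1 q.2) (t, z)) => //.
apply/local_repP; split=> [|j]; first by apply: nearcT => -[s y] /= [_].
have st : smc (prod_chart rc (costar_chart c tau)) (fun q => q.1) (t, z).
  apply: smc_ext (@smc_coord _ _ (prod_chart rc (costar_chart c tau)) (t, z)
    (lshift _ 0)) => -[s y] _.
  by rewrite /= row_mxEl mxE.
have sz i : smc (prod_chart rc (costar_chart c tau))
    (fun q => cmap (costar_chart c tau) q.2 0 i) (t, z).
  apply: smc_ext (@smc_coord _ _ (prod_chart rc (costar_chart c tau)) (t, z)
    (rshift 1 i)) => -[s y] _.
  by rewrite /= row_mxEr.
case: (split_ordP j) => i ->.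
  apply: smc_ext (sz (lshift _ i)) => -[s y] _ /=.
  by rewrite !row_mxEl.
apply: (smc_ext (f := fun q => q.1 ^+ wt i * cmap (costar_chart c tau) q.2 0 (rshift _ i))).
  move=> [s y] _; rewrite !costar_chartE !row_mxEr.
  by rewrite /= lam_act // [RHS]mxE.
by apply: smcM; [exact: smcX|exact: sz].
Qed.

Definition ctriv c tau : gtriv (costar A) :=
  @GTriv R (costar A) (cdim c) (ltype tau)
    (fun z => cdom c (tag z) /\ ldom tau (tag z))
    (fun z => cmap c (tag z)) (fun z => lam tau z).

Lemma ctriv_gtriv c tau : charts c -> wtr tau -> is_gtriv (ctriv c tau).
Proof.
move=> Mc At; have cA : @charts R (costar_tot A) (costar_chart c tau) by exists c, tau.
split=> //=.
- move=> z z' [cz tz] [cz' tz'] e; apply: lam_inj => //; exact: (gM.1 _ Mc).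
- exists (cmap c @` (cdom c `&` ldom tau)); first exact: (wtr_open At).
  move=> u y; split=> [[x [cx tx] xu]|[z [[cz tz] zu _]]]; last by exists (tag z).
  by have [z [zx zy]] := cpt_ex y At tx; exists z; rewrite zx; split.
- by move=> c' z Ac' c'z cz; split; exact: costar_id_smooth.
- by move=> t z _; split=> //; exact: lam_act.
Qed.

Lemma costar_gbundle : is_gbundle k (costar A).
Proof.
split; [exact: costar_manifold|exact: costar_act_smooth|].
have [n nP] := chart_cover mM; have [d [dk dP]] := wbundle_cover wA.
exists n, d; split=> // z; have [c [Mc cx cn]] := nP (tag z).
have [tau [At td tx]] := dP (tag z).
by exists (ctriv c tau); split=> //; exact: ctriv_gtriv.
Qed.

End Costar.

(** * Morphisms of Weil algebra bundles *)

Section Cast.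
Context (R : realType) (k : nat).

(** Morphisms whose base maps agree pointwise have fibre maps with different source types; this
    transport makes them comparable and remains a graded homomorphism. *)
Definition castg (A : wbundle R k) (x x' : wbase A) (e : x = x') :
    ghom (wfib x) (wfib x') :=
  match e in _ = y return ghom (wfib x) (wfib y) with erefl => ghom_id (wfib x) end.

Lemma castg_id (A : wbundle R k) (x : wbase A) (e : x = x) a : castg e a = a.
Proof. by rewrite (Prop_irrelevance e erefl). Qed.

Lemma castg_section (A : wbundle R k) (s : forall x : wbase A, wfib x) (x x' : wbase A)
  (e : x = x') : castg e (s x) = s x'.
Proof. by case: _ / e. Qed.

Lemma zak_ext (A B : wbundle R k) (f g : zak A B) :
  (forall x, zbase f x = zbase g x) ->
  (forall x (e : zbase f x = zbase g x) a, zmap f x a = zmap g x (castg e a)) ->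
  f = g.
Proof.
case: f g => [b f] [b' g] /= bb' fg.
have {}bb' : b = b' by apply/funext.
case: _ / bb' g fg => g fg; apply: zak_eq => x a.
by rewrite (fg x erefl).
Qed.

Lemma costar_ext (A : wbundle R k) (z z' : costar_tot A) (e : tag z = tag z') :
  (forall a, (tagged z : ghom _ (trunc R k)) a =
             (tagged z' : ghom _ (trunc R k)) (castg e a)) -> z = z'.
Proof.
case: z z' e => x psi [x' psi'] /= e; case: _ / e psi' => psi' H.
by congr existT; apply: ghom_eq => a; rewrite H.
Qed.

Lemma giso_inverse (A B : galg R) (f : A -> B) : is_giso f ->
  exists g : ghom B A, cancel f g /\ cancel g f.
Proof.
move=> [[lf [f1 fM] gf] [g fK gK] rf].
have gg : is_ghom g.
  split.
  - by move=> c u v; apply: (can_inj fK); rewrite lf !gK.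
  - split=> [|u v]; first by rewrite -f1 fK.
    by apply: (can_inj fK); rewrite fM !gK.
  - by move=> i b bi; apply: rf; rewrite gK.
by exists (GHom gg).
Qed.

End Cast.

(** * Smoothness of Zakrzewski morphisms in terms of matrices *)

Section DualSmooth.
Context (R : realType) (k : nat) (A B : wbundle R k).
Context (wA : is_wbundle A) (wB : is_wbundle B) (psi : zak A B).
Local Notation wtA tau := (@wtrivs R k A tau).
Local Notation wtB tau := (@wtrivs R k B tau).

Let mA := wbundle_mfd wA.
Let mB := wbundle_mfd wB.

Lemma dual_tag_rep (C : wbundle R k) (c : chart R (wbase C)) tau (z : dual C) :
  local_rep (dual_chart c tau) c (fun z : dual C => tag z) z.
Proof.
apply/local_repP; split=> [|j]; first by apply: nearcT => z' [].
apply: smc_ext (@smc_coord _ _ (dual_chart c tau) z (lshift _ j)) => z' _.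
by rewrite /= row_mxEl.
Qed.

Lemma smc_dual_coord (C : wbundle R k) (c : chart R (wbase C)) tau (z : dual C) j :
  smc (dual_chart c tau)
    (fun z : dual C => sval (tagged z) (lm tau (tag z) (wbasis R j))) z.
Proof.
apply: smc_ext (@smc_coord _ _ (dual_chart c tau) z (rshift _ j)) => z' _.
by rewrite /= row_mxEr mxE.
Qed.

(** In dual charts the map multiplies the coordinates of a linear form by the matrix of [psi], so it
    is enough that the matrix be smooth for one pair of frames around each point. *)
Lemma zdual_smooth : smooth (zbase psi) ->
  (forall x0, exists tauA tauB c, [/\ wtA tauA, wtB tauB,
     ldom tauA (zbase psi x0) /\ ldom tauB x0, charts c /\ cdom c x0 &
     forall j l, smc c (fun x => fcoord (lm tauB x)
       (zmap psi x (lm tauA (zbase psi x) (wbasis R j))) 0 l) x0]) ->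
  smooth (zdual psi).
Proof.
move=> sb H [x0 xi].
have [tauA [tauB [c [At Bt [tA tB] [Bc cx] sm]]]] := H x0.
have [c' Ac' c'x] := is_manifold_cover mA (zbase psi x0).
have B0 : @charts R (dual B) (dual_chart c tauB) by exists c, tauB.
have A0 : @charts R (dual A) (dual_chart c' tauA) by exists c', tauA.
have z0 : cdom (dual_chart c tauB) (existT _ x0 xi) by [].
have z0' : cdom (dual_chart c' tauA) (zdual psi (existT _ x0 xi)) by [].
apply: (compat_smooth_at (compat_chart (dual_id_smooth wB) B0 z0)
  (compat_chart (dual_id_smooth wA) A0 z0')) => //.
have trep := dual_tag_rep c tauB (existT _ x0 xi).
have brep := sb x0 _ _ Bc Ac' cx c'x; have /local_repP[nb sbc] := brep.
have ntA := nearc_comp cx brep (near_ldom wA At Ac' c'x tA).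
apply/local_repP; split=> [|j].
  exact: (nearc_comp (P := fun x => cdom c' (zbase psi x) /\ ldom tauA (zbase psi x))
    z0 trep (nearcI nb ntA)).
rewrite /=; case: (split_ordP j) => i ->.
  apply: smc_ext (smc_comp z0 trep (sbc i)) => z' _.
  by rewrite row_mxEl.
apply: (smc_ext (f := fun z : dual B => \sum_l
    fcoord (lm tauB (tag z))
      (zmap psi (tag z) (lm tauA (zbase psi (tag z)) (wbasis R i))) 0 l *
    sval (tagged z) (lm tauB (tag z) (wbasis R l)))).
  move=> [x eta] [/= _ tx]; rewrite row_mxEr mxE.
  have leta := svalP eta; pose L := GRing.isLinear.Build _ _ _ _ _ leta.
  pose l : {linear _ -> _} := HB.pack (sval eta) L.
  set v := zmap psi x _.
  rewrite -[in RHS](fcoord_decomp v (wtr_ghom wB Bt tx) (wtr_bij wB Bt tx)).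
  rewrite -[RHS]/(l _) linear_sum; apply: eq_bigr => n _.
  by rewrite linearZ.
apply: smc_sum => l _; apply: smcM; last exact: smc_dual_coord.
exact: (smc_comp z0 trep (sm i l)).
Qed.

(* The junk value [0] makes this linear for every [x]. *)
Definition coordform tau (l : 'I_#|{: wmon k (ltype tau)}|) (x : wbase B) :
    wfib x -> R^o :=
  fun b => if pselect (wtB tau /\ ldom tau x) is left _
           then fcoord (lm tau x) b 0 l else 0.

Lemma coordform_linear tau l x : linear (@coordform tau l x).
Proof.
move=> a u v; rewrite /coordform; case: pselect => [[Bt tx]|_].
  by rewrite (fcoord_linear (wtr_ghom wB Bt tx) (wtr_bij wB Bt tx)) !mxE.
by rewrite scaler0 addr0.
Qed.

Definition coordpt tau l (x : wbase B) : dual B :=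
  existT _ x (exist _ _ (@coordform_linear tau l x)).

(** Converse of [zdual_smooth]: the entry is the [j]-th fibre coordinate of the image under
    [zdual psi] of [coordpt l], a local section of the dual with constant fibre coordinates. *)
Lemma smc_zmap_basis tauA tauB c x0 j l : smooth (zdual psi) ->
  wtA tauA -> wtB tauB -> ldom tauA (zbase psi x0) -> ldom tauB x0 ->
  charts c -> cdom c x0 ->
  smc c (fun x => fcoord (lm tauB x)
       (zmap psi x (lm tauA (zbase psi x) (wbasis R j))) 0 l) x0.
Proof.
move=> sz At Bt tA tB Bc cx.
have [c' Ac' c'x] := is_manifold_cover mA (zbase psi x0).
have B0 : @charts R (dual B) (dual_chart c tauB) by exists c, tauB.
have A0 : @charts R (dual A) (dual_chart c' tauA) by exists c', tauA.
have ntB := near_ldom wB Bt Bc cx tB.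
have prep : local_rep c (dual_chart c tauB) (coordpt l) x0.
  apply/local_repP; split=> [|i]; first by apply: nearcW ntB => x cx' tx.
  rewrite /=; case: (split_ordP i) => n ->.
    apply: smc_ext (@smc_coord _ _ c x0 n) => x _.
    by rewrite row_mxEl.
  apply: (smc_near (f := fun=> (n == l)%:R)); last exact: smc_cst.
  apply: nearcW ntB => x _ tx; rewrite row_mxEr mxE /= /coordform.
  case: pselect => [_|[]//].
  by rewrite /fcoord winvE ?wcoord_basis //; exact: wtr_bij.
have z0 : cdom (dual_chart c tauB) (coordpt l x0) by [].
have zrep := sz (coordpt l x0) _ _ B0 A0 z0 (conj c'x tA).
have sj := smc_comp z0 zrep (@smc_dual_coord A c' tauA _ j).
apply: smc_near (smc_comp cx prep sj).
apply: nearcW ntB => x _ tx; rewrite /= /coordform.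
by case: pselect => [_|[]].
Qed.

Lemma smc_zmap tauA tauB c x0 (a : weil R k (ltype tauA)) l :
  smooth (zbase psi) -> smooth (zdual psi) ->
  wtA tauA -> wtB tauB -> ldom tauA (zbase psi x0) -> ldom tauB x0 ->
  charts c -> cdom c x0 ->
  smc c (fun x => fcoord (lm tauB x)
       (zmap psi x (lm tauA (zbase psi x) a)) 0 l) x0.
Proof.
move=> sb sz At Bt tA tB Bc cx.
have [c' Ac' c'x] := is_manifold_cover mA (zbase psi x0).
have ntB := near_ldom wB Bt Bc cx tB.
have ntA := nearc_comp cx (sb x0 _ _ Bc Ac' cx c'x) (near_ldom wA At Ac' c'x tA).
apply: (smc_near (f := fun x => \sum_j wcoord a 0 j * fcoord (lm tauB x)
       (zmap psi x (lm tauA (zbase psi x) (wbasis R j))) 0 l)).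
  apply: nearcW (nearcI ntA ntB) => x _ [tAx tBx].
  have gA := wtr_ghom wA At tAx; have gB := wtr_ghom wB Bt tBx.
  rewrite [in RHS](weil_decomp a) (ghom_sum _ _ gA).
  rewrite (ghom_sum _ _ (ghomP (zmap psi x))).
  pose L := GRing.isLinear.Build _ _ _ _ _ (fcoord_linear gB (wtr_bij wB Bt tBx)).
  pose g : {linear wfib x -> _} := HB.pack (fcoord (lm tauB x)) L.
  rewrite -[fcoord _ _ in RHS]/(g _) linear_sum summxE; apply: eq_bigr => j _.
  by rewrite linearZ [RHS]mxE.
by apply: smc_sum => j _; apply: smcZ; exact: smc_zmap_basis.
Qed.

Lemma costar_map_smooth : smooth (zbase psi) -> smooth (zdual psi) ->
  @smooth R (costar B) (costar A) (costar_map psi).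
Proof.
move=> sb sz z.
have [c Bc cx] := is_manifold_cover mB (tag z).
have [c' Ac' c'x] := is_manifold_cover mA (zbase psi (tag z)).
have [_ [_ /(_ (tag z))[tauB [Bt _ tB]]]] := wbundle_cover wB.
have [_ [_ /(_ (zbase psi (tag z)))[tauA [At _ tA]]]] := wbundle_cover wA.
have B0 : @charts R (costar_tot B) (costar_chart c tauB) by exists c, tauB.
have A0 : @charts R (costar_tot A) (costar_chart c' tauA) by exists c', tauA.
have z0 : cdom (costar_chart c tauB) z by [].
have z0' : cdom (costar_chart c' tauA) (costar_map psi z) by [].
apply: (compat_smooth_at (compat_chart (costar_id_smooth wB) B0 z0)
  (compat_chart (costar_id_smooth wA) A0 z0')) => //.
have trep := tag_rep c tauB z.
have brep := sb _ _ _ Bc Ac' cx c'x; have /local_repP[nb sbc] := brep.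
have ntA := nearc_comp cx brep (near_ldom wA At Ac' c'x tA).
apply/local_repP; split=> [|j].
  exact: (nearc_comp (P := fun x => cdom c' (zbase psi x) /\ ldom tauA (zbase psi x))
    z0 trep (nearcI nb ntA)).
rewrite /=; case: (split_ordP j) => i ->.
  apply: smc_ext (smc_comp z0 trep (sbc i)) => z' _.
  by rewrite row_mxEl.
(* The image under [psi] of the [i]-th generator, written in the frame [tauB]; evaluating it at the
   coordinates of the character gives the new coordinate. *)
pose v x := winv (lm tauB x) (zmap psi x (lm tauA (zbase psi x) (wgen R k i))).
apply: (smc_ext (f := fun z => tcoef (wt i) (wev (lam tauB z) (v (tag z))))).
  move=> z' [_ tz']; rewrite row_mxEr mxE -(lamE wB _ Bt tz') /=.
  by rewrite winvK //; exact: (wtr_bij wB Bt tz').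
apply: smc_wev => [|l|l]; first exact: (wt_le (wtr_size wA At)).
  exact: smc_lam.
have := smc_zmap (wgen R k i) l sb sz At Bt tA tB Bc cx.
exact: (smc_comp z0 trep).
Qed.

Lemma costar_map_act t (z : costar B) :
  costar_map psi (act t z) = act t (costar_map psi z).
Proof. by congr existT; exact: ghom_eq. Qed.

End DualSmooth.

(** * Isomorphisms of Weil algebra bundles *)

Section Inverse.
Context (R : realType) (k : nat) (A B : wobj R k).
Local Notation wA := (wP A).
Local Notation wB := (wP B).
Context (psi : wbmor A B) (b' : wbase A -> wbase B).
Local Notation b := (zbase psi).
Hypotheses (sb' : smooth b') (bK : cancel b b') (b'K : cancel b' b).
Hypothesis iso : forall x, is_giso (zmap psi x).

Definition zinv_fun x : ghom (wfib x) (wfib (b x)) :=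
  projT1 (cid (giso_inverse (iso x))).

Lemma zinv_funK x : cancel (zmap psi x) (zinv_fun x).
Proof. by rewrite /zinv_fun; case: cid => g []. Qed.

Lemma zinv_funVK x : cancel (zinv_fun x) (zmap psi x).
Proof. by rewrite /zinv_fun; case: cid => g []. Qed.

(** The inverse fibre map taken at [b' y] lands over [b (b' y)], which is [y] only up to [b'K];
    hence the transport. *)
Definition zinv : zak B A :=
  @Zak R k B A b' (fun y => ghom_comp (castg (b'K y)) (zinv_fun (b' y))).

Lemma zinv_dual_smooth : smooth (zdual zinv).
Proof.
apply: (@zdual_smooth R k B A wB wA zinv sb') => y0.
have [_ [_ /(_ y0)[tauA [At _ tA]]]] := wbundle_cover wA.
have [_ [_ /(_ (b' y0))[tauB [Bt _ tB]]]] := wbundle_cover wB.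
have [c Ac cy] := is_manifold_cover (wbundle_mfd wA) y0.
have [cB Bc cBx] := is_manifold_cover (wbundle_mfd wB) (b' y0).
exists tauB, tauA, c; split=> // j l.
have brep := sb' Ac Bc cy cBx.
have ntA := near_ldom wA At Ac cy tA.
have tA' : ldom tauA (b (b' y0)) by rewrite b'K.
have [cA Ac' cAx] := is_manifold_cover (wbundle_mfd wA) (b (b' y0)).
have ntA' : nearc cB (fun x => ldom tauA (b x)) (b' y0).
  exact: (nearc_comp cBx (wb_smooth Bc Ac' cBx cAx) (near_ldom wA At Ac' cAx tA')).
have ntB := near_ldom wB Bt Bc cBx tB.
(* The frame [tauA] carried to [B] by [psi]. The matrix of the inverse expresses [tauB] in this
   frame, whereas the matrix of [psi] expresses it in [tauB]; [smc_frame] performs the inversion. *)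
pose f x (a : weil R k (ltype tauA)) := zmap psi x (lm tauA (b x) a).
have fP x : ldom tauA (b x) -> is_ghom (f x) /\ bijective (f x).
  move=> tx; split.
    exact: (@is_ghom_comp R _ _ _ (zmap psi x) (GHom (wtr_ghom wA At tx))).
  by apply: bij_comp; [exact: is_giso_bij (iso x)|exact: (wtr_bij wA At tx)].
have sf i : smc cB (fun x => fcoord (f x) (lm tauB x (wbasis R j)) 0 i) (b' y0).
  apply: (smc_frame (f' := fun x => lm tauB x)) => //.
  - by apply: nearcW ntA' => x _; exact: fP.
  - apply: nearcW ntB => x _ tx.
    by split; [exact: (wtr_ghom wB Bt tx)|exact: (wtr_bij wB Bt tx)].
  - move=> i' l'.
    exact: (smc_zmap_basis wA wB i' l' (@wb_dual_smooth _ _ _ _ psi) At Bt).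
  - move=> l'; apply: (smc_near (f := fun=> wcoord (wbasis R j : weil R k _) 0 l')).
      apply: nearcW ntB => x _ tx; rewrite /fcoord winvE //.
      exact: (wtr_bij wB Bt tx).
    exact: smc_cst.
apply: smc_near (smc_comp cy brep (sf l)).
apply: nearcW ntA => y _ ty; rewrite /= /fcoord; congr (wcoord _ 0 l).
have tby : ldom tauA (b (b' y)) by rewrite b'K.
set v := lm tauB (b' y) (wbasis R j).
have fv := winvK (fP _ tby).2 v.
apply: (bij_inj (wtr_bij wA At ty)); rewrite winvK; last exact: (wtr_bij wA At ty).
set w := winv (f (b' y)) v.
rewrite -(castg_section (fun y => lm tauA y w) (b'K y)).
by congr (castg _ _); rewrite -fv /f zinv_funK.
Qed.

Definition wbinv : wbmor B A := @WBMor R k B A zinv sb' zinv_dual_smooth.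

(** Stated for arbitrary equalities so that [e'] can be eliminated; it is applied with
    [x' = b' (b x)]. *)
Lemma zmap_castg x x' (e' : x' = x) (e : b x' = b x) (a : wfib x') :
  zmap psi x (castg e (zinv_fun x' a)) = castg e' a.
Proof. by case: _ / e' e => e; rewrite !castg_id zinv_funVK. Qed.

Lemma wb_iso : @is_iso (FGWAB R k) A B psi.
Proof.
exists wbinv; split; apply: wbmor_eq; apply: zak_ext => //= x e a.
  by rewrite zinv_funK (Prop_irrelevance e (b'K x)).
exact: zmap_castg.
Qed.

End Inverse.

(** * The functors and the units *)

Section StarMap.
Context (R : realType) (k : nat).

(** The fibres over [x] and [x'] consist of the same points of [F], so the transport is invisible on
    underlying points. *)
Lemma castg_homG (F : gbundle R) (x x' : base F) (e : x = x') (alpha : homG k x)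
    (p : fibre x) (p' : fibre x') : sval p = sval p' ->
  (castg (A := star k F) e alpha : homG k x') p' = alpha p.
Proof.
case: _ / e p' => p' pp'; rewrite castg_id.
by congr (homG_fun alpha _); apply: fibre_eq.
Qed.

Section Morphism.
Context (F E : gbobj R k) (f : gbmor F E).
Local Notation gF := (gbP F).
Local Notation gE := (gbP E).

Lemma base_map_smooth : smooth (base_map f).
Proof.
have -> : base_map f = @proj R E \o (f \o (fun x : base F => sval x)).
  by apply/funext => x; apply: base_eq; rewrite /= -gb_act (svalP x).
apply: (@smooth_comp R (base F) E (base E)).
- exact: is_manifold_cover (gbundle_mfd gE).
- apply: (@smooth_comp R (base F) F E).
  + exact: is_manifold_cover (gbundle_mfd gF).
  + exact: sval_base_smooth.
  + exact: gb_smooth.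
- exact: (@proj_smooth R E).
Qed.

Lemma star_map_dual_smooth : smooth (zdual (star_map f)).
Proof.
apply: (@zdual_smooth R k (star k E) (star k F) (star_wbundle gE) (star_wbundle gF)
  (star_map f) base_map_smooth) => x0.
have [phi [tphi dphi phix]] := ftriv_ex gF x0.
have [psi [tpsi dpsi psix]] := ftriv_ex gE (base_map f x0).
exists (ftriv gE tpsi), (ftriv gF tphi), (base_chart phi); split=> //.
- exact: ftriv_wtriv.
- exact: ftriv_wtriv.
- by split=> //; exists phi.
move=> j l.
pose s' (x : base E) : homG k x := lm (ftriv gE tpsi) x (wbasis R j).
pose s (x : base F) : homG k x := star_fun (s' (base_map f x)).
apply: (smc_ftriv_coef (s := s)) => // p phip px.
(* On total spaces the pulled-back section is a mere composition, whose smoothness needs no local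
   computation. *)
have -> : secfun s = secfun s' \o f.
  apply/funext => q; apply/esym.
  exact: (secfunE s' (fibre_map f (to_fibre q))).
apply: (@smooth_at_comp R F E (trunc_mfd R k) f (secfun s')).
- exact: is_manifold_cover (gbundle_mfd gE).
- exact: gb_smooth.
- apply: (@ftriv_section_smooth R k E gE psi tpsi (wbasis R j)).
  by apply/(gtriv_sat tpsi); rewrite -gb_act -[act 0 p]/(sval (proj p)) px.
Qed.

Definition star_mor : wbmor (star k E) (star k F) :=
  @WBMor R k _ _ (star_map f) base_map_smooth star_map_dual_smooth.

End Morphism.

Definition star_obj (F : GB R k) : FGWAB R k := WObj (star_wbundle (gbP F)).

Lemma star_mor_id (F : gbobj R k) : star_mor (gb_id F) = wb_id (star_obj F).
Proof.
apply: wbmor_eq; apply: zak_ext => [x|x e a]; first exact: base_eq.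
by apply: homG_eq => p; rewrite (castg_homG _ _ (p := fibre_map (gb_id F) p)).
Qed.

Lemma star_mor_comp (F E G : gbobj R k) (g : gbmor E G) (f : gbmor F E) :
  star_mor (gb_comp g f) =
  @wb_comp R k (star_obj G) (star_obj E) (star_obj F) (star_mor f) (star_mor g).
Proof.
apply: wbmor_eq; apply: zak_ext => [x|x e a]; first exact: base_eq.
by apply: homG_eq => p; rewrite /= (castg_homG _ _ (p := fibre_map (gb_comp g f) p)).
Qed.

Definition star_functor : @cofunctor (GB R k) (FGWAB R k) star_obj :=
  @CoFunctor (GB R k) (FGWAB R k) star_obj (fun F E f => star_mor f)
    star_mor_id star_mor_comp.

Definition costar_obj (A : FGWAB R k) : GB R k := GBObj (costar_gbundle (wP A)).

Definition costar_mor (B A : wobj R k) (phi : wbmor B A) :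
    gbmor (costar A) (costar B) :=
  @GBMor R (costar A) (costar B) (costar_map phi)
    (costar_map_smooth (wP B) (wP A) (@wb_smooth _ _ _ _ phi) (@wb_dual_smooth _ _ _ _ phi))
    (costar_map_act phi).

Lemma costar_mor_id (A : wobj R k) : costar_mor (wb_id A) = gb_id (costar_obj A).
Proof.
by apply: gbmor_eq => -[x psi]; congr existT; exact: ghom_eq.
Qed.

Lemma costar_mor_comp (A B C : wobj R k) (g : wbmor B C) (f : wbmor A B) :
  costar_mor (wb_comp g f) =
  @gb_comp R k (costar_obj C) (costar_obj B) (costar_obj A) (costar_mor f) (costar_mor g).
Proof. by apply: gbmor_eq => -[x psi]; congr existT; exact: ghom_eq. Qed.

Definition costar_functor : @cofunctor (FGWAB R k) (GB R k) costar_obj :=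
  @CoFunctor (FGWAB R k) (GB R k) costar_obj (fun B A phi => costar_mor phi)
    costar_mor_id costar_mor_comp.

End StarMap.

(** * The unit on graded bundles: points as evaluation characters *)

Section Evaluation.
Context (R : realType) (k : nat) (F : gbobj R k).
Local Notation gF := (gbP F).
Local Notation SF := (star k F).

Fact eval_ghom (p : F) :
  @is_ghom R (homG_galg k (proj p)) (trunc R k)
    (fun alpha : homG k (proj p) => alpha (to_fibre p)).
Proof. by split=> //= i a ai; exact: ai. Qed.

Definition eval_pt (p : F) : costar SF :=
  existT (fun x : base F => ghom (homG_galg k x) (trunc R k)) (proj p) (GHom (eval_ghom p)).

Lemma eval_pt_act t p : eval_pt (act t p) = act t (eval_pt p).
Proof.
have e : proj (act t p) = proj p by apply: base_eq; exact: act00.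
apply: (@costar_ext R k SF (eval_pt (act t p)) (act t (eval_pt p)) e) => alpha /=.
rewrite -homG_act; apply/esym.
exact: castg_homG.
Qed.

Section Chart.
Context (phi : gtriv F) (tphi : is_gtriv phi) (dphi : size (gtype phi) = k).

Lemma lam_eval_pt p : gdom phi p ->
  @lam R k SF (ftriv gF tphi) (eval_pt p) = gfib phi p.
Proof.
move=> phip; rewrite -[RHS](wevK dphi); apply/rowP => j; rewrite !mxE.
congr tcoef; apply: (ftrivE gF tphi (wgen R k j) (to_fibre p)).
exact/(proj_dom _ tphi).
Qed.

Definition eval_chart := @costar_chart R k SF (base_chart phi) (ftriv gF tphi).

Lemma eval_chart_charts : @charts R (costar_tot SF) eval_chart.
Proof.
exists (base_chart phi), (ftriv gF tphi); split=> //; last exact: ftriv_wtriv.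
by exists phi.
Qed.

End Chart.

Lemma eval_pt_smooth : smooth eval_pt.
Proof.
move=> p.
have [phi [tphi dphi phix]] := ftriv_ex gF (proj p).
have phip : gdom phi p by exact/(gtriv_sat tphi).
have z0 : cdom (eval_chart tphi) (eval_pt p) by [].
have C0 := compat_chart (costar_id_smooth (star_wbundle gF)) (eval_chart_charts tphi dphi) z0.
apply: (compat_smooth_at (compat_gtriv tphi phip) C0) => //.
apply/local_repP; split=> [|j].
  by apply: nearcT => q phiq; split; exact/(proj_dom _ tphi).
rewrite /=; case: (split_ordP j) => i ->.
  apply: smc_ext (@smc_gbase R F phi p i) => q phiq.
  by rewrite row_mxEl /= gbase_proj.
apply: smc_ext (@smc_gfib R F phi p i) => q phiq.
by rewrite row_mxEr -(lam_eval_pt tphi dphi phiq).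
Qed.

Lemma eval_pt_bij : bijective eval_pt.
Proof.
apply: inj_surj_bijective => [p q e|z].
  have [phi [tphi dphi phix]] := ftriv_ex gF (proj p).
  have phip : gdom phi p by exact/(gtriv_sat tphi).
  have pq : act 0 p = act 0 q by exact: (congr1 (fun z => sval (tag z)) e).
  have phiq : gdom phi q by apply/(gtriv_sat tphi); rewrite -pq.
  apply: (gtriv_inj tphi) => //.
    by rewrite -(gbase_proj tphi phip) pq gbase_proj.
  by rewrite -(lam_eval_pt tphi dphi phip) -(lam_eval_pt tphi dphi phiq) e.
have [phi [tphi dphi phix]] := ftriv_ex gF (tag z).
(* The preimage of the character [z] is the point over its base point whose fibre coordinates are
   the coordinates of [z]. *)
pose y := @lam R k SF (ftriv gF tphi) z.
have [phiq _ qy aq] := gptP y tphi phix.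
have qz : proj (gpt (phi := phi) y (sval (tag z))) = tag z.
  by apply: base_eq; rewrite /= aq (svalP (tag z)).
exists (gpt (phi := phi) y (sval (tag z))).
apply: (lam_inj (star_wbundle gF) (ftriv_wtriv gF tphi dphi)) => //.
  exact/(proj_dom _ tphi).
by rewrite lam_eval_pt.
Qed.

Definition eval_mor : gbmor F (costar SF) :=
  @GBMor R F (costar SF) eval_pt eval_pt_smooth eval_pt_act.

Lemma eval_pt_inv_smooth (g : costar SF -> F) :
  cancel eval_pt g -> cancel g eval_pt -> smooth g.
Proof.
move=> fK gK z.
have tagE z' : proj (g z') = tag z' by rewrite -[in RHS](gK z').
have [phi [tphi dphi phix]] := ftriv_ex gF (tag z).
have gdomE z' : gdom phi (sval (tag z')) -> gdom phi (g z').
  by rewrite -tagE => H; exact/(gtriv_sat tphi).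
have z0 : cdom (eval_chart tphi) z by [].
have C0 := compat_chart (costar_id_smooth (star_wbundle gF)) (eval_chart_charts tphi dphi) z0.
apply: (compat_smooth_at C0 (compat_gtriv tphi (gdomE _ phix))) => //.
  exact: gdomE.
apply/local_repP; split=> [|j]; first by apply: nearcT => z' [+ _]; exact: gdomE.
rewrite /=; case: (split_ordP j) => i ->.
  apply: smc_ext (@smc_coord _ _ (eval_chart tphi) z (lshift _ i)) => z' [phiz' _].
  by rewrite /= !row_mxEl -tagE /= gbase_proj //; exact: gdomE.
apply: smc_ext (@smc_lam R k SF (base_chart phi) (ftriv gF tphi) z i) => z' [phiz' _].
by rewrite row_mxEr -(lam_eval_pt tphi dphi (gdomE _ phiz')) gK.
Qed.

Lemma eval_mor_iso :
  @is_iso (GB R k) F (costar_obj (star_obj F)) eval_mor.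
Proof.
have [g fK gK] := eval_pt_bij.
have gact t z : g (act t z) = act t (g z).
  by apply: (can_inj fK); rewrite gK eval_pt_act gK.
exists (@GBMor R (costar SF) F g (eval_pt_inv_smooth fK gK) gact).
by split; apply: gbmor_eq => z; rewrite /= ?fK ?gK.
Qed.

End Evaluation.

Lemma eval_natural (R : realType) (k : nat) (F E : gbobj R k) (f : gbmor F E) p :
  costar_map (star_map f) (eval_pt p) = eval_pt (f p).
Proof.
have e : base_map f (proj p) = proj (f p) by apply: base_eq; exact: gb_act.
apply: (@costar_ext R k (star k E) (costar_map (star_map f) (eval_pt p))
  (eval_pt (f p)) e) => alpha.
by apply/esym; exact: castg_homG.
Qed.

(** * The unit on Weil algebra bundles: biduality *)

Section DoubleDual.
Context (R : realType) (k : nat) (A : wobj R k).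
Local Notation wA := (wP A).
Local Notation CA := (costar A).
Local Notation gC := (costar_gbundle wA).
Local Notation SC := (star k CA).
Local Notation wtr tau := (@wtrivs R k A tau).

(** A base point of [costar A] is a character fixed by the action of 0, that is, one vanishing in
    positive weights. There is exactly one over each point of the base of [A]. *)
Definition dbase (x : base CA) : wbase A := tag (sval x).

Lemma fibre_tag (x : base CA) (p : fibre x) : dbase x = tag (sval p).
Proof. exact: (congr1 (fun z : costar_tot A => tag z) (esym (fibreP p))). Qed.

(* The biduality pairing [psi |-> psi a], up to the transport of [a] to the fibre
   of [A] in which [psi] lives. *)
Definition dfun (x : base CA) (a : wfib (dbase x)) (p : fibre x) : trunc R k :=
  (tagged (sval p : costar_tot A) : ghom _ (trunc R k)) (castg (fibre_tag p) a).

Lemma adapted_ex (y : wbase A) : exists c tau,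
  [/\ @charts R (wbase A) c, wtr tau, cdom c y & ldom tau y].
Proof.
have [c Ac cy] := is_manifold_cover (wbundle_mfd wA) y.
have [_ [_ /(_ y)[tau [At _ ty]]]] := wbundle_cover wA.
by exists c, tau.
Qed.

(** In a trivialization the transport disappears and the pairing is evaluation at fibre coordinates,
    so that its smoothness is that of [ftriv]. *)
Lemma dfunE c tau (x : base CA) (a : wfib (dbase x)) (p : fibre x) :
  wtr tau -> ldom tau (dbase x) ->
  dfun a p = wev (gfib (ctriv c tau) (sval p)) (winv (lm tau (dbase x)) a).
Proof.
move=> At tx; have tp : ldom tau (tag (sval p)) by rewrite -(fibre_tag p).
apply: etrans (lamE wA (winv (lm tau (dbase x)) a) At tp).
apply: (congr1 (fun u => (tagged (sval p : costar_tot A) : ghom _ (trunc R k)) u)).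
rewrite -[in LHS](winvK (wtr_bij wA At tx) a).
exact: (castg_section (fun y => lm tau y (winv (lm tau (dbase x)) a)) (fibre_tag p)).
Qed.

Lemma dfun_smooth (x : base CA) (a : wfib (dbase x)) :
  @smooth R (fibre x) (trunc_mfd R k) (dfun a).
Proof.
have [c [tau [Ac At cx tx]]] := adapted_ex (dbase x).
have -> : dfun a = fun p =>
    wev (gfib (ctriv c tau) (sval p)) (winv (lm tau (dbase x)) a).
  by apply/funext => p; exact: dfunE.
exact: (@ftriv_smooth R k CA gC (ctriv c tau) (ctriv_gtriv wA Ac At) x (conj cx tx)).
Qed.

Lemma dfun_act (x : base CA) (a : wfib (dbase x)) t (p : fibre x) :
  dfun a (fibre_act t p) = tdil t (dfun a p).
Proof.
rewrite /dfun /=; congr (tdil t (ghom_fun _ _)).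
by congr (ghom_fun (castg _) _); exact: Prop_irrelevance.
Qed.

Definition dhom (x : base CA) (a : wfib (dbase x)) : homG_galg k x :=
  HomG (@dfun_smooth x a) (@dfun_act x a).

Lemma dhom_ghom (x : base CA) : is_ghom (@dhom x).
Proof.
have H p := ghomP (ghom_comp (tagged (sval p : costar_tot A) : ghom _ (trunc R k))
                             (castg (@fibre_tag x p))).
split=> [c a b||i a ai p]; [|split=> [|a b]|]; try apply: homG_eq => p;
  have [lin [e1 eM] eg] := H p.
- exact: lin.
- exact: e1.
- exact: eM.
- exact: eg.
Qed.

Definition dzak : zak A SC :=
  @Zak R k A SC dbase (fun x => GHom (@dhom_ghom x)).

Section Adapted.
Context (c : chart R (wbase A)) (tau : ltriv k (wfib (w := A))).
Context (Ac : charts c) (At : wtr tau).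
Local Notation phi := (ctriv c tau).
Local Notation tphi := (ctriv_gtriv wA Ac At).

Lemma dhom_ftriv (x : base CA) (w : weil R k (ltype tau)) : gdom phi (sval x) ->
  dhom (lm tau (dbase x) w : wfib (dbase x)) = lm (ftriv gC tphi) x w.
Proof.
move=> phix; apply: homG_eq => p.
have e := @ftrivE R k CA gC phi tphi x w p phix.
apply: etrans (esym e); rewrite /=.
apply: etrans (dfunE c _ _ At phix.2) _.
by rewrite winvE //; exact: (wtr_bij wA At phix.2).
Qed.

Lemma dhom_giso (x : base CA) : gdom phi (sval x) -> is_giso (@dhom x).
Proof.
move=> phix; have tx : ldom tau (dbase x) := phix.2.
have bt := wtr_bij wA At tx.
have [gf bf rf] := ftriv_giso gC tphi phix.
have E a : dhom a = lm (ftriv gC tphi) x (winv (lm tau (dbase x)) a).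
  by rewrite -(dhom_ftriv _ phix) winvK.
split; first exact: dhom_ghom.
- have bw : bijective (winv (lm tau (dbase x))).
    by exists (lm tau (dbase x)); [exact: winvK|exact: winvE].
  have -> : @dhom x = lm (ftriv gC tphi) x \o winv (lm tau (dbase x)).
    by apply/funext => a; exact: E.
  exact: bij_comp.
- move=> i a; rewrite E => /rf ai; rewrite -(winvK bt a).
  by have [_ _] := wtr_ghom wA At tx; apply.
Qed.

End Adapted.

Lemma dbase_smooth : smooth dbase.
Proof.
apply: (@smooth_comp R (base CA) CA (wbase A) (fun x => sval x)
  (fun z : costar_tot A => tag z)).
- exact: costar_cover wA.
- exact: sval_base_smooth.
- exact: (tag_smooth wA).
Qed.

Lemma dzak_dual_smooth : smooth (zdual dzak).
Proof.
apply: (@zdual_smooth R k A SC wA (star_wbundle gC) dzak dbase_smooth) => x0.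
have [c [tau [Ac At cx tx]]] := adapted_ex (dbase x0).
pose tphi := ctriv_gtriv wA Ac At.
exists tau, (ftriv gC tphi), (base_chart (ctriv c tau)); split=> //.
- by apply: ftriv_wtriv; exact: (wtr_size wA At).
- by split=> //; exists (ctriv c tau).
(* [dhom] carries the frame [tau] to the frame [ftriv], so its matrix is constant. *)
move=> j l; apply: (smc_ext (f := fun=> wcoord (wbasis R j : weil R k _) 0 l)).
  move=> x phix; rewrite /=.
  have -> := dhom_ftriv Ac At (wbasis R j) phix.
  rewrite /fcoord winvE //; exact: is_giso_bij (ftriv_giso gC tphi phix).
exact: smc_cst.
Qed.

Definition dmor : wbmor A SC := @WBMor R k A SC dzak dbase_smooth dzak_dual_smooth.

Lemma dbase_inj (x x' : base CA) : dbase x = dbase x' -> x = x'.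
Proof.
move=> e; have [c [tau [Ac At cx tx]]] := adapted_ex (dbase x).
have tphi := ctriv_gtriv wA Ac At.
have phix : gdom (ctriv c tau) (sval x) by [].
have phix' : gdom (ctriv c tau) (sval x') by rewrite /= -/(dbase x') -e.
apply: base_eq; apply: (lam_inj wA At) => //.
by have := gfib_base tphi phix; rewrite /= => ->; have := gfib_base tphi phix'.
Qed.

Lemma dbase_surj (y : wbase A) : exists x, dbase x = y.
Proof.
have [c [tau [Ac At cy ty]]] := adapted_ex y.
have [z [zy _]] := cpt_ex wA 0 At ty.
by exists (@proj R CA z).
Qed.

Lemma dbase_inv_smooth (b' : wbase A -> base CA) : cancel b' dbase -> smooth b'.
Proof.
move=> bK y; have [c [tau [Ac At cy ty]]] := adapted_ex y.
have tphi := ctriv_gtriv wA Ac At.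
have phiy : gdom (ctriv c tau) (sval (b' y)) by rewrite /= -/(dbase (b' y)) bK.
have bc : @charts R (base CA) (base_chart (ctriv c tau)) by exists (ctriv c tau).
apply: (compat_smooth_at (compat_chart (transition_smooth (wbundle_mfd wA)) Ac cy)
  (compat_chart (base_id_smooth gC) bc phiy)) => //.
apply/local_repP; split=> [|j].
  apply: nearcW (near_ldom wA At Ac cy ty) => y' cy' ty'.
  by rewrite /= -/(dbase (b' y')) bK.
apply: smc_ext (@smc_coord _ _ c y j) => y' _.
by rewrite /= -/(dbase (b' y')) bK.
Qed.

Lemma dmor_iso : @is_iso (FGWAB R k) A (star_obj (costar_obj A)) dmor.
Proof.
have [b' bK b'K] := inj_surj_bijective dbase_inj dbase_surj.
apply: (@wb_iso R k A (star_obj (costar_obj A)) dmor b') => //.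
  exact: dbase_inv_smooth.
move=> x; have [c [tau [Ac At cx tx]]] := adapted_ex (dbase x).
exact: (@dhom_giso c tau Ac At x (conj cx tx)).
Qed.

End DoubleDual.

Section Naturality.
Context (R : realType) (k : nat).

Lemma castg_zmap (A B : wbundle R k) (f : zak A B) (x x' : wbase B) (e : x = x')
    (e' : zbase f x = zbase f x') a :
  castg e (zmap f x a) = zmap f x' (castg e' a).
Proof. by case: _ / e e' => e'; rewrite !castg_id. Qed.

(** The two composites have convertible base maps, so only fibre maps are compared; they differ by
    moving a transport across [f]. *)
Lemma dmor_natural (A B : wobj R k) (f : wbmor A B) :
  @wb_comp R k A (star_obj (costar_obj A)) (star_obj (costar_obj B))
    (star_mor (costar_mor f : gbmor (costar_obj B) (costar_obj A))) (dmor A) =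
  @wb_comp R k A B (star_obj (costar_obj B)) (dmor B) f.
Proof.
apply: wbmor_eq; apply: zak_eq => x a; apply: homG_eq => p /=.
have e := castg_zmap (fibre_tag p) (fibre_tag (fibre_map (costar_mor f) p)) a.
exact: (congr1 (fun u => (tagged (sval p : costar_tot B) : ghom _ (trunc R k)) u) (esym e)).
Qed.

End Naturality.

(* The libraries shadow [hom] and [fmap]. *)
Import Defs.

(** The existential quantifiers leave no freedom: [hstar] and [hcostar] are proofs, and the
    equations fix both functors on morphisms, a morphism being determined by its underlying map or
    Zakrzewski morphism. *)
Theorem theorem4p16 (R : realType) (k : nat) :
  exists (hstar : forall F : GB R k, is_wbundle (star k F))
         (hcostar : forall A : FGWAB R k, is_gbundle k (costar A))
         (S : @cofunctor (GB R k) (FGWAB R k) (fun F => WObj (hstar F)))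
         (T : @cofunctor (FGWAB R k) (GB R k) (fun A => GBObj (hcostar A))),
    [/\ forall (F E : GB R k) (f : hom F E), wb_zak (fmap S f) = star_map f,
        forall (B A : FGWAB R k) (phi : hom B A),
          gb_fun (fmap T phi) = @costar_map R k B A (wb_zak phi) &
        dual_equivalence S T].
Proof.
exists (fun F => star_wbundle (gbP F)), (fun A => costar_gbundle (wP A)),
  (star_functor R k), (costar_functor R k); split=> //; split.
- exists (fun F => eval_mor F); split=> [F|F E f]; first exact: eval_mor_iso.
  by apply: gbmor_eq => p; exact: eval_natural.
- exists (fun A => dmor A); split=> [A|A B f]; first exact: dmor_iso.
  exact: dmor_natural.
Qed.
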